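(* Let $n\ge2$ and $u\in C_c^2(\mathbb H^n\setminus\{0\})$. Then $$\|\Delta_{\mathbb H}u\|^2=\|\Delta_{\rho,\mathbb H}u\|^2+\|(\Delta_{\mathbb H}-\Delta_{\rho,\mathbb H})u\|^2+2\sum_{j=1}^n\|\partial_\rho(\mathcal L_ju)\|^2-2\sum_{j=1}^n\|\mathcal L_ju\|^2-2\sum_{j=1}^n\Big\|\frac{\mathcal L_ju}{\sinh\rho}\Big\|^2 .$$ Moreover, $$\|\Delta_{\mathbb H}u\|^2\ge\|\Delta_{\rho,\mathbb H}u\|^2+\frac12\sum_{j=1}^n\Big\|\frac{\mathcal L_ju}{\rho}\Big\|^2+\frac{(n+1)(n-3)}{2}\sum_{j=1}^n\|\coth\rho\,\mathcal L_ju\|^2 .$$ Consequently, if $n\ge3$, then $\|\Delta_{\mathbb H}u\|\ge\|\Delta_{\rho,\mathbb H}u\|$ for all $u\in C_c^2(\mathbb H^n\setminus\{0\})$.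
   Context: $\mathbb H^n$ denotes the Poincaré ball model of hyperbolic space: the unit ball $\{x\in\mathbb R^n:|x|<1\}$ with metric $\frac{4|dx|^2}{(1-|x|^2)^2}$. Write $r=|x|$ and $\rho=\ln\frac{1+r}{1-r}$ (hyperbolic distance to the origin), $\partial_\rho=\frac{1-r^2}{2}\partial_r$ where $\partial_r=\sum_i\frac{x_i}{r}\partial_{x_i}$. $\Delta_{\mathbb H}$ is the Laplace–Beltrami operator of $\mathbb H^n$, $\Delta_{\rho,\mathbb H}=\partial_\rho^2+(n-1)\coth\rho\,\partial_\rho$ its radial part, and $\mathcal L_j=\frac{1-r^2}{2}\big(\partial_{x_j}-\frac{x_j}{r}\partial_r\big)$ for $1\le j\le n$. $\|\cdot\|$ is the norm of $L^2(\mathbb H^n)$ with respect to the hyperbolic volume measure. *)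

(* Defs.v *)
(* Poincare ball model of H^n inside R^n = 'rV[R]_n. *)
From HB Require Import structures.
From mathcomp Require Import all_boot all_order all_algebra.
From mathcomp Require Import all_classical all_reals all_analysis.
Set Implicit Arguments. Unset Strict Implicit. Unset Printing Implicit Defensive.
Import Order.TTheory GRing.Theory Num.Theory.
Import numFieldNormedType.Exports.
Local Open Scope classical_set_scope.
Local Open Scope ring_scope.

Section Hyperbolic.
Variables (R : realType) (n : nat).
Notation V := 'rV[R]_n.

Definition ebasis (i : 'I_n) : V := delta_mx 0 i.
Definition partial (i : 'I_n) (u : V -> R) : V -> R :=
  fun x => 'D_(ebasis i) u x.

(* Euclidean norm r = |x| (NB: the library norm on 'rV is the sup norm) *)
Definition rad (x : V) : R := Num.sqrt (\sum_(i < n) x 0 i ^+ 2).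

(* hyperbolic distance to the origin *)
Definition rho (x : V) : R := ln ((1 + rad x) / (1 - rad x)).

Definition sinh (t : R) : R := (expR t - expR (- t)) / 2.
Definition cosh (t : R) : R := (expR t + expR (- t)) / 2.
Definition coth (t : R) : R := cosh t / sinh t.

(* conformal factor: g = lambda^2 |dx|^2 *)
Definition lam (x : V) : R := 2 / (1 - rad x ^+ 2).

Definition d_r (u : V -> R) : V -> R :=
  fun x => \sum_(i < n) (x 0 i / rad x) * partial i u x.
Definition d_rho (u : V -> R) : V -> R :=
  fun x => (1 - rad x ^+ 2) / 2 * d_r u x.

(* Laplace-Beltrami operator of g = lambda^2 delta in coordinates:
   (1/sqrt g) d_i (sqrt g g^{ij} d_j u) = lambda^{-n} sum_i d_i (lambda^{n-2} d_i u) *)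
Definition lapH (u : V -> R) : V -> R :=
  fun x => (lam x ^+ n)^-1 *
    \sum_(i < n) partial i (fun y => lam y ^+ (n - 2) * partial i u y) x.

Definition lapRho (u : V -> R) : V -> R :=
  fun x => d_rho (d_rho u) x + (n%:R - 1) * coth (rho x) * d_rho u x.

Definition Lop (j : 'I_n) (u : V -> R) : V -> R :=
  fun x => (1 - rad x ^+ 2) / 2 * (partial j u x - x 0 j / rad x * d_r u x).

(* Lebesgue integral over R^n, as the iterated integral of 1-dimensional
   Lebesgue integrals (all integrands used below are continuous with
   compact support, for which this coincides with the n-dim integral). *)
Fixpoint iint (m : nat) : ('rV[R]_m -> R) -> R :=
  match m with
  | 0 => fun f => f 0
  | m'.+1 => fun f =>
      Rintegral (@lebesgue_measure R) setT
        (fun t : R => iint (fun v : 'rV[R]_m' => f (row_mx (t%:M : 'rV[R]_1) v)))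
  end.

Definition hvol (x : V) : R := if rad x < 1 then lam x ^+ n else 0.

Definition hnorm (f : V -> R) : R :=
  Num.sqrt (iint (fun x => f x ^+ 2 * hvol x)).

(* u in C^2_c(H^n \ {0}) (extended by 0 to R^n) *)
Definition C2 (u : V -> R) : Prop :=
  continuous u /\
  (forall i x, derivable u x (ebasis i)) /\
  (forall i, continuous (partial i u)) /\
  (forall i j x, derivable (partial i u) x (ebasis j)) /\
  (forall i j, continuous (partial j (partial i u))).

Definition C2c_punctured_ball (u : V -> R) : Prop :=
  C2 u /\
  exists K : set V, compact K /\
    K `<=` [set x | 0 < rad x < 1] /\
    (forall x, ~ K x -> u x = 0).

End Hyperbolic.

(* Main.v *)
(**
Everything is computed in Cartesian coordinates on the punctured ball. With
[E = r d/dr] and [delta_j = r (d_j - (x_j / r^2) E)] (the spherical gradient) one has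
[L_j = delta_j / sinh rho], so that [Delta - Delta_rho] is the spherical
Laplacian divided by [sinh^2 rho]. Expanding the square, the identity reduces to
an integration by parts in the cross term [<Delta_rho u, (Delta - Delta_rho) u>].
As [u] is only [C^2], third derivatives are avoided through the weak
identity [int d_i A d_l b = int d_l A d_i b] for [C^1] functions, obtained with
difference quotients.

For the lower bound, the radial term [sum_j |d_rho L_j u|^2] is bounded below by
a one-dimensional Hardy inequality, i.e. by integrating the square
[(d_rho v + g v)^2] for the ground state slope [g = (n-1)/2 coth rho - 1/(2 rho)],
and the spherical term is bounded below by the Poincare inequality
[|Delta_S u|^2 >= (n-1) |grad_S u|^2]. For [n >= 3] the latter is Bochner's
formula together with Cauchy-Schwarz on the trace of the spherical Hessian. For
[n = 2], where this argument degenerates, it is Wirtinger's inequality on each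
circle, integrated against the plane by rotation invariance of the Lebesgue
integral.
*)
Require Import Defs.
From HB Require Import structures.
From mathcomp Require Import all_boot all_order all_algebra.
From mathcomp Require Import all_classical all_reals all_analysis.
From mathcomp Require Import ring lra.
Set Implicit Arguments. Unset Strict Implicit. Unset Printing Implicit Defensive.
Import Order.TTheory GRing.Theory Num.Theory.
Import numFieldNormedType.Exports.
Local Open Scope classical_set_scope.
Local Open Scope ring_scope.
(* mathcomp exports another [rad]. *)
Local Notation rad := Defs.rad.

(** * Uniformly continuous functions of bounded support *)

Section UniformContinuity.
Variables (R : realType).

(** The integral is an iterated one-dimensional one, so linearity, translation invariance and
    exchange of integrals are all proved by induction on the dimension or through Riemann sums, and
    limits pass under it only as uniform limits with a common support. Derivatives are directional
    throughout, and regularity enters through the mean value theorem on lines. The coefficients blow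
    up at the origin or on the unit sphere, so formulas are computed on the punctured ball and
    extended by vanishing off the compact set [K].

    The constants fit together as follows. Twice the Hardy inequality loses (n - 1) |L_j u / sinh
    rho|^2, which is exactly what the sharp Poincare constant n - 1 returns from |(Delta -
    Delta_rho) u|^2. What remains of the coth terms is 2 ((n - 1) / 2)^2 - 2 = (n + 1)(n - 3) / 2.
    Any smaller Poincare constant would leave a negative term in 1 / sinh rho, which is why n = 2
    also calls for the sharp inequality, and hence for Wirtinger. *)

Definition ucont (V W : normedZmodType R) (f : V -> W) : Prop :=
  forall e : R, 0 < e -> exists2 d : R, 0 < d &
    forall x y, `|x - y| < d -> `|f x - f y| < e.

Definition supp_in (V : normedZmodType R) (M : R) (f : V -> R) : Prop :=
  forall x, M < `|x| -> f x = 0.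

(** This class is stable under slicing and under integration in one variable, so an induction on the
    dimension of an iterated integral never leaves it. *)
Definition ucs (V : normedZmodType R) (f : V -> R) : Prop :=
  ucont f /\ exists M : R, supp_in M f.

Lemma ucont_continuous (V : normedModType R) (f : V -> R) :
  ucont f -> continuous f.
Proof.
move=> fu x; apply/cvgrPdist_lt => e /fu[d d0 fd].
near=> y; apply: fd; near: y; apply/nbhs_ballP; exists d => // y /=.
by rewrite -ball_normE.
Unshelve. all: by end_near. Qed.

(** Heine-Cantor on the closed ball of radius [M + 1]. The extra unit settles the remaining pairs:
    if [x] lies outside that ball and [y] is within 1 of it, both are outside the support. *)
Lemma continuous_ucs n (f : 'rV[R]_n -> R) (M : R) :
  continuous f -> supp_in M f -> ucont f.
Proof.
move=> fc fs e e0.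
have cB : compact [set x : 'rV[R]_n | `|x| <= M + 1].
  apply: bounded_closed_compact.
    exists (M + 1); split; first exact: num_real.
    by move=> y My x /= /le_trans; apply; exact: ltW.
  rewrite (_ : [set _ | _] = (fun x : 'rV[R]_n => `|x|) @^-1` [set t | t <= M + 1])//.
  by apply: closed_comp => [x _|]; [exact: norm_continuous|exact: closed_le].
have /compact_near_coveringP cov := cB.
have := cov R (0^'+) (fun d x => forall y, `|x - y| < d -> `|f x - f y| < e) _.
case.
  move=> x xB; have e20 : 0 < e / 2 by rewrite divr_gt0.
  have /cvgrPdist_lt/(_ _ e20)/nbhs_ballP[d /= d0 fd] := fc x.
  exists (ball x (d / 2), [set t | t < d / 2]); first split => /=.
  - by apply: nbhsx_ballx; rewrite divr_gt0.
  - by apply: nbhs_right_lt; rewrite divr_gt0.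
  move=> [x' t] /= [xx' td] y xy.
  have h1 : `|f x - f x'| < e / 2.
    by apply: fd; apply: le_ball xx'; lra.
  have h2 : `|f x - f y| < e / 2.
    apply: fd; move: xx'; rewrite -!ball_normE /= => xx'.
    rewrite -(subrKA x') (le_lt_trans (ler_normD _ _))//; lra.
  rewrite -(subrKA (f x)) (le_lt_trans (ler_normD _ _))// distrC; lra.
move=> d /= d0 dP.
have d20 : 0 < Num.min (d / 2) 1 by rewrite lt_min ltr01 andbT divr_gt0.
exists (Num.min (d / 2) 1) => // x y.
rewrite lt_min => /andP[xyd xy1].
have [xM|xM] := leP `|x| (M + 1).
  apply: (dP (d / 2)) => //=.
    rewrite /= sub0r normrN gtr0_norm ?divr_gt0//; lra.
  by rewrite divr_gt0.
have yM : M < `|y|.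
  have := ler_normD (x - y) y; rewrite subrK; lra.
rewrite (fs x) ?(fs y)// ?subrr ?normr0//; lra.
Qed.

Lemma ucont_lin (V : normedZmodType R) (f g : V -> R) (a : R) :
  ucont f -> ucont g -> ucont (fun x => a * f x + g x).
Proof.
move=> fu gu e e0.
have a1 : 0 < `|a| + 1 by have := normr_ge0 a; lra.
have e1 : 0 < e / 2 / (`|a| + 1) by rewrite !divr_gt0.
have e2 : 0 < e / 2 by rewrite !divr_gt0.
have [d1 d10 h1] := fu _ e1; have [d2 d20 h2] := gu _ e2.
exists (Num.min d1 d2) => [|x y]; first by rewrite lt_min d10.
rewrite lt_min => /andP[/h1 {}h1 /h2 {}h2].
have -> : a * f x + g x - (a * f y + g y) = a * (f x - f y) + (g x - g y) by ring.
rewrite (le_lt_trans (ler_normD _ _))// normrM.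
have : `|a| * `|f x - f y| <= `|a| * (e / 2 / (`|a| + 1)).
  by apply: ler_wpM2l => //; exact: ltW.
have : `|a| * (e / 2 / (`|a| + 1)) <= e / 2.
  rewrite mulrCA; apply: ler_piMr; first exact: ltW.
  by rewrite ler_pdivrMr// mul1r; lra.
lra.
Qed.

Lemma supp_in_le (V : normedZmodType R) (M N : R) (f : V -> R) :
  M <= N -> supp_in M f -> supp_in N f.
Proof. by move=> MN fM x Nx; apply: fM; exact: le_lt_trans Nx. Qed.

Lemma ucs_supp (V : normedZmodType R) (f : V -> R) :
  ucs f -> exists2 M : R, 0 <= M & supp_in M f.
Proof.
move=> [_ [M fM]]; exists (Num.max 0 M); first by rewrite le_max lexx.
by apply: supp_in_le fM; rewrite le_max lexx orbT.
Qed.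

Lemma ucs_lin (V : normedZmodType R) (f g : V -> R) (a : R) :
  ucs f -> ucs g -> ucs (fun x => a * f x + g x).
Proof.
move=> [fu [M fM]] [gu [N gN]]; split; first exact: ucont_lin.
exists (Num.max M N) => x; rewrite gt_max => /andP[Mx Nx].
by rewrite fM// gN// mulr0 addr0.
Qed.

End UniformContinuity.

(** * One-dimensional integrals *)

Section Integral1.
Variables (R : realType).
Local Notation mu := (@lebesgue_measure R).

Lemma Rintegral_supp (f : R -> R) (a b : R) :
  (forall t, t \notin `[a, b] -> f t = 0) ->
  Rintegral mu setT f = Rintegral mu `[a, b] f.
Proof.
move=> f0; rewrite [RHS]Rintegral_mkcond; congr Rintegral.
apply/funext => t; rewrite patchE; case: ifPn => //.
by rewrite mem_setE => /f0.
Qed.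

Lemma supp_in_itv (f : R -> R) (M : R) :
  supp_in M f -> forall t, t \notin `[- M, M] -> f t = 0.
Proof. by move=> fM t; rewrite in_itv /= -ler_norml -ltNge => /fM. Qed.

Lemma continuous_itv_integrable (f : R -> R) (a b : R) :
  continuous f -> mu.-integrable `[a, b] (EFin \o f).
Proof.
move=> fc; apply: continuous_compact_integrable; first exact: segment_compact.
exact: continuous_subspaceT.
Qed.

Lemma ucs_integrable (f : R -> R) : ucs f -> mu.-integrable setT (EFin \o f).
Proof.
move=> [/ucont_continuous fc [M fM]].
have /integrable_mkcond : mu.-integrable `[- M, M] (EFin \o f).
  exact: continuous_itv_integrable.
move=> /(_ _)/wrap[]; first exact: measurable_itv.
congr integrable.
apply/funext => t; rewrite patchE; case: ifPn => //=.
by rewrite mem_setE => /(supp_in_itv fM) ->.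
Qed.

Lemma Rintegral_bound (f : R -> R) (M e : R) :
  0 <= M -> ucs f -> supp_in M f -> (forall t, `|f t| <= e) ->
  `|Rintegral mu setT f| <= e * (2 * M).
Proof.
move=> M0 [/ucont_continuous fc _] fM fe.
rewrite (Rintegral_supp (supp_in_itv fM)).
apply: (le_trans (le_normr_Rintegral _ (continuous_itv_integrable _ _ fc))) => //.
apply: (@le_trans _ _ (Rintegral mu `[- M, M] (cst e))).
  apply: le_Rintegral => //.
  - apply: continuous_itv_integrable => t.
    by apply: (continuous_comp (fc t)); exact: norm_continuous.
  - by apply: continuous_itv_integrable => t; exact: cst_continuous.
rewrite Rintegral_cst//= lebesgue_measure_itv/= lte_fin.
case: ifPn => _ /=; first by rewrite opprK -mulr2n mulr_natl.
by rewrite mulr0 mulr_ge0 ?mulr_ge0// (le_trans _ (fe 0)).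
Qed.

Lemma Rintegral_shift (f : R -> R) (h : R) :
  ucs f -> Rintegral mu setT (fun t => f (t + h)) = Rintegral mu setT f.
Proof.
move=> fu; have [M M0 fM] := ucs_supp fu.
have fc : continuous f by apply: ucont_continuous; case: fu.
rewrite (Rintegral_supp (supp_in_itv fM)).
rewrite (@Rintegral_supp _ (- M - h) (M - h)); last first.
  move=> t; rewrite in_itv /= => th; apply: (supp_in_itv fM).
  by apply: contra th; rewrite in_itv /= => /andP[? ?]; apply/andP; split; lra.
rewrite /Rintegral; congr fine.
have dsh (t : R) : is_derive t 1 (fun t : R => t + h) 1 := is_derive_shift t 1 h.
have dF : derive1 (fun t : R => t + h) = cst 1.
  by apply/funext => t; rewrite derive1E; have [_ ->] := dsh t.
have := @integration_by_substitution_increasing R (fun t => t + h) f (- M - h) (M - h).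
rewrite !subrK dF => -> //.
- by apply: eq_integral => t _; rewrite /= mulr1.
- lra.
- by move=> x y _ _; rewrite ltrD2r.
- by move=> x _; exact: cst_continuous.
- by apply: is_cvg_cst.
- by apply: is_cvg_cst.
- split.
  + by move=> x _; have [] := dsh x.
  + by apply: cvg_at_right_filter; apply: cvgD; [exact: cvg_id|exact: cvg_cst].
  + by apply: cvg_at_left_filter; apply: cvgD; [exact: cvg_id|exact: cvg_cst].
- exact: continuous_subspaceT.
Qed.

Lemma Rintegral_lin (f g : R -> R) (a : R) : ucs f -> ucs g ->
  Rintegral mu setT (fun t => a * f t + g t) =
  a * Rintegral mu setT f + Rintegral mu setT g.
Proof.
move=> fu gu; have fi := ucs_integrable fu; have gi := ucs_integrable gu.
rewrite RintegralD//; first by rewrite RintegralZl.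
have : mu.-integrable setT (fun x => a%:E * (EFin \o f) x)%E.
  exact: integrableZl.
by [].
Qed.

End Integral1.

(** * The iterated integral on row vectors *)

Section IteratedIntegral.
Variables (R : realType).
Local Notation mu := (@lebesgue_measure R).

(** The slicing map used by [iint], so that [iintS] holds by conversion. *)
Definition rcons0 n (t : R) (v : 'rV[R]_n) : 'rV[R]_n.+1 :=
  row_mx (t%:M : 'rV[R]_1) v.

Lemma rcons0_0 n t (v : 'rV[R]_n) : rcons0 t v 0 0 = t.
Proof.
by rewrite mxE; case: splitP => j //=; rewrite mxE (ord1 j) eqxx.
Qed.

Lemma rcons0_lift n t (v : 'rV[R]_n) i : rcons0 t v 0 (lift 0 i) = v 0 i.
Proof.
rewrite mxE; case: splitP => j /=; first by rewrite (ord1 j).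
by rewrite /bump add1n => -[ij]; congr (v _ _); exact: val_inj.
Qed.

Lemma iintS n (f : 'rV[R]_n.+1 -> R) :
  iint f = Rintegral mu setT (fun t => iint (fun v => f (rcons0 t v))).
Proof. by []. Qed.

Lemma rowDE n (v w : 'rV[R]_n) i : (v + w) 0 i = v 0 i + w 0 i.
Proof. by rewrite mxE. Qed.

Lemma rowBE n (v w : 'rV[R]_n) i : (v - w) 0 i = v 0 i - w 0 i.
Proof. by rewrite !mxE. Qed.

Lemma rcons0_eta n (x : 'rV[R]_n.+1) :
  x = rcons0 (x 0 0) (\row_(i < n) x 0 (lift 0 i)).
Proof.
apply/rowP => i; case: (unliftP 0 i) => [j|] ->.
  by rewrite [RHS]rcons0_lift mxE.
by rewrite [RHS]rcons0_0.
Qed.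

Lemma rcons0B n a b (v w : 'rV[R]_n) :
  rcons0 a v - rcons0 b w = rcons0 (a - b) (v - w).
Proof.
apply/rowP => i; rewrite rowBE; case: (unliftP 0 i) => [j|] ->.
  by rewrite !rcons0_lift rowBE.
by rewrite !rcons0_0.
Qed.

Lemma rcons0D n a b (v w : 'rV[R]_n) :
  rcons0 a v + rcons0 b w = rcons0 (a + b) (v + w).
Proof.
apply/rowP => i; rewrite rowDE; case: (unliftP 0 i) => [j|] ->.
  by rewrite !rcons0_lift rowDE.
by rewrite !rcons0_0.
Qed.

Lemma coord_le_norm n (x : 'rV[R]_n) i : `|x 0 i| <= `|x|.
Proof.
rewrite [leRHS]/Num.Def.normr /= mx_normrE.
by apply: (le_trans _ (le_bigmax _ _ (0, i))).
Qed.

Lemma norm_rV_le n (x : 'rV[R]_n) (M : R) :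
  0 <= M -> (forall i, `|x 0 i| <= M) -> `|x| <= M.
Proof.
move=> M0 h; rewrite [leLHS]/Num.Def.normr /= mx_normrE.
apply/bigmax_leP; split => // -[i j] _ /=.
by rewrite (ord1 i).
Qed.

Lemma norm_rV_lt n (x : 'rV[R]_n) (M : R) :
  0 < M -> (forall i, `|x 0 i| < M) -> `|x| < M.
Proof.
move=> M0 h; rewrite [ltLHS]/Num.Def.normr /= mx_normrE.
apply/bigmax_ltP; split => // -[i j] _ /=.
by rewrite (ord1 i).
Qed.

Lemma norm_rcons0_lt n t (v : 'rV[R]_n) (M : R) :
  `|t| < M -> `|v| < M -> `|rcons0 t v| < M.
Proof.
move=> tM vM; apply: norm_rV_lt => [|i]; first exact: le_lt_trans tM.
case: (unliftP 0 i) => [j|] ->; last by rewrite rcons0_0.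
by rewrite rcons0_lift (le_lt_trans (coord_le_norm _ _)).
Qed.

Lemma ucs_slice n (f : 'rV[R]_n.+1 -> R) t (M : R) :
  ucont f -> supp_in M f ->
  ucont (fun v => f (rcons0 t v)) /\ supp_in M (fun v => f (rcons0 t v)).
Proof.
move=> fu fM; split=> [e e0|v vM].
  have [d d0 fd] := fu _ e0; exists d => // x y xy; apply: fd.
  by rewrite rcons0B norm_rcons0_lt// subrr normr0.
apply: fM; apply: (lt_le_trans vM); apply: norm_rV_le => // i.
by rewrite -(rcons0_lift t) coord_le_norm.
Qed.

Lemma iint_ge0 n (f : 'rV[R]_n -> R) : (forall x, 0 <= f x) -> 0 <= iint f.
Proof.
elim: n f => [|n IH] f f0 //=.
by apply: Rintegral_ge0 => t _; apply: IH.
Qed.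

Let lin n := forall (f g : 'rV[R]_n -> R) a, ucs f -> ucs g ->
  iint (fun x => a * f x + g x) = a * iint f + iint g.

Let bounded n := forall (f : 'rV[R]_n -> R) (M e : R), 0 <= M -> ucont f ->
  supp_in M f -> (forall x, `|f x| <= e) -> `|iint f| <= e * (2 * M) ^+ n.

(** Linearity writes the difference of two inner integrals as one integral, and the sup bound makes
    it small; hence the outer integrand is again uniformly continuous of bounded support. With this,
    [lin] and [bounded] are carried together to the next dimension. *)
Let slice n : lin n -> bounded n ->
  forall (f : 'rV[R]_n.+1 -> R) (M : R), 0 <= M -> ucont f -> supp_in M f ->
  ucont (fun t => iint (fun v => f (rcons0 t v))) /\
  supp_in M (fun t => iint (fun v => f (rcons0 t v))).
Proof.
move=> IHl IHb f M M0 fu fM; split=> [e e0|t tM].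
  (* The added 1 keeps the divisor positive when [M] is 0. *)
  have c0 : 0 < (2 * M) ^+ n + 1.
    by have := exprn_ge0 n (mulr_ge0 (ler0n R 2) M0); lra.
  have e1 : 0 < e / ((2 * M) ^+ n + 1) by rewrite divr_gt0.
  have [d d0 fd] := fu _ e1; exists d => // s t st.
  have [su sM] := ucs_slice s fu fM; have [tu tM] := ucs_slice t fu fM.
  have -> : iint (fun v => f (rcons0 s v)) - iint (fun v => f (rcons0 t v)) =
    iint (fun v => -1 * f (rcons0 t v) + f (rcons0 s v)).
    rewrite IHl ?mulN1r 1?addrC//; split => //; by exists M.
  apply: (@le_lt_trans _ _ (e / ((2 * M) ^+ n + 1) * (2 * M) ^+ n)).
    apply: IHb => //; first exact: ucont_lin.
      by move=> v Mv; rewrite sM// tM// mulr0 addr0.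
    move=> v; rewrite mulN1r addrC ltW// fd// rcons0B subrr.
    by rewrite norm_rcons0_lt// normr0.
  rewrite -mulrA gtr_pMr// mulrC ltr_pdivrMr// mul1r; lra.
apply/eqP; rewrite -normr_eq0 eq_le normr_ge0 andbT.
rewrite -(mul0r ((2 * M) ^+ n)); have [tu tM'] := ucs_slice t fu fM.
apply: IHb => // v; rewrite fM ?normr0//.
by apply: (lt_le_trans tM); rewrite -{1}(rcons0_0 t v) coord_le_norm.
Qed.

Let iint_lin_bounded n : lin n /\ bounded n.
Proof.
elim: n => [|n [IHl IHb]]; first by split=> [//|f M e _ _ _ fe]; rewrite expr0 mulr1; exact: fe.
split=> [f g a fu gu|f M e M0 fu fM fe].
  have [M M0 fM] := ucs_supp fu; have [N N0 gN] := ucs_supp gu.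
  rewrite !iintS -Rintegral_lin.
  - apply: eq_Rintegral => t _; rewrite IHl//.
      by have [] := ucs_slice t fu.1 fM; split => //; exists M.
    by have [] := ucs_slice t gu.1 gN; split => //; exists N.
  - by have [? ?] := slice IHl IHb M0 fu.1 fM; split => //; exists M.
  - by have [? ?] := slice IHl IHb N0 gu.1 gN; split => //; exists N.
have [? ?] := slice IHl IHb M0 fu fM.
rewrite iintS exprSr mulrA; apply: Rintegral_bound => //.
  by split => //; exists M.
by move=> t; have [? ?] := ucs_slice t fu fM; apply: IHb.
Qed.

Lemma iint_lin n (f g : 'rV[R]_n -> R) a : ucs f -> ucs g ->
  iint (fun x => a * f x + g x) = a * iint f + iint g.
Proof. exact: (iint_lin_bounded n).1. Qed.

Lemma iint_bound n (f : 'rV[R]_n -> R) (M e : R) : 0 <= M -> ucont f ->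
  supp_in M f -> (forall x, `|f x| <= e) -> `|iint f| <= e * (2 * M) ^+ n.
Proof. exact: (iint_lin_bounded n).2. Qed.

Lemma ucs_iint_slice n (f : 'rV[R]_n.+1 -> R) :
  ucs f -> ucs (fun t => iint (fun v => f (rcons0 t v))).
Proof.
move=> fu; have [M M0 fM] := ucs_supp fu; have [l b] := iint_lin_bounded n.
by have [? ?] := slice l b M0 fu.1 fM; split => //; exists M.
Qed.

Lemma ucs0 (V : normedZmodType R) : ucs (fun _ : V => 0 : R).
Proof.
split=> [e e0|]; last by exists 0.
by exists 1 => // x y _; rewrite subrr normr0.
Qed.

Lemma iint0 n : iint (fun _ : 'rV[R]_n => 0) = 0.
Proof.
transitivity (iint (fun _ : 'rV[R]_n => -1 * 0 + 0 : R)).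
  by congr iint; apply/funext => x; rewrite mulr0 addr0.
by rewrite (iint_lin _ (ucs0 _) (ucs0 _)) mulN1r addNr.
Qed.

Lemma ucsZ (V : normedZmodType R) (f : V -> R) a :
  ucs f -> ucs (fun x => a * f x).
Proof.
move=> fu; have := ucs_lin a fu (ucs0 V).
by under eq_fun do rewrite addr0.
Qed.

Lemma ucsD (V : normedZmodType R) (f g : V -> R) :
  ucs f -> ucs g -> ucs (fun x => f x + g x).
Proof.
move=> fu gu; have := ucs_lin 1 fu gu.
by under eq_fun do rewrite mul1r.
Qed.

Lemma ucsB (V : normedZmodType R) (f g : V -> R) :
  ucs f -> ucs g -> ucs (fun x => f x - g x).
Proof.
move=> fu gu; have := ucs_lin (-1) gu fu.
by under eq_fun do rewrite mulN1r addrC.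
Qed.

Lemma ucs_sum (V : normedZmodType R) (I : Type) (s : seq I) (f : I -> V -> R) :
  (forall i, ucs (f i)) -> ucs (fun x => \sum_(i <- s) f i x).
Proof.
move=> fu; elim: s => [|i s IH].
  by under eq_fun do rewrite big_nil; exact: ucs0.
by under eq_fun do rewrite big_cons; exact: ucsD.
Qed.

Lemma iintZ n (f : 'rV[R]_n -> R) a :
  ucs f -> iint (fun x => a * f x) = a * iint f.
Proof.
move=> fu; have := iint_lin a fu (ucs0 _); rewrite iint0 addr0 => <-.
by congr iint; apply/funext => x; rewrite addr0.
Qed.

Lemma iintD n (f g : 'rV[R]_n -> R) :
  ucs f -> ucs g -> iint (fun x => f x + g x) = iint f + iint g.
Proof.
move=> fu gu; have := iint_lin 1 fu gu; rewrite mul1r => <-.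
by congr iint; apply/funext => x; rewrite mul1r.
Qed.

Lemma iintB n (f g : 'rV[R]_n -> R) :
  ucs f -> ucs g -> iint (fun x => f x - g x) = iint f - iint g.
Proof.
move=> fu gu; have := iint_lin (-1) gu fu; rewrite mulN1r addrC => <-.
by congr iint; apply/funext => x; rewrite mulN1r addrC.
Qed.

Lemma iint_sum n (I : Type) (s : seq I) (f : I -> 'rV[R]_n -> R) :
  (forall i, ucs (f i)) ->
  iint (fun x => \sum_(i <- s) f i x) = \sum_(i <- s) iint (f i).
Proof.
move=> fu; elim: s => [|i s IH].
  by under eq_fun do rewrite big_nil; rewrite big_nil iint0.
under eq_fun do rewrite big_cons; rewrite big_cons iintD//; first by rewrite IH.
exact: ucs_sum.
Qed.

Lemma le_iint n (f g : 'rV[R]_n -> R) : ucs f -> ucs g ->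
  (forall x, f x <= g x) -> iint f <= iint g.
Proof.
move=> fu gu fg; rewrite -subr_ge0 -iintB//.
by apply: iint_ge0 => x; rewrite subr_ge0.
Qed.

Lemma ucs_shift (V : normedZmodType R) (f : V -> R) (v : V) :
  ucs f -> ucs (fun x => f (x + v)).
Proof.
move=> [fu [M fM]]; split=> [e /fu[d d0 fd]|].
  by exists d => // x y xy; apply: fd; rewrite opprD addrACA subrr addr0.
exists (M + `|v|) => x xM; apply: fM.
by have := ler_normB (x + v) v; rewrite addrK; lra.
Qed.

Lemma iint_shift n (f : 'rV[R]_n -> R) (v : 'rV[R]_n) :
  ucs f -> iint (fun x => f (x + v)) = iint f.
Proof.
elim: n f v => [|n IH] f v fu; first by rewrite /= (thinmx0 v) addr0.
rewrite !iintS -[RHS](@Rintegral_shift _ _ (v 0 0)); last exact: ucs_iint_slice.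
apply: eq_Rintegral => t _; have [M _ fM] := ucs_supp fu.
rewrite -[RHS](IH _ (\row_(i < n) v 0 (lift 0 i))).
  by congr iint; apply/funext => w; rewrite {1}(rcons0_eta v) rcons0D.
by have [] := ucs_slice (t + v 0 0) fu.1 fM; split => //; exists M.
Qed.

End IteratedIntegral.

(** * Restriction to lines and the mean value theorem *)

Section Lines.
Variables (R : realType) (V : normedModType R).
Implicit Types (f : V -> R) (x v : V).

Lemma is_derive_line f x v (t : R) : derivable f (x + t *: v) v ->
  is_derive t 1 (fun s : R => f (x + s *: v)) ('D_v f (x + t *: v)).
Proof.
have E : (fun h : R => h^-1 *: (((fun s : R => f (x + s *: v)) \o shift t) (h *: 1)
    - f (x + t *: v))) =
    (fun h => h^-1 *: ((f \o shift (x + t *: v)) (h *: v) - f (x + t *: v))).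
  apply/funext => h; congr (_ *: (f _ - _)).
  by rewrite /= /shift -[h *: 1]/(h * 1) mulr1 scalerDl addrCA.
move=> d; split; first by rewrite /derivable E.
by rewrite /derive E.
Qed.

Lemma line_MVT f x v (h : R) : (forall y, derivable f y v) ->
  exists2 s : R, `|s| <= `|h| & f (x + h *: v) - f x = h * 'D_v f (x + s *: v).
Proof.
move=> fd; pose g s := f (x + s *: v).
have gd (s : R) : is_derive s 1 g ('D_v f (x + s *: v)) by exact: is_derive_line.
have gc : continuous g.
  by move=> s; apply: differentiable_continuous; apply/derivable1_diffP; have [] := gd s.
have [h0|h0] := leP 0 h.
  have [s sh] := @MVT_segment R g _ 0 h h0 (fun s _ => gd s) (continuous_subspaceT gc).
  rewrite subr0 /g scale0r addr0 mulrC => E; exists s => //.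
  by move: sh; rewrite in_itv /= => /andP[s0 sh]; rewrite !ger0_norm.
have [s sh] := @MVT_segment R g _ h 0 (ltW h0) (fun s _ => gd s) (continuous_subspaceT gc).
rewrite sub0r /g scale0r addr0 mulrN => E; exists s.
  by move: sh; rewrite in_itv /= => /andP[s0 sh]; rewrite ler0_norm// ltr0_norm// lerN2.
by rewrite -opprB E opprK mulrC.
Qed.

End Lines.

(** * Uniform limits under the integral, integration by parts *)

Section CompactSupport.
Variables (R : realType) (n : nat).
Notation V := 'rV[R]_n.
Implicit Types (f g : V -> R).

Lemma ucsP f : ucs f <-> continuous f /\ exists M : R, supp_in M f.
Proof.
split=> [[fu fM]|[fc [M fM]]]; first by split => //; exact: ucont_continuous.
by split; [exact: continuous_ucs fM|exists M].
Qed.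

Lemma ucsM f g : ucs f -> continuous g -> ucs (fun x => f x * g x).
Proof.
move=> /ucsP[fc [M fM]] gc; apply/ucsP; split.
  by move=> x; exact: (cvgM (fc x) (gc x)).
by exists M => x /fM ->; rewrite mul0r.
Qed.

Lemma ucs_cont f : ucs f -> continuous f.
Proof. by case/ucsP. Qed.

Lemma ucsMM f g : ucs f -> ucs g -> ucs (fun x => f x * g x).
Proof. by move=> fu gu; exact: ucsM fu (ucs_cont gu). Qed.

Lemma ucs_bounded f : ucs f -> exists2 B : R, 0 < B & forall x, `|f x| <= B.
Proof.
move=> fu; have [M M0 fM] := ucs_supp fu.
have [d d0 fd] := fu.1 1 ltr01.
have cB : compact [set x : V | `|x| <= M].
  apply: bounded_closed_compact.
    exists M; split; first exact: num_real.
    by move=> y My x /= /le_trans; apply; exact: ltW.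
  rewrite (_ : [set _ | _] = (fun x : V => `|x|) @^-1` [set t | t <= M])//.
  by apply: closed_comp => [x _|]; [exact: norm_continuous|exact: closed_le].
have := continuous_compact (continuous_subspaceT (ucs_cont fu)) cB.
move=> /compact_bounded[B [_ hB]].
exists (Num.max 1 (B + 1)); first by rewrite lt_max ltr01.
move=> x; have [xM|xM] := leP `|x| M; last by rewrite fM// normr0 le_max ler01.
rewrite le_max; apply/orP; right; apply: (hB (B + 1)); first by rewrite ltrDl.
by exists x.
Qed.

(** The substitute for dominated convergence: approximants with a common support bound that are
    uniformly close to [f] and all have integral [c] determine the integral of [f], by
    [iint_bound]. *)
Lemma iint_approx f (M c : R) : 0 <= M -> ucs f -> supp_in M f ->
  (forall e : R, 0 < e -> exists g, [/\ ucs g, supp_in M g,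
     forall x, `|f x - g x| <= e & iint g = c]) -> iint f = c.
Proof.
move=> M0 fu fM h; apply/eqP; rewrite -subr_eq0 -normr_le0.
apply/ler_addgt0Pl => e e0; rewrite addr0.
have C0 : 0 < (2 * M) ^+ n + 1.
  by have := exprn_ge0 n (mulr_ge0 (ler0n R 2) M0); lra.
have [g [gu gM fg <-]] := h _ (divr_gt0 e0 C0).
rewrite -iintB//; apply: le_trans (iint_bound M0 (ucsB fu gu).1 _ fg) _.
  by move=> x Mx; rewrite fM// gM// subrr.
rewrite -mulrA ler_piMr ?(ltW e0)// mulrC ler_pdivrMr// mul1r; lra.
Qed.

Definition C1s f := ucs f /\
  forall i, (forall x, derivable f x (ebasis R i)) /\ ucs (partial i f).

Lemma norm_ebasis (h : R) (i : 'I_n) : `|h *: ebasis R i| <= `|h|.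
Proof.
apply: norm_rV_le => // j; rewrite !mxE eqxx /=.
by case: (j == i); rewrite ?mulr1 ?mulr0 ?normr0.
Qed.

(** By the mean value theorem the quotient is a value of the partial derivative at distance at most
    [h] from [x], and that derivative is uniformly continuous. *)
Lemma diffquot_unif f i : C1s f -> forall e : R, 0 < e -> exists2 d : R, 0 < d &
  forall h : R, h != 0 -> `|h| < d -> forall x,
    `|h^-1 * (f (x + h *: ebasis R i) - f x) - partial i f x| <= e.
Proof.
move=> [_ /(_ i)[fd [fu _]]] e /fu[d d0 hd]; exists d => // h h0 hlt x.
have [s sh ->] := line_MVT x h fd; rewrite mulKf// ltW// hd//.
rewrite addrC addKr; apply: le_lt_trans (norm_ebasis _ _) _.
exact: le_lt_trans hlt.
Qed.

Lemma supp_shift f (M N : R) (v : V) :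
  supp_in M f -> `|v| <= N -> supp_in (M + N) (fun x => f (x + v)).
Proof.
move=> fM vN x xM; apply: fM.
by have := ler_normB (x + v) v; rewrite addrK; lra.
Qed.

(** Difference quotients have integral 0 by translation invariance, and they converge uniformly to
    the derivative. *)
Lemma iint_partial f i : C1s f -> iint (partial i f) = 0.
Proof.
move=> fC; have [fu /(_ i)[fd pu]] := fC.
have [M M0 fM] := ucs_supp fu; have [N N0 pN] := ucs_supp pu.
have MN1 : M + 1 <= M + 1 + N by rewrite lerDl.
apply: (@iint_approx _ (M + 1 + N)) => //; [lra|by apply: supp_in_le pN; lra|].
move=> e e0; have [d d0 hd] := diffquot_unif i fC e0.
(* The bound 1 keeps the supports of all the quotients in one ball. *)
pose h := Num.min 1 (d / 2).
have h0 : 0 < h by rewrite lt_min ltr01 divr_gt0.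
have h1 : `|h| <= 1 by rewrite gtr0_norm// ge_min lexx.
have hd2 : `|h| < d by rewrite gtr0_norm// gt_min; apply/orP; right; lra.
exists (fun x => h^-1 * (f (x + h *: ebasis R i) - f x)).
have us := ucs_shift (h *: ebasis R i) fu.
split.
- by apply: ucsZ; apply: ucsB.
- move=> x xM; rewrite (fM x); last lra.
  rewrite (supp_shift fM (le_trans (norm_ebasis _ _) h1)); last lra.
  by rewrite subrr mulr0.
- by move=> x; rewrite distrC hd// gt_eqF.
- by rewrite iintZ ?iintB ?iint_shift ?subrr ?mulr0//; apply: ucsB.
Qed.

Lemma partialM f g i x : derivable f x (ebasis R i) -> derivable g x (ebasis R i) ->
  partial i (fun y => f y * g y) x = f x * partial i g x + g x * partial i f x.
Proof. by move=> fd gd; rewrite /partial (deriveM fd gd). Qed.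

Let shiftE f (v w x : V) :
  (fun h : R => h^-1 *: (((fun y => f (y + v)) \o shift x) (h *: w) - f (x + v))) =
  (fun h => h^-1 *: ((f \o shift (x + v)) (h *: w) - f (x + v))).
Proof. by apply/funext => h; rewrite /= /shift addrA. Qed.

Lemma derivable_shift f (v w x : V) :
  derivable f (x + v) w -> derivable (fun y => f (y + v)) x w.
Proof. by rewrite /derivable shiftE. Qed.

Lemma partial_shift f (v : V) i x :
  partial i (fun y => f (y + v)) x = partial i f (x + v).
Proof. by rewrite /partial /derive shiftE. Qed.

Lemma C1sM f g : C1s f -> C1s g -> C1s (fun x => f x * g x).
Proof.
move=> [fu fd] [gu gd]; split; first exact: ucsMM fu gu.
move=> i; have [fi fiu] := fd i; have [gi giu] := gd i; split.
  by move=> x; apply: derivableM.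
have -> : partial i (fun x => f x * g x) =
  (fun x => f x * partial i g x + g x * partial i f x).
  by apply/funext => x; exact: partialM.
exact: ucsD (ucsMM fu giu) (ucsMM gu fiu).
Qed.

Lemma C1s_shift f v : C1s f -> C1s (fun x => f (x + v)).
Proof.
move=> [fu fd]; split; first exact: ucs_shift.
move=> i; have [fi fiu] := fd i; split; first by move=> x; exact: derivable_shift.
have -> : partial i (fun x => f (x + v)) = (fun x => partial i f (x + v)).
  by apply/funext => x; exact: partial_shift.
exact: ucs_shift.
Qed.

Lemma C1s_lin f g a : C1s f -> C1s g -> C1s (fun x => a * f x + g x).
Proof.
move=> [fu fd] [gu gd]; split; first exact: ucs_lin.
move=> i; have [fi fiu] := fd i; have [gi giu] := gd i.
have zd x : derivable (fun y => a * f y) x (ebasis R i) by exact: derivableZ.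
split; first by move=> x; exact: derivableD.
have -> : partial i (fun x => a * f x + g x) =
  (fun x => a * partial i f x + partial i g x).
  apply/funext => x; rewrite /partial (deriveD (zd x) (gi x)).
  by rewrite (deriveZ a (fi x)).
exact: ucs_lin.
Qed.

(* Weak form of d(dA /\ db) = 0; neither A nor b has second derivatives, so
   one derivative of b is traded against one of A through difference quotients. *)
Lemma iint_partial_swap A b i l : C1s A -> C1s b ->
  iint (fun x => partial i A x * partial l b x) =
  iint (fun x => partial l A x * partial i b x).
Proof.
move=> AC bC; have [Au Ad] := AC; have [bu bd] := bC.
have [Adi Aiu] := Ad i; have [Adl Alu] := Ad l.
have [bdi biu] := bd i; have [bdl blu] := bd l.
have u1 : ucs (fun x => partial i A x * partial l b x).
  exact: ucsMM Aiu blu.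
have u2 : ucs (fun x => partial l A x * partial i b x).
  exact: ucsMM Alu biu.
apply/eqP; rewrite -subr_eq0 -(iintB u1 u2); apply/eqP.
have [M1 M10 AiM] := ucs_supp Aiu; have [M2 M20 biM] := ucs_supp biu.
have [B1 B10 AiB] := ucs_bounded Aiu; have [B2 B20 biB] := ucs_bounded biu.
apply: (@iint_approx _ (M1 + M2)); [lra|exact: ucsB| |].
  move=> x xM; have [-> ->] : partial i A x = 0 /\ partial i b x = 0.
    by split; [apply: AiM; lra|apply: biM; lra].
  by rewrite mul0r mulr0 subrr.
move=> e e0.
have e1 : 0 < e / (B1 + B2) by rewrite divr_gt0// addr_gt0.
have [d1 d10 hd1] := diffquot_unif l bC e1.
have [d2 d20 hd2] := diffquot_unif l AC e1.
pose h := Num.min d1 d2 / 2.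
have m0 : 0 < Num.min d1 d2 by rewrite lt_min d10.
have h0 : 0 < h by rewrite divr_gt0.
have hm : h < Num.min d1 d2 by rewrite /h; lra.
have [hd1' hd2'] : `|h| < d1 /\ `|- h| < d2.
  by rewrite normrN gtr0_norm//; split; apply: lt_le_trans hm _; rewrite ge_min lexx ?orbT.
have hn0 : h != 0 by rewrite gt_eqF.
have {hd1'}hd1 := hd1 _ hn0 hd1'.
have {hd2'}hd2 := hd2 (- h) _ hd2'; rewrite oppr_eq0 in hd2; have {}hd2 := hd2 hn0.
(* Forward quotient for [b], backward quotient for [A]. With this pairing the integral of
   [partial i A * q - p * partial i b] is exactly 0: integrating by parts in direction [i], where
   [p] is C^1, leaves two products of [partial i A] and [b] that differ by the translation by
   [h]. *)
pose q x := h^-1 * (b (x + h *: ebasis R l) - b x).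
pose p x := (- h)^-1 * (A (x + - h *: ebasis R l) - A x).
have bs := ucs_shift (h *: ebasis R l) bu.
have As := C1s_shift (- h *: ebasis R l) AC.
have qu : ucs q by apply: ucsZ; exact: ucsB.
have pC : C1s p.
  have -> : p = (fun x => (- h)^-1 * A (x + - h *: ebasis R l) + (- (- h)^-1 * A x + 0)).
    by apply/funext => x; rewrite /p addr0 mulrBr mulNr.
  apply: (C1s_lin _ As); apply: (C1s_lin _ AC).
  split; first exact: ucs0.
  move=> j; split => [x|]; first exact: derivable_cst.
  rewrite (_ : partial _ _ = fun=> 0); first exact: ucs0.
  by apply/funext => x; rewrite /partial derive_cst.
have pi x : partial i p x =
    (- h)^-1 * (partial i A (x + - h *: ebasis R l) - partial i A x).
  have d1' : derivable (fun y => A (y + - h *: ebasis R l)) x (ebasis R i).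
    exact: derivable_shift.
  by rewrite /partial /p (deriveZ _ (derivableB d1' (Adi x))) (deriveB d1' (Adi x))
    -[X in _ *: (X - _)]/(partial i _ x) partial_shift.
exists (fun x => partial i A x * q x - p x * partial i b x); split.
- exact: ucsB (ucsMM Aiu qu) (ucsMM pC.1 biu).
- move=> x xM; have [-> ->] : partial i A x = 0 /\ partial i b x = 0.
    by split; [apply: AiM; lra|apply: biM; lra].
  by rewrite mul0r mulr0 subrr.
- move=> x.
  have -> : partial i A x * partial l b x - partial l A x * partial i b x -
    (partial i A x * q x - p x * partial i b x) =
    partial i A x * (partial l b x - q x) + (p x - partial l A x) * partial i b x.
    by move: (partial i A x) (partial l b x) (partial l A x) (partial i b x) (q x) (p x)
      => *; ring.
  apply: le_trans (ler_normD _ _) _; rewrite !normrM distrC.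
  have h1 : `|partial i A x| * `|q x - partial l b x| <= B1 * (e / (B1 + B2)).
    by apply: ler_pM => //; exact: hd1.
  have h2 : `|p x - partial l A x| * `|partial i b x| <= (e / (B1 + B2)) * B2.
    by apply: ler_pM => //; exact: hd2.
  have : B1 * (e / (B1 + B2)) + e / (B1 + B2) * B2 = e.
    by field; rewrite gt_eqF// addr_gt0.
  lra.
- have pu := pC.1.
  have v1 : ucs (fun x => partial i A x * b (x + h *: ebasis R l)).
    exact: ucsMM Aiu bs.
  have v2 : ucs (fun x => partial i A x * b x).
    exact: ucsMM Aiu bu.
  have v3 : ucs (fun x => partial i A (x + - h *: ebasis R l) * b x).
    exact: ucsMM (ucs_shift _ Aiu) bu.
  have v4 : ucs (fun x => p x * partial i b x).
    exact: ucsMM pu biu.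
  have v5 : ucs (fun x => b x * partial i p x).
    by have [_ /(_ i)[_ piu]] := pC; exact: ucsMM bu piu.
  have pbC := C1sM pC bC.
  have ibp : iint (fun x => p x * partial i b x) + iint (fun x => b x * partial i p x) = 0.
    rewrite -iintD// -[RHS](iint_partial i pbC); congr iint; apply/funext => x.
    by rewrite partialM//; have [_ /(_ i)[]] := pC.
  have e1' : iint (fun x => partial i A x * q x) =
      h^-1 * (iint (fun x => partial i A x * b (x + h *: ebasis R l)) -
              iint (fun x => partial i A x * b x)).
    rewrite -iintB// -iintZ; last exact: ucsB.
    by congr iint; apply/funext => x; rewrite /q; ring.
  have e2' : iint (fun x => b x * partial i p x) =
      (- h)^-1 * (iint (fun x => partial i A (x + - h *: ebasis R l) * b x) -
              iint (fun x => partial i A x * b x)).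
    rewrite -iintB// -iintZ; last exact: ucsB.
    by congr iint; apply/funext => x; rewrite pi; ring.
  have e3' : iint (fun x => partial i A (x + - h *: ebasis R l) * b x) =
      iint (fun x => partial i A x * b (x + h *: ebasis R l)).
    rewrite -(iint_shift (h *: ebasis R l) v3); congr iint; apply/funext => x.
    by rewrite scaleNr addrK.
  rewrite (iintB (ucsMM Aiu qu) v4).
  have -> : iint (fun x => p x * partial i b x) = - iint (fun x => b x * partial i p x).
    by apply/eqP; rewrite -addr_eq0 ibp.
  by rewrite e1' e2' e3' invrN; ring.
Qed.

End CompactSupport.

(** * Chain rule for directional derivatives *)

Section ChainRule.
Variables (R : realType) (V : normedModType R).

(** Turns a directional derivative into a derivative of one real variable, so that the chain rule
    asks of the inner function only its derivative along [v]. *)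
Lemma is_derive_lineP (f : V -> R) x v (d : R) :
  is_derive x v f d <-> is_derive (0 : R) 1 (fun s : R => f (x + s *: v)) d.
Proof.
have E : (fun h : R => h^-1 *: (((fun s : R => f (x + s *: v)) \o shift 0) (h *: 1)
    - f (x + 0 *: v))) = (fun h => h^-1 *: ((f \o shift x) (h *: v) - f x)).
  apply/funext => h; rewrite /= /shift scale0r !addr0 -[h *: 1]/(h * 1) mulr1.
  by rewrite [x + _]addrC.
by split=> -[d1 d2]; split; move: d1 d2; rewrite /derivable /derive E.
Qed.

Lemma is_derive1_chain (f g : R -> R) (x df dg : R) :
  is_derive x 1 g dg -> is_derive (g x) 1 f df ->
  is_derive x 1 (fun s => f (g s)) (df * dg).
Proof.
move=> [gd <-] [fd <-]; split.
  apply/derivable1_diffP.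
  by apply: (@differentiable_comp _ _ _ _ g f); [exact/derivable1_diffP|exact/derivable1_diffP].
by rewrite -!derive1E; exact: (derive1_comp gd fd).
Qed.

Lemma is_derive_chain (f : R -> R) (g : V -> R) x v (df dg : R) :
  is_derive x v g dg -> is_derive (g x) 1 f df ->
  is_derive x v (fun y => f (g y)) (df * dg).
Proof.
move=> /is_derive_lineP gd fd; apply/is_derive_lineP.
by apply: is_derive1_chain => //; rewrite scale0r addr0.
Qed.

End ChainRule.

(** * Regularity on the punctured ball *)

Section PuncturedBall.
Variables (R : realType) (n : nat).
Notation V := 'rV[R]_n.
Implicit Types (f g : V -> R).

Definition pball : set V := [set x | 0 < rad x < 1].

Lemma sum_sqr_ge0 (x : V) : 0 <= \sum_(i < n) x 0 i ^+ 2.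
Proof. by apply: sumr_ge0 => i _; exact: sqr_ge0. Qed.

Lemma rad_ge0 (x : V) : 0 <= rad x. Proof. exact: sqrtr_ge0. Qed.

Lemma sqr_rad (x : V) : rad x ^+ 2 = \sum_(i < n) x 0 i ^+ 2.
Proof. by rewrite sqr_sqrtr// sum_sqr_ge0. Qed.

Lemma norm_le_rad (x : V) : `|x| <= rad x.
Proof.
apply: norm_rV_le => [|i]; first exact: rad_ge0.
rewrite -(ler_pXn2r (n := 2))// ?nnegrE ?rad_ge0// sqr_rad.
by rewrite real_normK ?num_real// (bigD1 i)//= lerDl sumr_ge0// => j _; exact: sqr_ge0.
Qed.

Lemma continuous_sum (I : Type) (s : seq I) (F : I -> V -> R) (x : V) :
  (forall i, continuous_at x (F i)) ->
  continuous_at x (fun y => \sum_(i <- s) F i y).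
Proof.
move=> Fc; elim: s => [|i s IH].
  rewrite (_ : (fun y => _) = cst 0); first exact: cst_continuous.
  by apply/funext => y; rewrite big_nil.
rewrite (_ : (fun y => _) = (fun y => F i y + \sum_(j <- s) F j y)).
  exact: continuousD (Fc i) IH.
by apply/funext => y; rewrite big_cons.
Qed.

Lemma rad_continuous : continuous (@Defs.rad R n).
Proof.
move=> x; apply: (@continuous_comp _ _ _ (fun x : V => \sum_(i < n) x 0 i ^+ 2) Num.sqrt).
  apply: continuous_sum => i.
  exact: continuous_comp (@coord_continuous R 1 n 0 i x) (@exprn_continuous _ 2 _).
exact: sqrt_continuous.
Qed.

Lemma open_pball : open pball.
Proof.
rewrite (_ : pball = @Defs.rad R n @^-1` `]0, 1[%classic); last first.
  by apply/seteqP; split=> x; rewrite /= in_itv.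
by apply: open_comp => [x _|]; [exact: rad_continuous|exact: interval_open].
Qed.

Lemma is_derive_coord (x : V) (i j : 'I_n) :
  is_derive x (ebasis R i) (fun y : V => y 0 j) (j == i)%:R.
Proof.
apply/is_derive_lineP.
have -> : (fun s : R => (x + s *: ebasis R i) 0 j) = (fun s => x 0 j + (j == i)%:R * s).
  by apply/funext => s; rewrite !mxE eqxx /= mulrC.
have d := is_deriveD (is_derive_cst (x 0 j) (0 : R) (1 : R))
  (is_deriveZ (j == i)%:R (is_derive_id (0 : R) (1 : R))).
by apply: is_derive_eq d _; rewrite add0r -[_ *: _]/(_ * _) mulr1.
Qed.

Lemma is_derive_rad (x : V) i : 0 < rad x ->
  is_derive x (ebasis R i) (@Defs.rad R n) (x 0 i / rad x).
Proof.
move=> x0.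
have s0 : 0 < \sum_(i < n) x 0 i ^+ 2 by rewrite -sqr_rad exprn_gt0.
have ds : is_derive x (ebasis R i) (fun y : V => \sum_(j < n) y 0 j ^+ 2) (2 * x 0 i).
  have -> : (fun y : V => \sum_(j < n) y 0 j ^+ 2) = \sum_(j < n) (fun y : V => y 0 j) ^+ 2.
    by apply/funext => y; rewrite fct_sumE; apply: eq_bigr => j _; rewrite fctE.
  apply: is_derive_eq; first by apply: is_derive_sum => j; apply: is_deriveX; exact: is_derive_coord.
  rewrite (bigD1 i)//= eqxx big1 ?addr0 => [|j ji].
    by rewrite expr1 /GRing.scale /= mulr1.
  by rewrite (negbTE ji) scaler0.
apply: is_derive_eq; first exact: is_derive_chain ds (is_derive1_sqrt s0).
rewrite -/(rad x); field; exact: lt0r_neq0.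
Qed.

(** Coefficients such as [(rad x)^-1] are regular only on the punctured ball, so continuity is
    recorded pointwise there; [C0O_ucs] makes it global once the function vanishes off [K]. *)
Definition C0O f := forall x, pball x -> continuous_at x f.

Definition C1O f := C0O f /\ forall i, C0O (partial i f) /\
  (forall x, pball x -> derivable f x (ebasis R i)).

Lemma C1O_C0O f : C1O f -> C0O f. Proof. by case. Qed.

Lemma C1O_partial f i : C1O f -> C0O (partial i f).
Proof. by move=> [_ /(_ i)[]]. Qed.

Arguments C1O_partial {f} i _.

Lemma C1O_derive f i x : C1O f -> pball x -> is_derive x (ebasis R i) f (partial i f x).
Proof. by move=> [_ /(_ i)[_ fd]] /fd; exact: derivableP. Qed.

(** Shape shared by the closure lemmas below: the first component is regularity, the second the
    formula for the partial derivatives, so that one application yields both. *)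
Lemma C1O_intro f (G : 'I_n -> V -> R) : C0O f -> (forall i, C0O (G i)) ->
  (forall i x, pball x -> is_derive x (ebasis R i) f (G i x)) ->
  C1O f /\ forall i x, pball x -> partial i f x = G i x.
Proof.
move=> fc Gc fG.
have pE i x : pball x -> partial i f x = G i x by move=> /(fG i)[].
split=> //; split=> // i; split=> [x xO|x /(fG i)[]//].
rewrite /continuous_at pE//; apply: cvg_trans (Gc i x xO).
apply: (@near_eq_cvg _ _ (nbhs x)); apply: filterS (open_nbhs_nbhs (conj open_pball xO)) => y yO.
by rewrite pE.
Qed.

Lemma C0O_cst (a : R) : C0O (fun=> a).
Proof. by move=> x _; exact: cst_continuous. Qed.

Lemma C0O_coord i : C0O (fun x : V => x 0 i).
Proof. by move=> x _; exact: (@coord_continuous R 1 n 0 i). Qed.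

Lemma C0O_rad : C0O (@Defs.rad R n).
Proof. by move=> x _; exact: rad_continuous. Qed.

Lemma C0O_D f g : C0O f -> C0O g -> C0O (fun x => f x + g x).
Proof. by move=> fc gc x xO; exact: continuousD (fc x xO) (gc x xO). Qed.

Lemma C0O_N f : C0O f -> C0O (fun x => - f x).
Proof. by move=> fc x xO; exact: continuousN (fc x xO). Qed.

Lemma C0O_M f g : C0O f -> C0O g -> C0O (fun x => f x * g x).
Proof. by move=> fc gc x xO; exact: continuousM (fc x xO) (gc x xO). Qed.

Lemma C0O_X f m : C0O f -> C0O (fun x => f x ^+ m).
Proof. by move=> fc x xO; exact: continuous_comp (fc x xO) (@exprn_continuous _ m _). Qed.

Lemma C0O_V f : (forall x, pball x -> f x != 0) -> C0O f -> C0O (fun x => (f x)^-1).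
Proof. by move=> f0 fc x xO; exact: continuousV (f0 x xO) (fc x xO). Qed.

Lemma C0O_sum (I : Type) (s : seq I) (F : I -> V -> R) :
  (forall i, C0O (F i)) -> C0O (fun x => \sum_(i <- s) F i x).
Proof. by move=> Fc x xO; apply: continuous_sum => i; exact: Fc. Qed.

Lemma C0O_comp (phi : R -> R) f : C0O f ->
  (forall x, pball x -> continuous_at (f x) phi) -> C0O (fun x => phi (f x)).
Proof. by move=> fc pc x xO; exact: continuous_comp (fc x xO) (pc x xO). Qed.

Lemma C1O_cst (a : R) : C1O (fun=> a) /\ forall i x, pball x -> partial i (fun=> a) x = 0.
Proof.
by apply: (@C1O_intro _ (fun _ _ => 0)) => *; exact: C0O_cst.
Qed.

Lemma C1O_coord j : C1O (fun x : V => x 0 j) /\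
  forall i x, pball x -> partial i (fun x : V => x 0 j) x = (j == i)%:R.
Proof.
apply: (@C1O_intro _ (fun i _ => (j == i)%:R)) => *; try exact: C0O_cst.
  exact: C0O_coord.
exact: is_derive_coord.
Qed.

Lemma C1O_D f g : C1O f -> C1O g -> C1O (fun x => f x + g x) /\
  forall i x, pball x -> partial i (fun x => f x + g x) x = partial i f x + partial i g x.
Proof.
move=> fC gC; apply: (@C1O_intro _ (fun i x => partial i f x + partial i g x)).
- exact: C0O_D (C1O_C0O fC) (C1O_C0O gC).
- by move=> i /=; exact: C0O_D (C1O_partial i fC) (C1O_partial i gC).
- by move=> i x xO; exact: is_deriveD (C1O_derive i fC xO) (C1O_derive i gC xO).
Qed.

Lemma C1O_M f g : C1O f -> C1O g -> C1O (fun x => f x * g x) /\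
  forall i x, pball x ->
    partial i (fun x => f x * g x) x = f x * partial i g x + g x * partial i f x.
Proof.
move=> fC gC; apply: (@C1O_intro _ (fun i x => f x * partial i g x + g x * partial i f x)).
- exact: C0O_M (C1O_C0O fC) (C1O_C0O gC).
- move=> i /=; apply: C0O_D; first exact: C0O_M (C1O_C0O fC) (C1O_partial i gC).
  exact: C0O_M (C1O_C0O gC) (C1O_partial i fC).
- by move=> i x xO; exact: is_deriveM (C1O_derive i fC xO) (C1O_derive i gC xO).
Qed.

Lemma C1O_N f : C1O f -> C1O (fun x => - f x) /\
  forall i x, pball x -> partial i (fun x => - f x) x = - partial i f x.
Proof.
move=> fC; apply: (@C1O_intro _ (fun i x => - partial i f x)).
- exact: C0O_N (C1O_C0O fC).
- by move=> i /=; exact: C0O_N (C1O_partial i fC).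
- by move=> i x xO; exact: is_deriveN (C1O_derive i fC xO).
Qed.

Lemma C1O_sum (I : Type) (s : seq I) (F : I -> V -> R) :
  (forall i, C1O (F i)) -> C1O (fun x => \sum_(j <- s) F j x) /\
  forall i x, pball x ->
    partial i (fun x => \sum_(j <- s) F j x) x = \sum_(j <- s) partial i (F j) x.
Proof.
move=> FC; elim: s => [|j s [IHC IHp]].
  have -> : (fun x : V => \sum_(j <- [::]) F j x) = (fun=> 0).
    by apply/funext => x; rewrite big_nil.
  by have [C p] := C1O_cst 0; split => // i x xO; rewrite p// big_nil.
have -> : (fun x : V => \sum_(j <- j :: s) F j x) = (fun x => F j x + \sum_(j <- s) F j x).
  by apply/funext => x; rewrite big_cons.
by have [C p] := C1O_D (FC j) IHC; split => // i x xO; rewrite p// IHp// big_cons.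
Qed.

Lemma C1O_radial (phi dphi : R -> R) :
  (forall s : R, 0 < s < 1 -> is_derive s 1 phi (dphi s)) ->
  (forall s : R, 0 < s < 1 -> continuous_at s dphi) ->
  C1O (fun x => phi (rad x)) /\
  forall i x, pball x -> partial i (fun x => phi (rad x)) x = dphi (rad x) * (x 0 i / rad x).
Proof.
move=> dp dc; apply: (@C1O_intro _ (fun i x => dphi (rad x) * (x 0 i / rad x))).
- apply: C0O_comp; first exact: C0O_rad.
  move=> x xO; apply: differentiable_continuous; apply/derivable1_diffP.
  by have [] := dp _ xO.
- move=> i /=; apply: C0O_M; first by apply: C0O_comp; [exact: C0O_rad|move=> x xO; exact: dc].
  apply: C0O_M; first exact: C0O_coord.
  apply: C0O_V; last exact: C0O_rad.
  by move=> x /andP[x0 _]; rewrite gt_eqF.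
- move=> i x xO; have /andP[x0 _] := xO.
  exact: is_derive_chain (is_derive_rad i x0) (dp _ xO).
Qed.

End PuncturedBall.
Arguments C1O_partial {R n f} i _.

(** * Finite-sum identities *)

Section Sums.
Variables (R : realType) (n : nat).

Lemma sum_kron (F : 'I_n -> R) j : \sum_(i < n) (j == i)%:R * F i = F j.
Proof.
rewrite (bigD1 j)//= eqxx mul1r big1 ?addr0// => i ij.
by rewrite eq_sym (negbTE ij) mul0r.
Qed.

Lemma sum_lin_kron (c x : 'I_n -> R) (a b e : R) j l :
  \sum_(i < n) c i * (a * x i + (j == i)%:R * b + (l == i)%:R * e) =
  a * (\sum_(i < n) c i * x i) + b * c j + e * c l.
Proof.
under eq_bigr => i _.
  have -> : c i * (a * x i + (j == i)%:R * b + (l == i)%:R * e) =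
    a * (c i * x i) + (j == i)%:R * (b * c i) + (l == i)%:R * (e * c i) by ring.
  over.
by rewrite !big_split/= !sum_kron mulr_sumr.
Qed.

(** Pointwise content of [iint_fields]. Here [a] is the value of the function, [A] and [b] are
    gradients, and [dc l i], [dd l i] are the derivatives in direction [i] of the [l]-th
    coefficients of the fields. The right side is the sum of d_i(a c_i d_l) b_l - d_l(a c_i d_l)
    b_i, expanded by the product rule; it involves first derivatives only. *)
Lemma field_algebra (a : R) (c d A b : 'I_n -> R) (dc dd : 'I_n -> 'I_n -> R) :
  (\sum_(i < n) c i * A i) * (\sum_(l < n) d l * b l) -
  (\sum_(i < n) d i * A i) * (\sum_(l < n) c l * b l) +
  a * ((\sum_(l < n) (\sum_(i < n) c i * dd l i - \sum_(i < n) d i * dc l i) * b l)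
       + (\sum_(i < n) dc i i) * (\sum_(l < n) d l * b l)
       - (\sum_(i < n) dd i i) * (\sum_(l < n) c l * b l)) =
  \sum_(i < n) \sum_(l < n)
    ((a * (c i * dd l i + d l * dc i i) + c i * d l * A i) * b l
     - (a * (c i * dd l l + d l * dc i l) + c i * d l * A l) * b i).
Proof.
have -> : (\sum_(l < n) (\sum_(i < n) c i * dd l i - \sum_(i < n) d i * dc l i) * b l)
    = \sum_(i < n) \sum_(l < n) (c i * dd l i * b l)
      - \sum_(i < n) \sum_(l < n) (d l * dc i l * b i).
  rewrite [X in _ = X - _]exchange_big -sumrB; apply: eq_bigr => l _.
  by rewrite mulrBl !mulr_suml.
rewrite [(\sum_(i < n) d i * A i) * _]mulrC [(\sum_(i < n) dd i i) * _]mulrC.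
rewrite !big_distrlr /= mulrBr mulrDr mulrBr !mulr_sumr.
under [X in _ + (X - _ + _ - _)]eq_bigr do rewrite mulr_sumr.
under [X in _ + (_ - X + _ - _)]eq_bigr do rewrite mulr_sumr.
under [X in _ + (_ + X - _)]eq_bigr do rewrite mulr_sumr.
under [X in _ + (_ - X)]eq_bigr do rewrite mulr_sumr.
rewrite -!sumrB -!big_split/= -sumrB -big_split/=; apply: eq_bigr => i _.
rewrite -!sumrB -!big_split/= -sumrB -big_split/=; apply: eq_bigr => l _.
by ring.
Qed.

End Sums.

Lemma near0_continuous (R : realType) (V : normedModType R) (f : V -> R) x :
  (\near x, 0 = f x) -> continuous_at x f.
Proof.
move=> f0; apply/cvgrPdist_lt => e e0.
have f0x : 0 = f x by exact: nbhs_singleton f0.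
by apply: filterS f0 => y <-; rewrite -f0x subrr normr0.
Qed.

(** * Integration by parts for vector fields *)

Section Fields.
Variables (R : realType) (n : nat).
Notation V := 'rV[R]_n.
Variables (K : set V) (cK : compact K) (KO : K `<=` @pball R n).
Implicit Types (f g A b : V -> R).

Definition off f := forall x, ~ K x -> f x = 0.

Lemma off_near f x : off f -> ~ K x -> \near x, 0 = f x.
Proof.
move=> f0 Kx; have oK : open (~` K) by apply: closed_openC; exact: compact_closed.
apply: filterS (open_nbhs_nbhs (conj oK Kx)) => y Ky; by rewrite f0.
Qed.

Lemma off_is_derive f i x : off f -> ~ K x -> is_derive x (ebasis R i) f 0.
Proof.
move=> f0 Kx; apply: near_eq_is_derive (off_near f0 Kx) (is_derive_cst _ _ _).
Qed.

Lemma off_partial f i : off f -> off (partial i f).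
Proof. by move=> f0 x Kx; have [_] := off_is_derive i f0 Kx. Qed.

Arguments off_partial {f} i _.

Lemma off_supp f : off f -> supp_in 1 f.
Proof.
move=> f0 x x1; apply: f0 => /KO /andP[_ r1].
by have := norm_le_rad x; rewrite leNgt (lt_trans r1).
Qed.

(** At a point of [K] continuity is the hypothesis on the ball; away from [K], which is closed, the
    function is 0 on a whole neighbourhood. *)
Lemma C0O_ucs f : C0O f -> off f -> ucs f.
Proof.
move=> fc f0; apply/ucsP; split; last by exists 1; exact: off_supp.
move=> x; have [/KO /fc//|Kx] := pselect (K x).
exact: near0_continuous (off_near f0 Kx).
Qed.

Lemma C1O_C1s f : C1O f -> off f -> C1s f.
Proof.
move=> fC f0; split; first exact: C0O_ucs (C1O_C0O fC) f0.
move=> i; split; last exact: C0O_ucs (C1O_partial i fC) (off_partial i f0).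
move=> x; have [/KO xO|Kx] := pselect (K x).
  by have [] := C1O_derive i fC xO.
by have [] := off_is_derive i f0 Kx.
Qed.

Lemma eq_iint_off f g : off f -> off g -> (forall x, pball x -> f x = g x) ->
  iint f = iint g.
Proof.
move=> f0 g0 fg; congr iint; apply/funext => x.
have [/KO/fg//|Kx] := pselect (K x); by rewrite f0// g0.
Qed.

Definition vf (c : 'I_n -> V -> R) f x := \sum_(i < n) c i x * partial i f x.
Definition fdiv (c : 'I_n -> V -> R) x := \sum_(i < n) partial i (c i) x.

Lemma off_vf c f : off f -> off (vf c f).
Proof. by move=> f0 x Kx; apply: big1 => i _; rewrite off_partial// mulr0. Qed.

Arguments off_vf c {f} _.

(** Weak form of c(d b) - d(c b) = [c, d] b, tested against [A] and integrated by parts once on each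
    side, so that it makes sense for C^1 functions. It is [iint_partial_swap] applied to each
    product A c_i d_l and summed over [i] and [l]. *)
Lemma iint_fields (c d : 'I_n -> V -> R) A b :
  (forall i, C1O (c i)) -> (forall i, C1O (d i)) ->
  C1O A -> off A -> C1O b -> off b ->
  iint (fun x => vf c A x * vf d b x - vf d A x * vf c b x + A x *
    (\sum_(l < n) (vf c (d l) x - vf d (c l) x) * partial l b x
     + fdiv c x * vf d b x - fdiv d x * vf c b x)) = 0.
Proof.
move=> cC dC AC A0 bC b0.
have cdC i l := C1O_M (cC i) (dC l).
have AcdC i l := C1O_M AC (cdC i l).1.
pose B i l x := A x * (c i x * d l x).
have B1 i l : C1s (B i l).
  by apply: C1O_C1s; [exact: (AcdC i l).1|move=> x Kx; rewrite /B A0// mul0r].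
have b1 := C1O_C1s bC b0.
have u i l j m : ucs (fun x => partial j (B i l) x * partial m b x).
  by apply: ucsMM; [have [_ /(_ j)[]] := B1 i l|have [_ /(_ m)[]] := b1].
transitivity (iint (fun x => \sum_(i < n) \sum_(l < n)
    (partial i (B i l) x * partial l b x - partial l (B i l) x * partial i b x))).
  apply: eq_iint_off.
  - move=> x Kx; rewrite A0// mul0r addr0.
    by rewrite (off_vf c A0)// (off_vf d A0)// !mul0r subrr.
  - move=> x Kx; rewrite big1// => i _; rewrite big1// => l _.
    by rewrite !(off_partial _ b0)// !mulr0 subrr.
  - move=> x xO; rewrite /vf /fdiv field_algebra.
    apply: eq_bigr => i _; apply: eq_bigr => l _.
    by rewrite /B !(AcdC i l).2// !(cdC i l).2//.
rewrite iint_sum => [|i]; last first.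
  by apply: ucs_sum => l; apply: ucsB; exact: u.
apply: big1 => i _; rewrite iint_sum => [|l]; last by apply: ucsB; exact: u.
apply: big1 => l _; rewrite iintB; [|exact: u|exact: u].
by rewrite (iint_partial_swap i l (B1 i l) b1) subrr.
Qed.

Lemma iint_fdiv (c : 'I_n -> V -> R) A :
  (forall i, C1O (c i)) -> C1O A -> off A ->
  iint (fun x => vf c A x + fdiv c x * A x) = 0.
Proof.
move=> cC AC A0; have AcC i := C1O_M AC (cC i).
have Ac0 i : off (fun x => A x * c i x) by move=> x Kx; rewrite A0// mul0r.
transitivity (iint (fun x => \sum_(i < n) partial i (fun x => A x * c i x) x)).
  apply: eq_iint_off.
  - by move=> x Kx; rewrite (off_vf c A0)// A0// mulr0 addr0.
  - by move=> x Kx; rewrite big1// => i _; rewrite (off_partial _ (Ac0 i)).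
  - move=> x xO; rewrite /vf /fdiv mulr_suml -big_split/=; apply: eq_bigr => i _.
    by rewrite (AcC i).2//; ring.
rewrite iint_sum => [|i].
  by apply: big1 => i _; apply: iint_partial; exact: C1O_C1s (AcC i).1 (Ac0 i).
exact: C0O_ucs (C1O_partial i (AcC i).1) (off_partial i (Ac0 i)).
Qed.

End Fields.
Arguments off_partial {R n K} cK {f} i _.
Arguments off_vf {R n K} cK c {f} _.

(** * The Euler field and the spherical gradient *)

Section EulerAngular.
Variables (R : realType) (n : nat).
Notation V := 'rV[R]_n.
Implicit Types (f g A b : V -> R).

Definition ce (i : 'I_n) (x : V) : R := x 0 i.
(** Coefficient of d_i in [del j]: [rad x] times the (j, i) entry of the orthogonal projection onto
    the tangent space of the sphere. Hence its symmetry, the annihilation of x in [sum_cd_coord],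
    and the idempotence behind [sum_cd_cd]. *)
Definition cd (j i : 'I_n) (x : V) : R :=
  (j == i)%:R * rad x - x 0 j * x 0 i * (rad x)^-1.

(* [eul] is [r d/dr] and [del j] is the [j]-th component of the spherical gradient. *)
Definition eul f x := vf ce f x.
Definition del j f x := vf (cd j) f x.

Lemma rad_gt0 (x : V) : pball x -> 0 < rad x. Proof. by case/andP. Qed.

Lemma rad_neq0 (x : V) : pball x -> rad x != 0.
Proof. by move=> /rad_gt0; exact: lt0r_neq0. Qed.

Lemma C1O_rad : C1O (@Defs.rad R n) /\
  forall i x, pball x -> partial i (@Defs.rad R n) x = x 0 i / rad x.
Proof.
have h1 (s : R) : 0 < s < 1 -> is_derive s 1 id (1 : R) by move=> _; exact: is_derive_id.
have h2 (s : R) : 0 < s < 1 -> continuous_at s (fun=> 1 : R) by move=> _; exact: cst_continuous.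
have [C p] := @C1O_radial R n _ _ h1 h2.
by split => // i x xO; rewrite p// mul1r.
Qed.

Lemma C1O_radV : C1O (fun x : V => (rad x)^-1) /\
  forall i x, pball x -> partial i (fun x : V => (rad x)^-1) x = - x 0 i / rad x ^+ 3.
Proof.
have h1 (s : R) : 0 < s < 1 -> is_derive s 1 (fun s => s^-1) (- s ^- 2).
  move=> /andP[s0 _]; have s1 : s != 0 by rewrite gt_eqF.
  apply: is_derive_eq; first exact: (is_deriveV s1 (is_derive_id s 1)).
  by rewrite -[_ *: _]/(_ * _) mulr1.
have h2 (s : R) : 0 < s < 1 -> continuous_at s (fun s => - s ^- 2).
  move=> /andP[s0 _]; have s1 : s ^+ 2 != 0 by rewrite expf_neq0// gt_eqF.
  have c1 : continuous_at s (fun s : R => s ^+ 2) by exact: exprn_continuous.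
  have c2 : continuous_at s (fun s : R => s ^- 2) by apply: (continuousV _ c1).
  exact: continuousN c2.
have [C p] := @C1O_radial R n _ _ h1 h2.
split => // i x xO; rewrite p//; field; exact: rad_neq0.
Qed.

(** The gradient is arranged as a multiple of [x] plus Kronecker terms, the shape that
    [sum_lin_kron] contracts with any field. *)
Lemma C1O_cd j l : C1O (cd j l) /\ forall i x, pball x -> partial i (cd j l) x =
  ((j == l)%:R / rad x + x 0 j * x 0 l / rad x ^+ 3) * x 0 i
  + (j == i)%:R * (- x 0 l / rad x) + (l == i)%:R * (- x 0 j / rad x).
Proof.
have t1 := C1O_M (C1O_cst n (j == l)%:R).1 C1O_rad.1.
have t2 := C1O_M (C1O_coord R j).1 (C1O_coord R l).1.
have t3 := C1O_M t2.1 C1O_radV.1.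
have t4 := C1O_N t3.1.
have t5 := C1O_D t1.1 t4.1.
split; first exact: t5.1.
move=> i x xO; have r0 := rad_neq0 xO.
rewrite t5.2// t4.2// t3.2// t2.2// t1.2// C1O_rad.2// C1O_radV.2// (C1O_cst _ _).2//.
by rewrite (C1O_coord R j).2// (C1O_coord R l).2//; field.
Qed.

Lemma sum_sqr_coord (x : V) : \sum_(i < n) x 0 i * x 0 i = rad x ^+ 2.
Proof. by rewrite sqr_rad. Qed.

Lemma sum_cd_coord j (x : V) : pball x -> \sum_(i < n) cd j i x * x 0 i = 0.
Proof.
move=> xO; have r0 := rad_neq0 xO.
under eq_bigr => i _.
  have -> : cd j i x * x 0 i =
    (j == i)%:R * (rad x * x 0 i) + - (x 0 j / rad x) * (x 0 i * x 0 i).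
    by rewrite /cd; ring.
  over.
by rewrite big_split/= sum_kron -mulr_sumr sum_sqr_coord; field.
Qed.

Lemma cd_sym j l (x : V) : cd j l x = cd l j x.
Proof. by rewrite /cd eq_sym [x 0 j * _]mulrC. Qed.

Lemma vf_coord (c : 'I_n -> V -> R) j x : pball x ->
  vf c (fun x : V => x 0 j) x = c j x.
Proof.
move=> xO; rewrite /vf -[RHS](sum_kron (fun i => c i x) j).
by apply: eq_bigr => i _; rewrite (C1O_coord R j).2// mulrC.
Qed.

Lemma vf_cd (c : 'I_n -> V -> R) j l x : pball x -> vf c (cd j l) x =
  ((j == l)%:R / rad x + x 0 j * x 0 l / rad x ^+ 3) * (\sum_(i < n) c i x * x 0 i)
  + (- x 0 l / rad x) * c j x + (- x 0 j / rad x) * c l x.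
Proof.
move=> xO; rewrite /vf -sum_lin_kron; apply: eq_bigr => i _.
by rewrite (C1O_cd j l).2.
Qed.

Lemma fdiv_ce x : pball x -> fdiv ce x = n%:R.
Proof.
move=> xO; rewrite /fdiv; under eq_bigr do rewrite (C1O_coord R _).2// eqxx.
by rewrite sumr_const card_ord.
Qed.

Lemma fdiv_cd j x : pball x -> fdiv (cd j) x = - (n%:R - 1) * (x 0 j / rad x).
Proof.
move=> xO; have r0 := rad_neq0 xO; rewrite /fdiv.
under eq_bigr => i _.
  rewrite (C1O_cd j i).2// eqxx mul1r.
  have -> : ((j == i)%:R / rad x + x 0 j * x 0 i / rad x ^+ 3) * x 0 i +
      (j == i)%:R * (- x 0 i / rad x) + - x 0 j / rad x =
    (x 0 j / rad x ^+ 3) * (x 0 i * x 0 i) + - x 0 j / rad x by field.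
  over.
rewrite big_split/= -mulr_sumr sum_sqr_coord sumr_const card_ord -mulr_natr.
by field.
Qed.

Lemma delE j f x : del j f x = rad x * partial j f x - x 0 j / rad x * eul f x.
Proof.
rewrite /del /eul /vf mulr_sumr -(sum_kron (fun i => rad x * partial i f x) j).
by rewrite -sumrB; apply: eq_bigr => i _; rewrite /cd /ce; ring.
Qed.

Lemma sum_coord_del f x : pball x -> \sum_(j < n) x 0 j * del j f x = 0.
Proof.
move=> xO; have r0 := rad_neq0 xO.
under eq_bigr => j _.
  have -> : x 0 j * del j f x = rad x * (x 0 j * partial j f x)
    - eul f x / rad x * (x 0 j * x 0 j) by rewrite delE; ring.
  over.
rewrite sumrB -!mulr_sumr sum_sqr_coord -/(vf ce f x) -/(eul f x); by field.
Qed.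

Lemma vfM (c : 'I_n -> V -> R) f g x : C1O f -> C1O g -> pball x ->
  vf c (fun x => f x * g x) x = f x * vf c g x + g x * vf c f x.
Proof.
move=> fC gC xO; rewrite /vf !mulr_sumr -big_split/=; apply: eq_bigr => i _.
by rewrite (C1O_M fC gC).2//; ring.
Qed.

Lemma vf_sum (c : 'I_n -> V -> R) (F : 'I_n -> V -> R) x :
  (forall j, C1O (F j)) -> pball x ->
  vf c (fun x => \sum_(j < n) F j x) x = \sum_(j < n) vf c (F j) x.
Proof.
move=> FC xO; rewrite /vf exchange_big; apply: eq_bigr => i _.
by rewrite (C1O_sum _ FC).2// mulr_sumr.
Qed.

Lemma vf_near (c : 'I_n -> V -> R) f g x : (forall y, pball y -> f y = g y) ->
  pball x -> vf c f x = vf c g x.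
Proof.
move=> fg xO; rewrite /vf; apply: eq_bigr => i _; congr (_ * _).
rewrite /partial; apply: near_eq_derive.
by apply: filterS (open_nbhs_nbhs (conj (@open_pball R n) xO)) => y /fg.
Qed.

End EulerAngular.

(** * Integration by parts along the Euler field and the spherical gradient *)

Section EulerAngularIBP.
Variables (R : realType) (n : nat).
Notation V := 'rV[R]_n.
Variables (K : set V) (cK : compact K) (KO : K `<=` @pball R n).
Implicit Types (f g A b : V -> R).

Lemma off_eul f : off K f -> off K (eul f).
Proof. exact: off_vf. Qed.

Lemma off_del j f : off K f -> off K (del j f).
Proof. exact: off_vf. Qed.

Lemma iint_eul A : C1O A -> off K A -> iint (fun x => eul A x + n%:R * A x) = 0.
Proof.
move=> hA A0; rewrite -[RHS](iint_fdiv cK KO (fun i => (C1O_coord R i).1) hA A0).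
apply: (eq_iint_off KO).
- by move=> x Kx; rewrite (off_eul A0)// A0// mulr0 addr0.
- by move=> x Kx; rewrite (off_vf cK _ A0)// A0// mulr0 addr0.
- by move=> x xO; rewrite fdiv_ce.
Qed.

Lemma iint_del j A : C1O A -> off K A ->
  iint (fun x => del j A x - (n%:R - 1) * (x 0 j / rad x) * A x) = 0.
Proof.
move=> hA A0; rewrite -[RHS](iint_fdiv cK KO (fun i => (C1O_cd R j i).1) hA A0).
apply: (eq_iint_off KO).
- by move=> x Kx; rewrite (off_del j A0)// A0// mulr0 subr0.
- by move=> x Kx; rewrite (off_vf cK _ A0)// A0// mulr0 addr0.
- by move=> x xO; rewrite fdiv_cd// mulNr mulNr.
Qed.

(** The coefficients of [del j] are homogeneous of degree one, so the two fields commute and only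
    the divergences of [iint_fields] survive. *)
Lemma iint_eul_del j A b : C1O A -> off K A -> C1O b -> off K b ->
  iint (fun x => eul A x * del j b x - del j A x * eul b x +
    A x * (n%:R * del j b x + (n%:R - 1) * (x 0 j / rad x) * eul b x)) = 0.
Proof.
move=> hA A0 hb b0.
rewrite -[RHS](iint_fields cK KO (fun i => (C1O_coord R i).1) (fun i => (C1O_cd R j i).1) hA A0 hb b0).
have A0' c := off_vf cK c A0.
apply: (eq_iint_off KO).
- by move=> x Kx; rewrite (off_eul A0)// (off_del j A0)// A0// !mul0r subrr addr0.
- by move=> x Kx; rewrite !A0'// A0// !mul0r subrr addr0.
- move=> x xO; have r0 := rad_neq0 xO; rewrite big1 => [|l _].
    by rewrite fdiv_ce// fdiv_cd// -/(eul b x) -/(del j b x) /eul /del; ring.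
  rewrite (vf_coord _ l)// vf_cd// /ce sum_sqr_coord.
  have -> : ((j == l)%:R / rad x + x 0 j * x 0 l / rad x ^+ 3) * rad x ^+ 2 +
    - x 0 l / rad x * x 0 j + - x 0 j / rad x * x 0 l = cd j l x.
    by rewrite /cd; field.
  by rewrite subrr mul0r.
Qed.

(** The bracket of the two fields is (x_k / r) del_j - (x_j / r) del_k, whence the 1; their
    divergences contribute the same combination with coefficient -(n - 1). *)
Lemma iint_del_del k j A b : C1O A -> off K A -> C1O b -> off K b ->
  iint (fun x => del k A x * del j b x - del j A x * del k b x + A x *
    ((1 - (n%:R - 1)) * (x 0 k / rad x * del j b x - x 0 j / rad x * del k b x))) = 0.
Proof.
move=> hA A0 hb b0.
rewrite -[RHS](iint_fields cK KO (fun i => (C1O_cd R k i).1) (fun i => (C1O_cd R j i).1) hA A0 hb b0).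
have A0' c := off_vf cK c A0.
apply: (eq_iint_off KO).
- by move=> x Kx; rewrite !(off_del _ A0)// A0// !mul0r subrr addr0.
- by move=> x Kx; rewrite !A0'// A0// !mul0r subrr addr0.
- move=> x xO; have r0 := rad_neq0 xO.
  have -> : \sum_(l < n) (vf (cd k) (cd j l) x - vf (cd j) (cd k l) x) * partial l b x =
    x 0 k / rad x * del j b x - x 0 j / rad x * del k b x.
    rewrite /del /vf !mulr_sumr -sumrB; apply: eq_bigr => l _.
    rewrite -/(vf (cd k) (cd j l) x) -/(vf (cd j) (cd k l) x) !vf_cd// !sum_cd_coord//.
    by rewrite (cd_sym k j); field.
  by rewrite !fdiv_cd// -/(del j b x) -/(del k b x) /del; ring.
Qed.

End EulerAngularIBP.

(** * Symmetry of second derivatives *)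

Section Schwarz.
Variables (R : realType) (n : nat).
Notation V := 'rV[R]_n.

Lemma second_difference (u : V -> R) (i j : 'I_n) (x : V) (h : R) :
  (forall y, derivable u y (ebasis R i)) ->
  (forall y, derivable (partial i u) y (ebasis R j)) ->
  exists s t : R, [/\ `|s| <= `|h|, `|t| <= `|h| &
    u (x + h *: ebasis R i + h *: ebasis R j) - u (x + h *: ebasis R i)
    - (u (x + h *: ebasis R j) - u x) =
    h * (h * partial j (partial i u) (x + s *: ebasis R i + t *: ebasis R j))].
Proof.
move=> ud pd; pose g y := u (y + h *: ebasis R j) - u y.
have gd y : derivable g y (ebasis R i).
  by apply: derivableB; [exact: derivable_shift|exact: ud].
have gE y : 'D_(ebasis R i) g y = partial i u (y + h *: ebasis R j) - partial i u y.
  have ds := derivable_shift (ud (y + h *: ebasis R j)).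
  by rewrite /g (deriveB ds (ud y)) -(partial_shift u).
have [s sh E] := line_MVT x h gd.
rewrite gE in E.
have [t th E'] := line_MVT (x + s *: ebasis R i) h pd.
exists s, t; split => //.
by rewrite -[LHS]/(g (x + h *: ebasis R i) - g x) E E'.
Qed.

(** The second difference is symmetric in the two directions, and the mean value theorem, applied in
    either order, makes it h^2 times one or the other mixed derivative at a point near [x];
    continuity concludes. *)
Lemma schwarz (u : V -> R) (i j : 'I_n) (x : V) : C2 u ->
  partial j (partial i u) x = partial i (partial j u) x.
Proof.
move=> [_ [ud [_ [pd pc]]]].
apply/eqP; rewrite -subr_eq0 -normr_le0; apply/ler_addgt0Pl => e e0; rewrite addr0.
have e20 : 0 < e / 2 by rewrite divr_gt0.
have /cvgrPdist_lt/(_ _ e20)/nbhs_ballP[d1 /= d10 h1] := pc i j x.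
have /cvgrPdist_lt/(_ _ e20)/nbhs_ballP[d2 /= d20 h2] := pc j i x.
(* Two displacements of length at most [h] then stay within both radii. *)
pose h := Num.min d1 d2 / 3.
have m0 : 0 < Num.min d1 d2 by rewrite lt_min d10.
have h0 : 0 < h by rewrite divr_gt0.
have hn : h != 0 by rewrite gt_eqF.
have [s [t [sh th E]]] := second_difference x h (ud i) (pd i j).
have [s' [t' [sh' th' E']]] := second_difference x h (ud j) (pd j i).
have close (a b : R) (k l : 'I_n) : `|a| <= `|h| -> `|b| <= `|h| ->
    `|x - (x + a *: ebasis R k + b *: ebasis R l)| < Num.min d1 d2.
  move=> ah bh; rewrite -addrA opprD addrA subrr sub0r normrN.
  apply: le_lt_trans (ler_normD _ _) _.
  apply: le_lt_trans (lerD (le_trans (norm_ebasis a k) ah) (le_trans (norm_ebasis b l) bh)) _.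
  by rewrite (gtr0_norm h0) /h; move: (Num.min d1 d2) m0 => m m0; clear -m0; lra.
have eqP' : partial j (partial i u) (x + s *: ebasis R i + t *: ebasis R j) =
    partial i (partial j u) (x + s' *: ebasis R j + t' *: ebasis R i).
  have sub4 (a b c d : R) : a - b - (c - d) = a - c - (b - d) by ring.
  have mid := sub4 (u (x + h *: ebasis R i + h *: ebasis R j)) (u (x + h *: ebasis R i))
    (u (x + h *: ebasis R j)) (u x).
  rewrite [X in u X - u (x + h *: ebasis R j)]addrAC in mid.
  exact: (mulfI hn (mulfI hn (etrans (esym E) (etrans mid E')))).
have c1 : `|partial j (partial i u) x -
    partial j (partial i u) (x + s *: ebasis R i + t *: ebasis R j)| < e / 2.
  apply: h1; rewrite -ball_normE /=; apply: lt_le_trans (close s t i j sh th) _.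
  by rewrite ge_min lexx.
have c2 : `|partial i (partial j u) x -
    partial i (partial j u) (x + s' *: ebasis R j + t' *: ebasis R i)| < e / 2.
  apply: h2; rewrite -ball_normE /=; apply: lt_le_trans (close s' t' j i sh' th') _.
  by rewrite ge_min lexx orbT.
rewrite eqP' in c1; move: c1 c2.
set P := partial j (partial i u) x; set Q := partial i (partial j u) x.
set W := partial i _ _; move: P Q W => P Q W c1 c2; clear -c1 c2.
have -> : P - Q = (P - W) - (Q - W) by ring.
by apply: le_trans (ler_normB _ _) _; lra.
Qed.

End Schwarz.

(** * Commutators and the spherical Laplacian *)

Section SecondOrder.
Variables (R : realType) (n : nat).
Notation V := 'rV[R]_n.
Variables (u : V -> R).
Hypothesis (u2 : C2 u).

Lemma C2_C1O : C1O u.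
Proof.
have [uc [ud [pc _]]] := u2; split=> [x _|i]; first exact: uc.
by split=> x _; [exact: pc|exact: ud].
Qed.

Lemma C2_partial_C1O i : C1O (partial i u).
Proof.
have [_ [_ [pc [pd ppc]]]] := u2; split=> [x _|j]; first exact: pc.
by split=> x _; [exact: ppc|exact: pd].
Qed.

Lemma C1O_eul : C1O (eul u).
Proof.
exact: (C1O_sum _ (fun i => (C1O_M (C1O_coord R i).1 (C2_partial_C1O i)).1)).1.
Qed.

Lemma C1O_del j : C1O (del j u).
Proof.
exact: (C1O_sum _ (fun i => (C1O_M (C1O_cd R j i).1 (C2_partial_C1O i)).1)).1.
Qed.

Lemma vf_eul (c : 'I_n -> V -> R) x : pball x -> vf c (eul u) x =
  \sum_(l < n) x 0 l * vf c (partial l u) x + \sum_(l < n) c l x * partial l u x.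
Proof.
move=> xO.
have h i := C1O_M (C1O_coord R i).1 (C2_partial_C1O i).
rewrite [LHS](@vf_sum _ _ c (fun i x => x 0 i * partial i u x) x (fun i => (h i).1) xO).
rewrite -big_split/=; apply: eq_bigr => l _.
rewrite (vfM c (C1O_coord R l).1 (C2_partial_C1O l) xO) vf_coord//; ring.
Qed.

Lemma vf_del (c : 'I_n -> V -> R) j x : pball x -> vf c (del j u) x =
  \sum_(l < n) cd j l x * vf c (partial l u) x +
  \sum_(l < n) vf c (cd j l) x * partial l u x.
Proof.
move=> xO.
have h i := C1O_M (C1O_cd R j i).1 (C2_partial_C1O i).
rewrite [LHS](@vf_sum _ _ c (fun i x => cd j i x * partial i u x) x (fun i => (h i).1) xO).
rewrite -big_split/=; apply: eq_bigr => l _.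
rewrite (vfM c (C1O_cd R j l).1 (C2_partial_C1O l) xO); ring.
Qed.

Lemma hess_swap (c d : 'I_n -> R) x :
  \sum_(l < n) c l * (\sum_(i < n) d i * partial i (partial l u) x) =
  \sum_(l < n) d l * (\sum_(i < n) c i * partial i (partial l u) x).
Proof.
under eq_bigr do rewrite mulr_sumr.
under [RHS]eq_bigr do rewrite mulr_sumr.
rewrite exchange_big; apply: eq_bigr => i _; apply: eq_bigr => l _.
by rewrite (schwarz l i x u2); ring.
Qed.

Lemma del_eul_comm j x : pball x -> del j (eul u) x = eul (del j u) x.
Proof.
move=> xO; have r0 := rad_neq0 xO.
rewrite /del {1}/vf -/(vf (cd j) (eul u) x) vf_eul// /eul vf_del//.
congr (_ + _); first exact: hess_swap.
apply: eq_bigr => l _; rewrite vf_cd// /ce sum_sqr_coord; congr (_ * _).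
by rewrite /cd; field.
Qed.

Lemma comm_cd k j l (x : V) : pball x -> vf (cd k) (cd j l) x - vf (cd j) (cd k l) x =
  x 0 k / rad x * cd j l x - x 0 j / rad x * cd k l x.
Proof.
move=> xO; have r0 := rad_neq0 xO; rewrite !vf_cd// !sum_cd_coord//.
by rewrite (cd_sym k j); field.
Qed.

Lemma del_del_comm k j x : pball x -> del k (del j u) x - del j (del k u) x =
  x 0 k / rad x * del j u x - x 0 j / rad x * del k u x.
Proof.
move=> xO.
rewrite (vf_del (cd k) j xO : del k (del j u) x = _).
rewrite (vf_del (cd j) k xO : del j (del k u) x = _).
rewrite (hess_swap (fun l => cd j l x) (fun l => cd k l x)).
rewrite opprD addrACA subrr add0r -sumrB /del /vf !mulr_sumr -sumrB.
apply: eq_bigr => l _; rewrite -mulrBl -/(vf (cd k) (cd j l) x) -/(vf (cd j) (cd k l) x).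
by rewrite comm_cd//; ring.
Qed.

Lemma sum_cd_cd l i (x : V) : pball x ->
  \sum_(j < n) cd j l x * cd j i x = rad x * cd l i x.
Proof.
move=> xO; have r0 := rad_neq0 xO.
under eq_bigr => j _.
  have -> : cd j l x * cd j i x =
    (l == j)%:R * (rad x * cd j i x) - x 0 l / rad x * (cd i j x * x 0 j).
    by rewrite (cd_sym i j) /cd (eq_sym l j); ring.
  over.
by rewrite sumrB sum_kron -mulr_sumr sum_cd_coord// mulr0 subr0.
Qed.

Lemma sum_cd_diag (x : V) : pball x -> \sum_(j < n) cd j j x = (n%:R - 1) * rad x.
Proof.
move=> xO; have r0 := rad_neq0 xO.
under eq_bigr => j _.
  have -> : cd j j x = rad x - (rad x)^-1 * (x 0 j * x 0 j) by rewrite /cd eqxx mul1r; ring.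
  over.
by rewrite sumrB -mulr_sumr sum_sqr_coord sumr_const card_ord -mulr_natr; field.
Qed.

(** The left side is the Laplacian of the unit sphere, and the identity is the polar decomposition
    of the Euclidean Laplacian. [sum_cd_cd] contracts the second-order part; the derivatives of the
    coefficients give -(n - 1) [eul u], one copy of which is absorbed by the first-order part of
    [eul (eul u)]. *)
Lemma sum_del_del x : pball x -> \sum_(j < n) del j (del j u) x =
  rad x ^+ 2 * (\sum_(j < n) partial j (partial j u) x)
  - eul (eul u) x - (n%:R - 2) * eul u x.
Proof.
move=> xO; have r0 := rad_neq0 xO.
have -> : eul (eul u) x = \sum_(l < n) \sum_(i < n) x 0 l * x 0 i * partial i (partial l u) x
    + eul u x.
  rewrite [LHS]vf_eul//; congr (_ + _); apply: eq_bigr => l _.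
  by rewrite /vf mulr_sumr; apply: eq_bigr => i _; rewrite /ce mulrA.
under eq_bigr do rewrite (vf_del (cd _) _ xO : del _ (del _ u) x = _).
rewrite big_split/=.
have -> : \sum_(j < n) \sum_(l < n) vf (cd j) (cd j l) x * partial l u x =
    - (n%:R - 1) * eul u x.
  rewrite exchange_big /eul /vf mulr_sumr; apply: eq_bigr => l _.
  rewrite -mulr_suml mulrA; congr (_ * _).
  under eq_bigr => j _.
    rewrite -/(vf (cd j) (cd j l) x) vf_cd// sum_cd_coord// mulr0 add0r.
    rewrite (cd_sym j l).
    have -> : - x 0 l / rad x * cd j j x + - x 0 j / rad x * cd l j x =
      - x 0 l / rad x * cd j j x - (rad x)^-1 * (cd l j x * x 0 j) by ring.
    over.
  rewrite sumrB -!mulr_sumr sum_cd_coord// sum_cd_diag// /ce; by field.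
have -> : \sum_(j < n) \sum_(l < n) cd j l x * vf (cd j) (partial l u) x =
    rad x ^+ 2 * (\sum_(l < n) partial l (partial l u) x)
      - \sum_(l < n) \sum_(i < n) x 0 l * x 0 i * partial i (partial l u) x.
  rewrite mulr_sumr -sumrB exchange_big; apply: eq_bigr => l _.
  have -> : \sum_(j < n) cd j l x * vf (cd j) (partial l u) x =
      \sum_(i < n) rad x * cd l i x * partial i (partial l u) x.
    rewrite /vf; under eq_bigr do rewrite mulr_sumr.
    rewrite exchange_big; apply: eq_bigr => i _.
    by rewrite -sum_cd_cd// mulr_suml; apply: eq_bigr => j _; rewrite mulrA.
  rewrite -(sum_kron (fun i => rad x ^+ 2 * partial i (partial l u) x) l) -sumrB.
  apply: eq_bigr => i _; rewrite /cd; by field.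
move: (\sum_(j < n) partial j (partial j u) x) (eul u x) => S p.
by move: (\sum_(l < n) \sum_(i < n) _) => D; ring.
Qed.

Lemma sum_coord_eul_del x : pball x -> \sum_(j < n) x 0 j * eul (del j u) x = 0.
Proof.
move=> xO; under eq_bigr do rewrite -del_eul_comm//.
exact: sum_coord_del.
Qed.

(** Differentiate the tangency relation [sum_coord_del] along [del k]: the derivative falling on x_j
    produces [cd k j], which acts on a tangent vector as multiplication by [rad x]. *)
Lemma sum_coord_del_del k x : pball x ->
  \sum_(j < n) x 0 j * del k (del j u) x = - rad x * del k u x.
Proof.
move=> xO.
have h i := C1O_M (C1O_coord R i).1 (C1O_del i).
have := @vf_near _ _ (cd k) (fun x => \sum_(j < n) x 0 j * del j u x) (fun=> 0) x
  (sum_coord_del u) xO.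
have -> : vf (cd k) (fun=> 0) x = 0.
  by rewrite /vf big1// => i _; rewrite (C1O_cst _ _).2// mulr0.
rewrite (@vf_sum _ _ (cd k) (fun i x => x 0 i * del i u x) x (fun i => (h i).1) xO).
under eq_bigr do rewrite (vfM _ (C1O_coord R _).1 (C1O_del _) xO) vf_coord//.
rewrite big_split/= => /eqP; rewrite addr_eq0 => /eqP ->; rewrite mulNr; congr (- _).
have r0 := rad_neq0 xO.
under eq_bigr => j _.
  have -> : del j u x * cd k j x =
    (k == j)%:R * (rad x * del j u x) - x 0 k / rad x * (x 0 j * del j u x).
    by rewrite /cd; ring.
  over.
by rewrite sumrB sum_kron -mulr_sumr sum_coord_del// mulr0 subr0.
Qed.

End SecondOrder.

(** * Radial weights *)

Section RadialFunctions.
Variables (R : realType) (n : nat).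
Notation V := 'rV[R]_n.

(* On the punctured ball [kk] is [1 / sinh rho] and [cc] is [coth rho]. *)
Definition kk (x : V) : R := 2^-1 * ((rad x)^-1 - rad x).
Definition cc (x : V) : R := 2^-1 * ((rad x)^-1 + rad x).

(* The gradient of [f] is radial, hence [del j f = 0]. *)
Definition radgrad (f g : V -> R) :=
  C1O f /\ forall i x, pball x -> partial i f x = g x * x 0 i.

Lemma eul_radgrad f g x : radgrad f g -> pball x -> eul f x = g x * rad x ^+ 2.
Proof.
move=> [_ fg] xO; rewrite -sum_sqr_coord mulr_sumr; apply: eq_bigr => i _.
by rewrite fg// mulrCA.
Qed.

Lemma del_radgrad f g j x : radgrad f g -> pball x -> del j f x = 0.
Proof.
move=> [_ fg] xO; rewrite -[RHS](mulr0 (g x)) -(sum_cd_coord j xO) mulr_sumr.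
by apply: eq_bigr => i _; rewrite fg// mulrCA.
Qed.

Lemma radgradM f g f' g' : radgrad f f' -> radgrad g g' ->
  radgrad (fun x => f x * g x) (fun x => f x * g' x + g x * f' x).
Proof.
move=> [fC ff] [gC gg]; have [C p] := C1O_M fC gC; split => // i x xO.
by rewrite p// ff// gg//; ring.
Qed.

Lemma radgradX f f' m : radgrad f f' ->
  radgrad (fun x => f x ^+ m.+1) (fun x => m.+1%:R * f x ^+ m * f' x).
Proof.
move=> fr; elim: m => [|m [IHC IHp]].
  have [C p] := fr; split; first exact: C.
  by move=> i x xO; rewrite [LHS]p// expr0 mulr1 mul1r.
have [C p] := radgradM fr (conj IHC IHp).
have E : (fun x => f x ^+ m.+2) = (fun x => f x * f x ^+ m.+1).
  by apply/funext => x; rewrite exprS.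
split; first by rewrite E.
move=> i x xO; rewrite E p// -[m.+2%:R]natr1 exprS; ring.
Qed.

Lemma radgrad_cst a : radgrad (fun=> a) (fun=> 0).
Proof. by have [C p] := C1O_cst n a; split => // i x xO; rewrite p// mul0r. Qed.

Lemma radgrad_kk : radgrad kk (fun x => - cc x / rad x ^+ 2).
Proof.
have t2 := C1O_N (C1O_rad R n).1.
have t3 := C1O_D (C1O_radV R n).1 t2.1.
have t4 := C1O_M (C1O_cst n (2^-1 : R)).1 t3.1.
split; first exact: t4.1.
move=> i x xO; have r0 := rad_neq0 xO.
rewrite t4.2// t3.2// t2.2// (C1O_rad R n).2// (C1O_radV R n).2// (C1O_cst _ _).2//.
by rewrite /cc; field.
Qed.

Lemma radgrad_cc : radgrad cc (fun x => - kk x / rad x ^+ 2).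
Proof.
have t3 := C1O_D (C1O_radV R n).1 (C1O_rad R n).1.
have t4 := C1O_M (C1O_cst n (2^-1 : R)).1 t3.1.
split; first exact: t4.1.
move=> i x xO; have r0 := rad_neq0 xO.
rewrite t4.2// t3.2// (C1O_rad R n).2// (C1O_radV R n).2// (C1O_cst _ _).2//.
by rewrite /kk; field.
Qed.

Lemma rad_lt1 (x : V) : pball x -> rad x < 1. Proof. by case/andP. Qed.

Lemma sqr_rad_lt1 (x : V) : pball x -> 0 < 1 - rad x ^+ 2.
Proof. by case/andP => r0 r1; rewrite subr_gt0 expr_lt1// ltW. Qed.

Lemma sqr_rad_neq1 (x : V) : pball x -> 1 - rad x ^+ 2 != 0.
Proof. by move=> /sqr_rad_lt1 h; rewrite gt_eqF. Qed.

Lemma kkE (x : V) : pball x -> kk x = (1 - rad x ^+ 2) / (2 * rad x).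
Proof. by move=> xO; have r0 := rad_neq0 xO; rewrite /kk; field. Qed.

Lemma kk_gt0 (x : V) : pball x -> 0 < kk x.
Proof.
move=> xO; rewrite kkE// divr_gt0 ?sqr_rad_lt1// mulr_gt0//; exact: rad_gt0.
Qed.

Lemma kk_neq0 (x : V) : pball x -> kk x != 0.
Proof. by move=> /kk_gt0 h; rewrite gt_eqF. Qed.

Lemma cc_kk (x : V) : cc x = kk x + rad x.
Proof. by rewrite /cc /kk; move: (rad x)^-1 => v; field. Qed.

Lemma sqr_cc (x : V) : pball x -> cc x ^+ 2 = 1 + kk x ^+ 2.
Proof. by move=> xO; have r0 := rad_neq0 xO; rewrite /cc /kk; field. Qed.

Lemma lamE (x : V) : pball x -> lam x = (kk x * rad x)^-1.
Proof.
move=> xO; have r0 := rad_neq0 xO; have r1 := sqr_rad_neq1 xO.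
by rewrite /lam kkE//; field; rewrite r0 r1.
Qed.

Lemma lam_gt0 (x : V) : pball x -> 0 < lam x.
Proof. by move=> xO; rewrite lamE// invr_gt0 mulr_gt0// ?kk_gt0//; exact: rad_gt0. Qed.

Lemma radgrad_lam : radgrad (@lam R n) (fun x => lam x ^+ 2).
Proof.
have n1 (s : R) : 0 < s < 1 -> 1 - s ^+ 2 != 0.
  by case/andP => s0 s1; rewrite gt_eqF// subr_gt0 expr_lt1// ltW.
have d0 (s : R) : is_derive s 1 (fun s : R => 1 - s ^+ 2) (- (2 * s)).
  have d := is_deriveB (is_derive_cst (1 : R) s (1 : R)) (is_deriveX 2 (is_derive_id s (1 : R))).
  by apply: is_derive_eq d _; rewrite sub0r expr1 -[_ *: _]/(_ * _) mulr1.
have h1 (s : R) : 0 < s < 1 -> is_derive s 1 (fun s => 2 / (1 - s ^+ 2))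
    (4 * s / (1 - s ^+ 2) ^+ 2).
  move=> /n1 s1.
  have d := is_deriveZ (2 : R) (@is_deriveV _ (fun s : R => 1 - s ^+ 2) s _ _ s1 (d0 s)).
  apply: is_derive_eq d _; rewrite -[_ *: _]/(2 * (_ * _)); by field.
have h2 (s : R) : 0 < s < 1 -> continuous_at s (fun s => 4 * s / (1 - s ^+ 2) ^+ 2).
  move=> /n1 s1.
  have c1 : continuous_at s (fun s : R => 1 - s ^+ 2).
    by apply: differentiable_continuous; apply/derivable1_diffP; have [] := d0 s.
  have c2 : continuous_at s (fun s : R => (1 - s ^+ 2) ^+ 2).
    exact: continuous_comp c1 (@exprn_continuous _ 2 _).
  have c3 : continuous_at s (fun s : R => ((1 - s ^+ 2) ^+ 2)^-1).
    by apply: (continuousV _ c2); rewrite expf_neq0.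
  have c4 : continuous_at s (fun s : R => 4 * s).
    have c0 : continuous_at s (fun s : R => s) by exact: cvg_id.
    exact: continuousM (@cst_continuous _ _ (4 : R) s) c0.
  exact: continuousM c4 c3.
have [C p] := @C1O_radial R n _ _ h1 h2.
split; first exact: C.
move=> i x xO; rewrite [LHS]p// /lam; field.
by rewrite rad_neq0// sqr_rad_neq1.
Qed.

Lemma radgrad_lamX m : radgrad (fun x => lam x ^+ m) (fun x => m%:R * lam x ^+ m.+1).
Proof.
case: m => [|m].
  have [C p] := radgrad_cst 1; split; first exact: C.
  by move=> i x xO; rewrite [LHS]p// !mul0r.
have [C p] := radgradX m radgrad_lam; split => // i x xO.
by rewrite p//; congr (_ * _); rewrite !exprS; ring.
Qed.

Lemma expR_rho (x : V) : pball x -> expR (rho x) = (1 + rad x) / (1 - rad x).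
Proof.
move=> /andP[r0 r1]; rewrite /rho lnK// posrE divr_gt0 ?subr_gt0//.
by rewrite addr_gt0.
Qed.

Lemma sinh_rho (x : V) : pball x -> sinh (rho x) = (kk x)^-1.
Proof.
move=> xO; have r0 := rad_neq0 xO; have r1 := sqr_rad_neq1 xO.
have /andP[p0 p1] := xO.
have a1 : 1 - rad x != 0 by rewrite gt_eqF// subr_gt0.
have a2 : 1 + rad x != 0 by rewrite gt_eqF// addr_gt0.
by rewrite /sinh expRN expR_rho// kkE//; field; rewrite r0 r1 a1 a2.
Qed.

Lemma coth_rho (x : V) : pball x -> coth (rho x) = cc x.
Proof.
move=> xO; have r0 := rad_neq0 xO; have r1 := sqr_rad_neq1 xO.
have /andP[p0 p1] := xO.
have a1 : 1 - rad x != 0 by rewrite gt_eqF// subr_gt0.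
have a2 : 1 + rad x != 0 by rewrite gt_eqF// addr_gt0.
rewrite /coth sinh_rho// invrK /cosh expRN expR_rho// kkE// /cc.
by field; rewrite r0 a1 a2.
Qed.

Lemma rho_gt0 (x : V) : pball x -> 0 < rho x.
Proof.
move=> /andP[r0 r1]; rewrite /rho ln_gt0// ltr_pdivlMr ?subr_gt0// mul1r.
by rewrite ltrD2l gtrN.
Qed.

Lemma radgrad_rhoV : radgrad (fun x : V => (rho x)^-1)
  (fun x => - (rho x)^-1 ^+ 2 / (kk x * rad x ^+ 2)).
Proof.
have p1 (s : R) : 0 < s < 1 -> 1 - s != 0 by case/andP => s0 s1; rewrite gt_eqF// subr_gt0.
have p2 (s : R) : 0 < s < 1 -> 1 + s != 0 by case/andP => s0 s1; rewrite gt_eqF// addr_gt0.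
have q0 (s : R) : 0 < s < 1 -> 1 < (1 + s) / (1 - s).
  by case/andP => s0 s1; rewrite ltr_pdivlMr ?subr_gt0// mul1r ltrD2l gtrN.
have l0 (s : R) : 0 < s < 1 -> ln ((1 + s) / (1 - s)) != 0.
  by move=> /q0 h; rewrite gt_eqF// ln_gt0.
have d1 (s : R) : is_derive s 1 (fun s : R => 1 - s) (-1).
  have d := is_deriveB (is_derive_cst (1 : R) s (1 : R)) (is_derive_id s (1 : R)).
  by apply: is_derive_eq d _; rewrite sub0r.
have d2 (s : R) : is_derive s 1 (fun s : R => 1 + s) 1.
  have d := is_deriveD (is_derive_cst (1 : R) s (1 : R)) (is_derive_id s (1 : R)).
  by apply: is_derive_eq d _; rewrite add0r.
have d3 (s : R) : 0 < s < 1 ->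
    is_derive s 1 (fun s : R => (1 + s) / (1 - s)) (2 / (1 - s) ^+ 2).
  move=> hs; have d := is_deriveM (d2 s) (@is_deriveV _ (fun s : R => 1 - s) s _ _ (p1 s hs) (d1 s)).
  apply: is_derive_eq d _; rewrite -![_ *: _]/(_ * _); field; exact: p1.
have d4 (s : R) : 0 < s < 1 ->
    is_derive s 1 (fun s : R => ln ((1 + s) / (1 - s))) (2 / (1 - s ^+ 2)).
  move=> hs; have q1 : 0 < (1 + s) / (1 - s) by rewrite (lt_trans ltr01)// q0.
  apply: is_derive_eq; first exact: is_derive1_chain (d3 s hs) (is_derive1_ln q1).
  have n1 : 1 - s ^+ 2 != 0 by rewrite -[X in X - _](expr1n _ 2) subr_sqr mulf_neq0 ?p1 ?p2.
  by field; rewrite ?n1 ?p1 ?p2.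
have h1 (s : R) : 0 < s < 1 -> is_derive s 1 (fun s : R => (ln ((1 + s) / (1 - s)))^-1)
    (- (ln ((1 + s) / (1 - s))) ^- 2 * (2 / (1 - s ^+ 2))).
  by move=> hs; exact: (@is_deriveV _ (fun s : R => ln ((1 + s) / (1 - s))) s _ _ (l0 s hs) (d4 s hs)).
have h2 (s : R) : 0 < s < 1 -> continuous_at s (fun s : R =>
    (- (ln ((1 + s) / (1 - s))) ^- 2 * (2 / (1 - s ^+ 2)))).
  move=> hs.
  have c1 : continuous_at s (fun s : R => ln ((1 + s) / (1 - s))).
    by apply: differentiable_continuous; apply/derivable1_diffP; have [] := d4 s hs.
  have c2 : continuous_at s (fun s : R => ln ((1 + s) / (1 - s)) ^+ 2).
    exact: continuous_comp c1 (@exprn_continuous _ 2 _).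
  have c3 : continuous_at s (fun s : R => ln ((1 + s) / (1 - s)) ^- 2).
    by apply: (continuousV _ c2); rewrite expf_neq0// l0.
  have c5 : continuous_at s (fun s : R => 1 - s ^+ 2).
    exact: continuousB (@cst_continuous _ _ (1 : R) s) (@exprn_continuous _ 2 _).
  have c6 : continuous_at s (fun s : R => (1 - s ^+ 2)^-1).
    apply: (continuousV _ c5).
    by rewrite -[X in X - _](expr1n _ 2) subr_sqr mulf_neq0 ?p1 ?p2.
  have c7 := continuousM (@cst_continuous _ _ (2 : R) s) c6.
  exact: continuousM (continuousN c3) c7.
have [C p] := @C1O_radial R n _ _ h1 h2.
split; first exact: C.
move=> i x xO; rewrite [LHS]p// kkE// -/(rho x); field.
have r0 : rho x != 0 by rewrite gt_eqF// rho_gt0.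
by rewrite r0 sqr_rad_neq1// rad_neq0.
Qed.

End RadialFunctions.

(** * Hyperbolic operators through the Euler field and the spherical gradient *)

Section Operators.
Variables (R : realType) (n : nat).
Notation V := 'rV[R]_n.
Implicit Types (f g : V -> R).

Lemma C0O_kk : C0O (fun x : V => kk x). Proof. exact: (radgrad_kk R n).1.1. Qed.
Lemma C0O_cc : C0O (fun x : V => cc x). Proof. exact: (radgrad_cc R n).1.1. Qed.
Lemma C0O_lam : C0O (fun x : V => lam x). Proof. exact: (radgrad_lam R n).1.1. Qed.
Lemma C0O_rhoV : C0O (fun x : V => (rho x)^-1). Proof. exact: (radgrad_rhoV R n).1.1. Qed.
Lemma C0O_radV : C0O (fun x : V => (rad x)^-1). Proof. exact: (C1O_radV R n).1.1. Qed.

Lemma C0O_eul f : C1O f -> C0O (fun x => eul f x).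
Proof.
move=> fC; apply: C0O_sum => i; apply: C0O_M; first exact: C0O_coord.
exact: C1O_partial.
Qed.

Lemma C0O_del j f : C1O f -> C0O (fun x => del j f x).
Proof.
move=> fC; apply: C0O_sum => i; apply: C0O_M; first exact: (C1O_cd R j i).1.1.
exact: C1O_partial.
Qed.

Lemma d_rhoE f x : pball x -> d_rho f x = kk x * eul f x.
Proof.
move=> xO; have r0 := rad_neq0 xO.
rewrite /d_rho /d_r /eul /vf /ce !mulr_sumr; apply: eq_bigr => i _.
rewrite kkE//; move: (partial i f x) => q; by field.
Qed.

Lemma LopE j f x : pball x -> Lop j f x = kk x * del j f x.
Proof.
move=> xO; have r0 := rad_neq0 xO.
have E : d_r f x = eul f x / rad x.
  rewrite /d_r /eul /vf /ce mulr_suml; apply: eq_bigr => i _.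
  by rewrite mulrAC.
rewrite /Lop E delE kkE//; move: (partial j f x) (eul f x) => q e; by field.
Qed.

(** Conformal change of the Laplacian: lam^-2 Delta + (n - 2) lam^-1 E, with lam^-1 = [kk * rad].
    The assumption on [n] makes the truncated exponent [n - 2] a true difference. *)
Lemma lapHE f x : (2 <= n)%N -> C2 f -> pball x -> lapH f x =
  (kk x * rad x) ^+ 2 * (\sum_(i < n) partial i (partial i f) x)
  + (n%:R - 2) * (kk x * rad x) * eul f x.
Proof.
move=> n2 fC xO; have [LC Lp] := radgrad_lamX R n (n - 2).
have l0 : lam x != 0 by rewrite gt_eqF// lam_gt0.
have E : (n - 2).+2 = n by rewrite -addn2 subnK.
have -> : n%:R - 2 = (n - 2)%:R :> R by rewrite natrB.
have -> : kk x * rad x = (lam x)^-1 by rewrite lamE// invrK.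
rewrite /lapH /eul /vf /ce !mulr_sumr -big_split/=; apply: eq_bigr => i _.
rewrite (C1O_M LC (C2_partial_C1O fC i)).2// Lp//.
rewrite -[X in lam x ^+ X]E !exprS; move: (n - 2)%N => m.
have lm : lam x ^+ m != 0 by rewrite expf_neq0.
move: (partial i (partial i f) x) (partial i f x) => P Q.
by field; rewrite l0 lm.
Qed.

Lemma eul_kk_mul f x : C1O f -> pball x ->
  eul (fun x => kk x * f x) x = kk x * eul f x - cc x * f x.
Proof.
move=> fC xO; have r0 := rad_neq0 xO.
rewrite /eul (vfM (@ce R n) (radgrad_kk R n).1 fC xO) -!/(eul _ x).
rewrite (eul_radgrad (radgrad_kk R n) xO); move: (eul f x) (f x) => *; by field.
Qed.

Lemma eul_near f g x : (forall y, pball y -> f y = g y) -> pball x -> eul f x = eul g x.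
Proof. exact: vf_near. Qed.

Lemma lapRhoE f x : C2 f -> pball x -> lapRho f x =
  kk x ^+ 2 * eul (eul f) x + (n%:R - 2) * cc x * kk x * eul f x.
Proof.
move=> fC xO; rewrite /lapRho coth_rho// !d_rhoE//.
rewrite (@eul_near _ (fun x => kk x * eul f x) x (@d_rhoE f) xO).
rewrite eul_kk_mul//; last exact: C1O_eul.
move: (eul (eul f) x) (eul f x) => *; ring.
Qed.

(** The first-order terms agree because [cc = kk + rad]: [rad] comes from the conformal factor and
    [kk] from the polar decomposition of the Euclidean Laplacian. *)
Lemma lapH_lapRho f x : (2 <= n)%N -> C2 f -> pball x ->
  lapH f x - lapRho f x = kk x ^+ 2 * \sum_(j < n) del j (del j f) x.
Proof.
move=> n2 fC xO; rewrite lapHE// lapRhoE// sum_del_del//.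
rewrite cc_kk; move: (\sum_(j < n) _) (eul (eul f) x) (eul f x) => *; ring.
Qed.

Lemma d_rho_Lop j f x : C2 f -> pball x -> d_rho (Lop j f) x =
  kk x * (kk x * eul (del j f) x - cc x * del j f x).
Proof.
move=> fC xO; rewrite d_rhoE//; congr (_ * _).
rewrite (@eul_near _ (fun x => kk x * del j f x) x (@LopE j f) xO).
by rewrite eul_kk_mul//; exact: C1O_del.
Qed.

End Operators.
Arguments C0O_del {R n} j {f} _.

Ltac C1O_tac := lazymatch goal with
  | |- C1O (eul _) => refine (C1O_eul _); assumption
  | |- C1O (del _ _) => refine (C1O_del _ _); assumption
  | |- _ => match goal with
      | H : C1O ?f |- C1O ?g => constr_eq f g; exact H
      | H : C2 ?f |- C1O ?g => constr_eq f g; exact (C2_C1O H)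
      end
  end.

(** Syntax-directed: arithmetic is split by head symbol, the radial weights are closed by their own
    lemmas, and the regularity of functions under [eul] and [del] is left to [C1O_tac], which draws
    on the [C1O] and [C2] facts in context. *)
Ltac C0O_tac := lazymatch goal with
  | |- C0O (fun x => @Algebra.add _ (@?f x) (@?g x)) => refine (@C0O_D _ _ f g _ _); C0O_tac
  | |- C0O (fun x => @Algebra.opp _ (@?f x)) => refine (@C0O_N _ _ f _); C0O_tac
  | |- C0O (fun x => @GRing.mul _ (@?f x) (@?g x)) => refine (@C0O_M _ _ f g _ _); C0O_tac
  | |- C0O (fun x => @GRing.exp _ (@?f x) ?m) => refine (@C0O_X _ _ f m _); C0O_tac
  | |- C0O (fun x => \sum_(j <- _) _) => refine (@C0O_sum _ _ _ _ _ _) => ?; C0O_tac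
  | |- C0O (fun x => eul ?f x) => refine (@C0O_eul _ _ f _); C1O_tac
  | |- C0O (fun x => del ?j ?f x) => refine (@C0O_del _ _ j f _); C1O_tac
  | |- C0O (fun x => kk x) => exact (@C0O_kk _ _)
  | |- C0O (fun x => cc x) => exact (@C0O_cc _ _)
  | |- C0O (fun x => lam x) => exact (@C0O_lam _ _)
  | |- C0O (fun x => Defs.rad x) => exact (@C0O_rad _ _)
  | |- C0O (fun x => (rho x)^-1) => exact (@C0O_rhoV _ _)
  | |- C0O (fun x => (Defs.rad x)^-1) => exact (@C0O_radV _ _)
  | |- C0O (fun x => fun_of_matrix x _ _) => exact (@C0O_coord _ _ _)
  | |- C0O (fun x => ?f x) => refine (@C1O_C0O _ _ f _); C1O_tac
  | |- _ => exact (@C0O_cst _ _ _)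
  end.

(** * From hyperbolic norms to weighted integrals *)

Section OperatorsOff.
Variables (R : realType) (n : nat).
Notation V := 'rV[R]_n.
Variables (K : set V) (cK : compact K) (KO : K `<=` @pball R n).
Variable (u : V -> R).
Hypothesis u0 : off K u.

Lemma off_d_rho f : off K f -> off K (d_rho f).
Proof.
move=> f0 x Kx; rewrite /d_rho /d_r big1 ?mulr0// => i _.
by rewrite (off_partial cK i f0)// mulr0.
Qed.

Lemma off_lapRho : off K (lapRho u).
Proof.
move=> x Kx; have h := off_d_rho u0; rewrite /lapRho (off_d_rho h)// h//.
by rewrite mulr0 addr0.
Qed.

Lemma off_Lop j : off K (Lop j u).
Proof.
move=> x Kx; rewrite /Lop (off_partial cK j u0)// /d_r big1 ?mulr0 ?subr0 ?mulr0// => i _.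
by rewrite (off_partial cK i u0)// mulr0.
Qed.

Lemma off_lapH : off K (lapH u).
Proof.
move=> x Kx; rewrite /lapH big1 ?mulr0// => i _.
have h : off K (fun y => lam y ^+ (n - 2) * partial i u y).
  by move=> y Ky; rewrite (off_partial cK i u0)// mulr0.
exact: (off_partial cK i h x Kx).
Qed.

Lemma hvol_ge0 (x : V) : 0 <= hvol x.
Proof.
rewrite /hvol; case: ifPn => // r1; rewrite exprn_ge0// /lam divr_ge0//.
by rewrite subr_ge0 expr_le1 ?rad_ge0// ltW.
Qed.

(** Passes from an operator defined on all of R^n to its formula on the punctured ball, where [hvol]
    is [lam ^+ n]; elsewhere both integrands vanish. *)
Lemma hnorm_sqr (f g : V -> R) : off K f -> off K g ->
  (forall x, pball x -> f x = g x) ->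
  hnorm f ^+ 2 = iint (fun x => lam x ^+ n * g x ^+ 2).
Proof.
move=> f0 g0 fg; rewrite /hnorm sqr_sqrtr; last first.
  by apply: iint_ge0 => x; rewrite mulr_ge0 ?sqr_ge0// hvol_ge0.
apply: (eq_iint_off KO).
- by move=> x Kx; rewrite f0// expr0n /= mul0r.
- by move=> x Kx; rewrite g0// expr0n /= mulr0.
- by move=> x xO; rewrite fg// /hvol rad_lt1// mulrC.
Qed.

End OperatorsOff.

(** * The cross term and the radial Hardy inequality *)

Section WeightedIdentities.
Variables (R : realType) (n : nat).
Notation V := 'rV[R]_n.
Variables (K : set V) (cK : compact K) (KO : K `<=` @pball R n).
Implicit Types (f g : V -> R).

Lemma del_radial_mul f f' g j x : radgrad f f' -> C1O g -> pball x ->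
  del j (fun x => f x * g x) x = f x * del j g x.
Proof.
move=> fr gC xO; rewrite /del (vfM (cd j) fr.1 gC xO) -!/(del j _ x).
by rewrite (del_radgrad j fr xO) mulr0 addr0.
Qed.

Lemma eulM f g x : C1O f -> C1O g -> pball x ->
  eul (fun x => f x * g x) x = f x * eul g x + g x * eul f x.
Proof. exact: vfM. Qed.

Lemma delM f g j x : C1O f -> C1O g -> pball x ->
  del j (fun x => f x * g x) x = f x * del j g x + g x * del j f x.
Proof. exact: vfM. Qed.

(** The exponent is shifted to match [radgradX]: [wk 3] carries the fourth power of [kk], [wk 0] the
    first. *)
Definition wk m (x : V) : R := lam x ^+ n * kk x ^+ m.+1.

Lemma radgrad_wk m : exists g, radgrad (wk m) g.
Proof. eexists; exact: radgradM (radgrad_lamX R n n) (radgradX m (radgrad_kk R n)). Qed.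

(** Follows from [eul kk = - cc] and [eul lam = lam * rad / kk]. *)
Lemma eul_wk m x : pball x -> eul (wk m) x =
  lam x ^+ n * kk x ^+ m * (n%:R * rad x - m.+1%:R * cc x).
Proof.
move=> xO; have r0 := rad_neq0 xO; have k0 := kk_neq0 xO.
rewrite (eul_radgrad (radgradM (radgrad_lamX R n n) (radgradX m (radgrad_kk R n))) xO).
rewrite !exprS; have -> : lam x * lam x ^+ n = (kk x * rad x)^-1 * lam x ^+ n.
  by rewrite {1}lamE.
move: (lam x ^+ n) (kk x ^+ m) => w q; by field; rewrite r0 k0.
Qed.

(** In polar coordinates the hyperbolic volume has density sinh^(n-1) rho, with logarithmic
    derivative (n - 1) coth rho. In Cartesian form this is [iint_eul] for the weight [wk 0]. *)
Lemma iint_d_rho F : C1O F -> off K F -> iint (fun x => lam x ^+ n *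
  (kk x * eul F x + (n%:R - 1) * cc x * F x)) = 0.
Proof.
move=> FC F0; have [g wr] := radgrad_wk 0.
rewrite -[RHS](iint_eul cK KO (C1O_M wr.1 FC).1); last first.
  by move=> x Kx; rewrite F0// mulr0.
apply: (eq_iint_off KO).
- by move=> x Kx; rewrite (off_eul cK F0)// F0// !mulr0 addr0 mulr0.
- have h : off K (fun x => wk 0 x * F x) by move=> x Kx; rewrite F0// mulr0.
  by move=> x Kx; rewrite (off_eul cK h)// F0// !mulr0 addr0.
- move=> x xO; rewrite (eulM wr.1 FC xO) eul_wk// /wk expr0 expr1 cc_kk.
  move: (lam x ^+ n) (eul F x) (F x) => *; ring.
Qed.

Variable (u : V -> R).
Hypotheses (u2 : C2 u) (u0 : off K u).

Let dv j x := kk x * (kk x * eul (del j u) x - cc x * del j u x).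

(** The two integrands differ by [I1] and [I2], of integral 0, summed over [j]. The summand on the
    right is kk^4 (E del_j u)^2 - 2 cc kk^3 (del_j u)(E del_j u): subtracting the [cc] square
    removes precisely the zeroth-order part of [dv j] squared. *)
Lemma iint_cross :
  iint (fun x => lam x ^+ n *
    ((kk x ^+ 2 * eul (eul u) x + (n%:R - 2) * cc x * kk x * eul u x) *
     (kk x ^+ 2 * \sum_(j < n) del j (del j u) x))) =
  \sum_(j < n) iint (fun x => lam x ^+ n *
    (dv j x ^+ 2 - (cc x * (kk x * del j u x)) ^+ 2)).
Proof.
have [g4 w4] := radgrad_wk 3; have [g3 w3] := radgrad_wk 2.
have w3c := radgradM w3 (radgradM (radgrad_cc R n) (radgrad_cst n 2)).
have pC := C1O_eul u2; have yC j := C1O_del u2 j.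
have p0 := off_eul cK u0; have y0 j := off_del cK j u0.
(* As [del j] commutes with [eul] and ignores radial weights, [del j A] is [wk 3] times E del_j u,
   so [I1] cancels the term kk^4 (E del_j u)^2. The factor 2 in [B] makes the divergence [I2] cancel
   the mixed term in the same way. *)
pose A x := wk 3 x * eul u x.
pose B x := wk 2 x * (cc x * 2) * eul u x.
have hA : C1O A by exact: (C1O_M w4.1 pC).1.
have hB : C1O B by exact: (C1O_M w3c.1 pC).1.
have A0 : off K A by move=> x Kx; rewrite /A p0// mulr0.
have B0 : off K B by move=> x Kx; rewrite /B p0// mulr0.
have hBy j : C1O (fun x => B x * del j u x) by exact: (C1O_M hB (yC j)).1.
have By0 j : off K (fun x => B x * del j u x) by move=> x Kx; rewrite B0// mul0r.
pose I1 j x := eul A x * del j (del j u) x - del j A x * eul (del j u) x +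
    A x * (n%:R * del j (del j u) x + (n%:R - 1) * (x 0 j / rad x) * eul (del j u) x).
pose I2 j x := del j (fun x => B x * del j u x) x
    - (n%:R - 1) * (x 0 j / rad x) * (B x * del j u x).
have iI1 j : iint (I1 j) = 0 by exact: (@iint_eul_del _ _ K cK KO j A _ hA A0 (yC j) (y0 j)).
have iI2 j : iint (I2 j) = 0 by exact: (@iint_del _ _ K cK KO j _ (hBy j) (By0 j)).
have I10 j : off K (I1 j).
  move=> x Kx; rewrite /I1 (off_eul cK A0)// (off_del cK j A0)// A0//.
  by rewrite !mul0r subrr addr0.
have I20 j : off K (I2 j).
  by move=> x Kx; rewrite /I2 (off_del cK j (By0 j))// B0// mul0r mulr0 subrr.
have uI1 j : ucs (I1 j).
  apply: (C0O_ucs cK KO _ (I10 j)); rewrite /I1.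
  C0O_tac.
have uI2 j : ucs (I2 j).
  apply: (C0O_ucs cK KO _ (I20 j)); rewrite /I2.
  have hBj := hBy j.
  C0O_tac.
pose Q j x := lam x ^+ n *
    (dv j x ^+ 2 - (cc x * (kk x * del j u x)) ^+ 2).
have Q0 j : off K (Q j).
  move=> x Kx; rewrite /Q /dv (off_eul cK (y0 j))// y0//.
  by rewrite !mulr0 subrr mulr0 expr0n /= subrr mulr0.
have uQ j : ucs (Q j).
  by apply: (C0O_ucs cK KO _ (Q0 j)); rewrite /Q /dv; C0O_tac.
have uI j : ucs (fun x => I1 j x + I2 j x) by exact: ucsD.
rewrite -(iint_sum _ uQ).
have <- : iint (fun x => \sum_(j < n) Q j x) + iint (fun x => \sum_(j < n) (I1 j x + I2 j x)) =
    iint (fun x => \sum_(j < n) Q j x).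
  rewrite (iint_sum _ uI) [X in _ + X]big1 ?addr0// => j _.
  by rewrite iintD// iI1 iI2 addr0.
rewrite -iintD; [|exact: ucs_sum|exact: ucs_sum].
apply: (eq_iint_off KO).
- by move=> x Kx; rewrite p0// (off_eul cK p0)// !mulr0 addr0 mul0r mulr0.
- move=> x Kx; rewrite !big1 ?addr0// => j _; last by rewrite Q0.
  by rewrite I10// I20// addr0.
move=> x xO; rewrite -big_split/=.
have E1 : eul A x = wk 3 x * eul (eul u) x +
    eul u x * (lam x ^+ n * kk x ^+ 3 * (n%:R * rad x - 4 * cc x)).
  by rewrite (eulM w4.1 pC xO) eul_wk.
have E2 j : del j A x = wk 3 x * eul (del j u) x.
  by rewrite (del_radial_mul j w4 pC xO) del_eul_comm.
have E3 j : del j (fun x => B x * del j u x) x =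
    B x * del j (del j u) x + del j u x * (wk 2 x * (cc x * 2) * eul (del j u) x).
  by rewrite (delM j hB (yC j) xO) (del_radial_mul j w3c pC xO) del_eul_comm.
(* The terms carrying x_j / r, left by the divergence of [del j], disappear after summation over [j]
   because the spherical gradient and its derivative along [eul] are tangent to the sphere. *)
have z1 := sum_coord_eul_del u2 xO; have z2 := sum_coord_del u xO.
have -> : \sum_(j < n) (Q j x + (I1 j x + I2 j x)) =
    \sum_(j < n) (lam x ^+ n *
    ((kk x ^+ 2 * eul (eul u) x + (n%:R - 2) * cc x * kk x * eul u x) *
     kk x ^+ 2) * del j (del j u) x +
     ((n%:R - 1) * A x / rad x * (x 0 j * eul (del j u) x)
      - (n%:R - 1) * B x / rad x * (x 0 j * del j u x))).
  apply: eq_bigr => j _; rewrite /Q /I1 /I2 /dv E1 E2 E3 /A /B /wk cc_kk.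
  move: (lam x ^+ n) (eul (eul u) x) (eul u x) (eul (del j u) x) (del j (del j u) x)
    (del j u x) (x 0 j) (rad x)^-1 (rad x) (kk x) => *; ring.
rewrite big_split/= sumrB -!mulr_sumr z1 z2 !mulr0 subrr addr0.
by move: (\sum_(j < n) _) => T; rewrite -!mulrA.
Qed.

(* Integrating [(Dv + g v)^2 >= 0] with [g = (n-1)/2 coth rho - 1/(2 rho)], the
   logarithmic derivative of the ground state of the one-dimensional Hardy inequality. *)
Lemma iint_hardy f : C1O f -> off K f ->
  iint (fun x => lam x ^+ n * (((n%:R - 1) / 2) ^+ 2 * (cc x * f x) ^+ 2
    - (n%:R - 1) / 2 * (kk x * f x) ^+ 2 + 1 / 4 * (f x / rho x) ^+ 2)) <=
  iint (fun x => lam x ^+ n * (kk x * eul f x) ^+ 2).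
Proof.
(* The square yields the potential g' + (n - 1) coth g - g^2. Since 2 a = n - 1 its coth / rho terms
   cancel, and a term -b / rho in g contributes (b - b^2) / rho^2, largest at b = 1/2 with value
   1/4. *)
move=> fC f0; pose a : R := (n%:R - 1) / 2.
have Gr := radgradM (radgrad_cst n a) (radgrad_cc R n).
have Hr := radgradM (radgrad_cst n (- 2^-1)) (radgrad_rhoV R n).
have [gC gE] := C1O_D Gr.1 Hr.1.
pose g (x : V) := a * cc x + - 2^-1 * (rho x)^-1.
have gg : C1O g by exact: gC.
have ffC := (C1O_M fC fC).1.
have FC : C1O (fun x => g x * (f x * f x)) by exact: (C1O_M gg ffC).1.
have F0 : off K (fun x => g x * (f x * f x)) by move=> x Kx; rewrite f0// mulr0 mulr0.
have i0 := iint_d_rho FC F0.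
rewrite -subr_ge0.
pose S x := lam x ^+ n * (kk x * eul f x + g x * f x) ^+ 2.
(* Subtracting [i0], the divergence identity for g f^2, trades the mixed term 2 g f (d_rho f) of [S]
   for zeroth-order terms. *)
set M := iint _; set L := iint _; suff -> : M - L = iint S.
  apply: iint_ge0 => x; have [/KO xO|Kx] := pselect (K x).
    by rewrite /S mulr_ge0 ?sqr_ge0// exprn_ge0// ltW// lam_gt0.
  by rewrite /S (off_eul cK f0)// f0// !mulr0 addr0 expr0n /= mulr0.
rewrite /L /M -[RHS]subr0 -i0 -iintB; last first.
- apply: (C0O_ucs cK KO).
    C0O_tac.
  by move=> x Kx; rewrite f0// mul0r !mulr0 expr0n /= !mulr0 subrr addr0 mulr0.
- apply: (C0O_ucs cK KO); first by C0O_tac.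
  by move=> x Kx; rewrite (off_eul cK f0)// mulr0 expr0n /= mulr0.
rewrite -iintB; last first.
- apply: (C0O_ucs cK KO).
    C0O_tac.
  by move=> x Kx; rewrite (off_eul cK F0)// f0// !mulr0 addr0 mulr0.
- apply: (C0O_ucs cK KO).
    rewrite /S; C0O_tac.
  by move=> x Kx; rewrite /S (off_eul cK f0)// f0// !mulr0 addr0 expr0n /= mulr0.
congr iint; apply/funext => x.
have [/KO xO|Kx] := pselect (K x); last first.
  rewrite /S (off_eul cK F0)// (off_eul cK f0)// f0// mul0r !(mulr0, expr0n, addr0) /=.
  by rewrite !(mulr0, addr0, subr0).
have k0 := kk_neq0 xO; have r0 := rad_neq0 xO.
have p0 : rho x != 0 by rewrite gt_eqF// rho_gt0.
have Eg : eul g x = - a * kk x + 2^-1 * (rho x)^-1 ^+ 2 / kk x.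
  have -> : eul g x = eul (fun x => a * cc x) x + eul (fun x => - 2^-1 * (rho x)^-1) x.
    rewrite /eul /vf -big_split/=; apply: eq_bigr => i _.
    by rewrite -mulrDr -gE.
  rewrite (eul_radgrad Gr xO) (eul_radgrad Hr xO); by field; rewrite p0 k0 r0.
rewrite (eulM gg ffC xO) (eulM fC fC xO) Eg /S /g /a.
move: (lam x ^+ n) (eul f x) (f x) (cc x) (kk x) k0 (rho x) p0 n%:R => w e q c k k0 t t0 m.
by field; rewrite k0 t0.
Qed.

End WeightedIdentities.

(** * Algebra of the spherical Hessian *)

Section HessianAlgebra.
Variables (R : realType) (n : nat).
Variables (d : 'I_n -> 'I_n -> R) (y o : 'I_n -> R).
Hypotheses (oy : \sum_(j < n) o j * y j = 0)
  (od1 : forall k, \sum_(j < n) o j * d k j = - y k).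

Let T := \sum_(j < n) d j j.
Let M := \sum_(k < n) \sum_(j < n) d k j * d j k.

(** Pointwise Bochner formula: [o] is the unit normal x / |x|, [y] the spherical gradient and
    [d k j] stands for [del k (del j u)]. In the application [a] is 2 - n, so the last term is (n -
    2) |y|^2, the Ricci curvature of the unit sphere. *)
Lemma del_del_algebra (a : R) :
  \sum_(k < n) \sum_(j < n)
    (d k j * d j k - d j j * d k k + a * (y j * (o k * d j k - o j * d k k))) =
  M - T ^+ 2 - a * \sum_(j < n) y j ^+ 2.
Proof.
have -> : T ^+ 2 = \sum_(k < n) \sum_(j < n) d j j * d k k.
  by rewrite exchange_big expr2 big_distrlr.
have -> : a * (\sum_(j < n) y j ^+ 2) =
    - \sum_(k < n) \sum_(j < n) a * (y j * (o k * d j k - o j * d k k)).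
  have -> : \sum_(k < n) \sum_(j < n) a * (y j * (o k * d j k - o j * d k k)) =
      \sum_(j < n) a * (y j * \sum_(k < n) o k * d j k)
      - a * (\sum_(j < n) o j * y j) * T.
    rewrite exchange_big [a * (\sum_(j < n) _)]mulr_sumr mulr_suml -sumrB.
    apply: eq_bigr => j _.
    rewrite /T !mulr_sumr -sumrB; apply: eq_bigr => k _; ring.
  rewrite oy mulr0 mul0r subr0 mulr_sumr -sumrN; apply: eq_bigr => j _.
  by rewrite od1; ring.
rewrite opprK /M -!sumrB -big_split/=; apply: eq_bigr => k _.
by rewrite -!sumrB -big_split/=; apply: eq_bigr => j _.
Qed.

Hypotheses (sym : forall k j, d k j + o j * y k = d j k + o k * y j)
  (oo : \sum_(j < n) o j ^+ 2 = 1)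
  (od2 : forall j, \sum_(k < n) o k * d k j = 0) (n1 : (1 < n)%N).

(* [d k j + o j * y k] are the entries of the spherical Hessian, a symmetric form on
   the tangent space [o^perp] of dimension [n - 1]. *)
Lemma sqr_trace_le : T ^+ 2 <= (n%:R - 1) * M.
Proof.
pose N k j := d k j + o j * y k.
(* Orthogonal projection onto the tangent space. In the Frobenius product [S1] is |N|^2, [S2] is the
   trace <N, P>, and [S3] is |P|^2 = n - 1, the dimension of that space. *)
pose P k j := (k == j)%:R - o k * o j : R.
pose m : R := n%:R - 1.
have m0 : 0 < m by rewrite subr_gt0 ltr1n.
have S1 : \sum_(k < n) \sum_(j < n) N k j ^+ 2 = M.
  have -> : \sum_(k < n) \sum_(j < n) N k j ^+ 2 =
      M + (\sum_(j < n) y j * \sum_(k < n) o k * d k j)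
      + (\sum_(k < n) y k * \sum_(j < n) o j * d j k)
      + (\sum_(k < n) o k * y k) * (\sum_(j < n) o j * y j).
    rewrite big_distrlr /= /M.
    have e1 : \sum_(j < n) y j * (\sum_(k < n) o k * d k j) =
      \sum_(k < n) \sum_(j < n) y j * (o k * d k j).
      by rewrite exchange_big; apply: eq_bigr => j _; rewrite mulr_sumr.
    have e2 : \sum_(k < n) y k * (\sum_(j < n) o j * d j k) =
      \sum_(k < n) \sum_(j < n) y k * (o j * d j k).
      by apply: eq_bigr => k _; rewrite mulr_sumr.
    rewrite {1}e1 e2.
    rewrite -!big_split/=; apply: eq_bigr => k _; rewrite -!big_split/=.
    by apply: eq_bigr => j _; rewrite expr2 {2}/N sym /N; ring.
  rewrite oy mul0r addr0 !big1 ?addr0// => j _; by rewrite od2 mulr0.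
have S2 : \sum_(k < n) \sum_(j < n) N k j * P k j = T.
  have -> : \sum_(k < n) \sum_(j < n) N k j * P k j =
      \sum_(k < n) (N k k - o k * ((\sum_(j < n) o j * d k j) + y k * \sum_(j < n) o j ^+ 2)).
    apply: eq_bigr => k _; rewrite -[N k k](sum_kron (N k)) mulr_sumr -big_split/=.
    rewrite mulr_sumr -sumrB; apply: eq_bigr => j _; rewrite /P /N; ring.
  under eq_bigr => k _ do rewrite od1 oo mulr1 addNr mulr0 subr0 /N.
  by rewrite big_split/= oy addr0.
have S3 : \sum_(k < n) \sum_(j < n) P k j ^+ 2 = m.
  have -> : \sum_(k < n) \sum_(j < n) P k j ^+ 2 =
      \sum_(k < n) ((1 - 2 * o k ^+ 2) + o k ^+ 2 * \sum_(j < n) o j ^+ 2).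
    apply: eq_bigr => k _.
    rewrite -[1 - _](sum_kron (fun j => 1 - 2 * o j ^+ 2) k).
    rewrite mulr_sumr -big_split/=; apply: eq_bigr => j _; rewrite /P.
    by case: eqP => [->|_] /=; ring.
  have -> : \sum_(k < n) ((1 - 2 * o k ^+ 2) + o k ^+ 2 * \sum_(j < n) o j ^+ 2) =
      \sum_(k < n) (1 - o k ^+ 2).
    by rewrite oo; apply: eq_bigr => k _; ring.
  by rewrite sumrB oo sumr_const card_ord.
rewrite -/m; move: T M m m0 S1 S2 S3 => t q m m0 S1 S2 S3.
(* Cauchy-Schwarz for [N] and [P], from the square of the combination [m * N - t * P]. *)
have : 0 <= \sum_(k < n) \sum_(j < n) (m * N k j - t * P k j) ^+ 2.
  by apply: sumr_ge0 => k _; apply: sumr_ge0 => j _; exact: sqr_ge0.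
have -> : \sum_(k < n) \sum_(j < n) (m * N k j - t * P k j) ^+ 2 =
    m ^+ 2 * q - 2 * m * t * t + t ^+ 2 * m.
  rewrite -S1 -[X in 2 * m * t * X]S2 -[X in t ^+ 2 * X]S3 !mulr_sumr -sumrB -big_split/=.
  apply: eq_bigr => k _; rewrite !mulr_sumr -sumrB -big_split/=.
  by apply: eq_bigr => j _; ring.
move=> h; have : 0 <= m * (m * q - t ^+ 2) by move: h; congr (_ <= _); ring.
by rewrite pmulr_rge0// subr_ge0.
Qed.

End HessianAlgebra.

(** * Poincare inequality on spheres for n at least 3 *)

Section SpherePoincare.
Variables (R : realType) (n : nat).
Notation V := 'rV[R]_n.
Variables (K : set V) (cK : compact K) (KO : K `<=` @pball R n).
Variable (u : V -> R).
Hypotheses (u2 : C2 u) (u0 : off K u).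

(** Write T for the spherical Laplacian, Y for the squared gradient and M for the squared Hessian.
    Bochner ([key]) reads int T^2 = int M + (n - 2) int Y, and the trace inequality gives int T^2 <=
    (n - 1) int M. Eliminating M leaves (n - 2) (int T^2 - (n - 1) int Y) >= 0, to be divided by n -
    2 > 0. The weight is radial, so it passes through every [del j]. *)
Lemma sphere_poincare_ge3 : (3 <= n)%N ->
  (n%:R - 1) * iint (fun x => wk 3 x * \sum_(j < n) del j u x ^+ 2) <=
  iint (fun x => wk 3 x * (\sum_(j < n) del j (del j u) x) ^+ 2).
Proof.
move=> n3; have [g wr] := @radgrad_wk R n 3.
have yC j := C1O_del u2 j; have y0 j := off_del cK j u0.
pose A j x := wk 3 x * del j u x.
have hA j : C1O (A j) by exact: (C1O_M wr.1 (yC j)).1.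
have A0 j : off K (A j) by move=> x Kx; rewrite /A y0// mulr0.
pose I k j x := del k (A j) x * del j (del k u) x - del j (A j) x * del k (del k u) x
  + A j x * ((1 - (n%:R - 1)) * (x 0 k / rad x * del j (del k u) x
                                - x 0 j / rad x * del k (del k u) x)).
have iI k j : iint (I k j) = 0.
  exact: (@iint_del_del _ _ K cK KO k j (A j) _ (hA j) (A0 j) (yC k) (y0 k)).
have I0 k j : off K (I k j).
  move=> x Kx; rewrite /I !(off_del cK _ (A0 j))// A0//.
  by rewrite !mul0r subrr addr0.
have wC : C1O (@wk R n 3) by exact: wr.1.
have uI k j : ucs (I k j).
  apply: (C0O_ucs cK KO _ (I0 k j)); rewrite /I; have hAj := hA j.
  by C0O_tac.
pose MM x := \sum_(k < n) \sum_(j < n) del k (del j u) x * del j (del k u) x.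
have uM : ucs (fun x => wk 3 x * MM x).
  apply: (C0O_ucs cK KO); first by rewrite /MM; C0O_tac.
  move=> x Kx; rewrite /MM big1 ?mulr0// => k _; rewrite big1// => j _.
  by rewrite (off_del cK k (y0 j))// mul0r.
have uT : ucs (fun x => wk 3 x * (\sum_(j < n) del j (del j u) x) ^+ 2).
  apply: (C0O_ucs cK KO); first by C0O_tac.
  move=> x Kx; rewrite big1 ?expr0n ?mulr0// => k _; by rewrite (off_del cK k (y0 k)).
have uY : ucs (fun x => wk 3 x * \sum_(j < n) del j u x ^+ 2).
  apply: (C0O_ucs cK KO); first by C0O_tac.
  by move=> x Kx; rewrite big1 ?mulr0// => k _; rewrite y0// expr0n.
have alg x : pball x -> let o := fun j => x 0 j / rad x in
   [/\ \sum_(j < n) o j * del j u x = 0,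
     (forall k, \sum_(j < n) o j * del k (del j u) x = - del k u x),
     (forall j, \sum_(k < n) o k * del k (del j u) x = 0) &
     \sum_(j < n) o j ^+ 2 = 1].
  move=> xO o; have r0 := rad_neq0 xO.
  have oE (F : 'I_n -> R) : \sum_(j < n) o j * F j = (rad x)^-1 * \sum_(j < n) x 0 j * F j.
    by rewrite mulr_sumr; apply: eq_bigr => j _; rewrite /o; ring.
  split=> [|k|j|].
  - by rewrite oE sum_coord_del// mulr0.
  - by rewrite oE sum_coord_del_del// mulNr mulrN mulKf.
  - by rewrite oE sum_coord_del// mulr0.
  - under eq_bigr do rewrite expr2; rewrite oE.
    under eq_bigr do rewrite /o mulrA; rewrite -mulr_suml sum_sqr_coord.
    by field.
have key : iint (fun x => wk 3 x * MM x)
    - iint (fun x => wk 3 x * (\sum_(j < n) del j (del j u) x) ^+ 2)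
    + (n%:R - 2) * iint (fun x => wk 3 x * \sum_(j < n) del j u x ^+ 2) = 0.
  have sI k : ucs (fun x => \sum_(j < n) I k j x) by apply: ucs_sum => j; exact: uI.
  have z : iint (fun x => \sum_(k < n) \sum_(j < n) I k j x) = 0.
    by rewrite (iint_sum _ sI) big1// => k _; rewrite (iint_sum _ (uI k)) big1.
  rewrite -[RHS]z -(iintZ _ uY) -(iintB uM uT) -(iintD (ucsB uM uT) (ucsZ _ uY)).
  apply: (eq_iint_off KO).
  - move=> x Kx.
    rewrite (_ : MM x = 0) ?[\sum_(j < n) del j (del j u) x]big1
      ?[\sum_(j < n) _ ^+ 2]big1 ?expr0n /= ?mulr0 ?subrr ?addr0//.
    + by move=> j _; rewrite y0// expr0n.
    + by move=> j _; rewrite (off_del cK j (y0 j)).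
    + by rewrite /MM big1// => k _; rewrite big1// => j _; rewrite (off_del cK k (y0 j))// mul0r.
  - by move=> x Kx; rewrite big1// => k _; rewrite big1// => j _; exact: I0.
  - move=> x xO; have [oy od1 _ _] := alg x xO.
    transitivity (wk 3 x * (MM x - (\sum_(j < n) del j (del j u) x) ^+ 2
        - (1 - (n%:R - 1)) * \sum_(j < n) del j u x ^+ 2)); first by
      move: (\sum_(j < n) del j (del j u) x) (\sum_(j < n) _ ^+ 2) (MM x) => *; ring.
    rewrite -(del_del_algebra oy od1) mulr_sumr; apply: eq_bigr => k _.
    rewrite mulr_sumr; apply: eq_bigr => j _.
    rewrite /I !(del_radial_mul _ wr (yC _) xO) /A.
    move: (wk 3 x) (del k (del j u) x) (del j (del k u) x) (del j (del j u) x)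
      (del k (del k u) x) (del j u x) => *; ring.
have le : iint (fun x => wk 3 x * (\sum_(j < n) del j (del j u) x) ^+ 2) <=
    (n%:R - 1) * iint (fun x => wk 3 x * MM x).
  rewrite -iintZ//; apply: le_iint => // [|x]; first exact: ucsZ.
  have [/KO xO|Kx] := pselect (K x); last first.
    have z j : del j (del j u) x = 0 by exact: (off_del cK j (y0 j)) Kx.
    rewrite [\sum_(j < n) _]big1// expr0n /= mulr0.
    rewrite (_ : MM x = 0) ?mulr0// /MM big1// => k _; rewrite big1// => j _.
    by rewrite (off_del cK k (y0 j))// mul0r.
  have [oy od1 od2 oo] := alg x xO; rewrite [leRHS]mulrCA; apply: ler_wpM2l.
    by rewrite /wk mulr_ge0// exprn_ge0// ltW ?lam_gt0 ?kk_gt0.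
  apply: (@sqr_trace_le _ _ (fun k j => del k (del j u) x) _ _ oy od1 _ oo od2).
    move=> k j; apply/eqP; rewrite -subr_eq0; apply/eqP.
    have := del_del_comm u2 k j xO; move=> h.
    by rewrite opprD addrACA h; ring.
  exact: ltnW.
move: key le; set a := iint _; set b := iint _; set c := iint _; move: a b c => c a b key le.
have n2 : 0 < n%:R - 2 :> R by rewrite subr_gt0 ltr_nat.
rewrite -(ler_pM2l n2).
move: n2 key le; move: n%:R => N n2 key le; clear -n2 key le.
have : c = a - (N - 2) * b by lra.
move=> cE; rewrite cE in le; nra.
Qed.

End SpherePoincare.

(** * Exchange of an interval integral with the iterated integral *)

Section Fubini.
Variables (R : realType).
Local Notation mu := (@lebesgue_measure R).

Lemma Rintegral_itv_split (f : R -> R) (a b c : R) : continuous f ->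
  a <= b -> b <= c ->
  Rintegral mu `[a, c] f = Rintegral mu `[a, b] f + Rintegral mu `[b, c] f.
Proof.
move=> fc ab bc.
have := @Rintegral_itvB R f (BLeft a) (BRight c) b (continuous_itv_integrable a c fc).
rewrite !bnd_simp => /(_ ab bc) /eqP; rewrite subr_eq => /eqP ->.
rewrite addrC Rintegral_itv_obnd_cbnd//.
apply: integrableS (continuous_itv_integrable b c fc) => //.
by apply: subset_itvr; rewrite bnd_simp.
Qed.

Lemma Rintegral_itv_cst (c a b : R) : a <= b -> Rintegral mu `[a, b] (fun=> c) = c * (b - a).
Proof.
move=> ab; rewrite Rintegral_cst//= lebesgue_measure_itv/= lte_fin.
case: ifPn => //; rewrite -leNgt => ba.
have -> : a = b by apply/le_anti; rewrite ab ba.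
by rewrite subrr !mulr0.
Qed.

Lemma Rintegral_near_cst (f : R -> R) (a b e : R) : continuous f -> a <= b ->
  (forall t, a <= t <= b -> `|f t - f a| <= e) ->
  `|Rintegral mu `[a, b] f - (b - a) * f a| <= e * (b - a).
Proof.
move=> fc ab fe; rewrite [_ * f a]mulrC -(Rintegral_itv_cst (f a) ab) -RintegralB//; last 2 first.
- exact: continuous_itv_integrable.
- by apply: continuous_itv_integrable => t; exact: cst_continuous.
have dc : continuous (fun t => f t - f a).
  by move=> t; exact: continuousB (fc t) (@cst_continuous _ _ (f a) t).
apply: (le_trans (le_normr_Rintegral _ (continuous_itv_integrable _ _ dc))) => //.
rewrite -Rintegral_itv_cst//; apply: le_Rintegral => //.
- apply: continuous_itv_integrable => t.
  exact: continuous_comp (dc t) (@norm_continuous _ _ _).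
- by apply: continuous_itv_integrable => t; exact: cst_continuous.
Qed.

Lemma riemann_sum (f : R -> R) (a D e : R) (N : nat) : continuous f -> 0 <= D ->
  (forall s t, `|s - t| <= D -> `|f s - f t| <= e) ->
  `|Rintegral mu `[a, a + N%:R * D] f - \sum_(i < N) D * f (a + i%:R * D)| <=
  e * (N%:R * D).
Proof.
move=> fc D0 fe; elim: N => [|N IH].
  by rewrite mul0r addr0 set_itv1 Rintegral_set1 big_ord0 subrr normr0 mulr0.
have h1 : a <= a + N%:R * D by rewrite lerDl mulr_ge0.
have h2 : a + N%:R * D <= a + N.+1%:R * D by rewrite lerD2l ler_wpM2r// ler_nat.
have E : a + N.+1%:R * D - (a + N%:R * D) = D by rewrite -natr1; ring.
rewrite (Rintegral_itv_split fc h1 h2) big_ord_recr /=.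
have loc : `|Rintegral mu `[a + N%:R * D, a + N.+1%:R * D] f - D * f (a + N%:R * D)| <= e * D.
  have := @Rintegral_near_cst f _ _ e fc h2; rewrite E; apply => t /andP[t1 t2]; apply: fe.
  by rewrite ger0_norm ?subr_ge0//; apply: le_trans (lerB t2 (lexx _)) _; rewrite E.
rewrite opprD addrACA; apply: le_trans (ler_normD _ _) _.
by apply: le_trans (lerD IH loc) _; rewrite -natr1 mulrDl mul1r mulrDr.
Qed.

Variable n : nat.
Variables (F : R -> 'rV[R]_n -> R) (a b M : R).
Hypotheses (ab : a <= b) (M0 : 0 <= M)
  (FM : forall t, supp_in M (F t))
  (Fu : forall e : R, 0 < e -> exists2 d : R, 0 < d &
     forall s t x y, `|s - t| < d -> `|x - y| < d -> `|F s x - F t y| < e).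

Let Fe (e : R) : 0 < e -> exists2 d : R, 0 < d &
  forall s t x, `|s - t| < d -> `|F s x - F t x| < e.
Proof.
by move=> /Fu[d d0 h]; exists d => // s t x st; apply: h => //; rewrite subrr normr0.
Qed.

Let Fc x : continuous (fun t => F t x).
Proof.
apply: ucont_continuous => e /Fe[d d0 h]; exists d => // s t; exact: h.
Qed.

Let Fs t : ucs (F t).
Proof.
split; last by exists M.
by move=> e /Fu[d d0 h]; exists d => // x y xy; apply: h => //; rewrite subrr normr0.
Qed.

Let iFe (e : R) : 0 < e -> exists2 d : R, 0 < d &
  forall s t, `|s - t| < d -> `|iint (F s) - iint (F t)| < e.
Proof.
move=> e0; have C0 : 0 < (2 * M) ^+ n + 1.
  by have := exprn_ge0 n (mulr_ge0 (ler0n R 2) M0); lra.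
have [d d0 h] := Fe (divr_gt0 e0 C0); exists d => // s t st; rewrite -iintB//.
apply: (@le_lt_trans _ _ (e / ((2 * M) ^+ n + 1) * (2 * M) ^+ n)).
  apply: iint_bound => //; first exact: (ucsB (Fs s) (Fs t)).1.
    by move=> x Mx; rewrite !FM// subrr.
  by move=> x; rewrite ltW// h.
rewrite -mulrA gtr_pMr// mulrC ltr_pdivrMr// mul1r; lra.
Qed.

Lemma ucs_Rintegral : ucs (fun x => Rintegral mu `[a, b] (fun t => F t x)).
Proof.
split=> [e e0|]; last first.
  exists M => x Mx; under eq_Rintegral do rewrite FM//.
  by rewrite Rintegral_itv_cst// mul0r.
have c0 : 0 < b - a + 1 by rewrite ltr_wpDl ?subr_ge0.
have [d d0 h] := Fu (divr_gt0 e0 c0); exists d => // x y xy.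
rewrite -RintegralB//; [|exact: continuous_itv_integrable|exact: continuous_itv_integrable].
have dc : continuous (fun t => F t x - F t y).
  by move=> t; exact: continuousB (@Fc x t) (@Fc y t).
apply: (le_lt_trans (le_normr_Rintegral _ (continuous_itv_integrable _ _ dc))) => //.
apply: (@le_lt_trans _ _ (Rintegral mu `[a, b] (fun=> e / (b - a + 1)))).
  apply: le_Rintegral => //.
  - apply: continuous_itv_integrable => t.
    exact: continuous_comp (dc t) (@norm_continuous _ _ _).
  - by apply: continuous_itv_integrable => t; exact: cst_continuous.
  - by move=> t _; rewrite ltW// h// subrr normr0.
rewrite Rintegral_itv_cst// -mulrA gtr_pMr// mulrC ltr_pdivrMr// mul1r; lra.
Qed.

(** For a left Riemann sum the exchange is linearity of [iint]. Uniform continuity makes the error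
    of the sum uniform in [x], hence small after integration over the common support. *)
Lemma iint_Rintegral :
  iint (fun x => Rintegral mu `[a, b] (fun t => F t x)) =
  Rintegral mu `[a, b] (fun t => iint (F t)).
Proof.
have ba0 : 0 <= b - a by rewrite subr_ge0.
have M2 := exprn_ge0 n (mulr_ge0 (ler0n R 2) M0).
(* The two errors add up to e / C * (b - a) * ((2 M)^n + 1), at most e; the final 1 covers
   [a = b]. *)
pose C := (b - a) * ((2 * M) ^+ n + 1) + 1.
have C0 : 0 < C.
  by rewrite ltr_wpDl// mulr_ge0// addr_ge0.
apply/eqP; rewrite -subr_eq0 -normr_le0; apply/ler_addgt0Pl => e e0; rewrite addr0.
have e1 : 0 < e / C by rewrite divr_gt0.
have [d1 d10 h1] := Fe e1; have [d2 d20 h2] := iFe e1.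
(* The number of steps puts the mesh [D] below both moduli of continuity. *)
pose N := (Num.bound ((b - a) / Num.min d1 d2)).+1; pose D := (b - a) / N%:R.
have m0 : 0 < Num.min d1 d2 by rewrite lt_min d10.
have N0 : 0 < N%:R :> R by rewrite ltr0n.
have D0 : 0 <= D by rewrite divr_ge0// ltW.
have Dm : D < Num.min d1 d2.
  rewrite ltr_pdivrMr// mulrC -ltr_pdivrMr//.
  apply: lt_le_trans (archi_boundP _) _; first by rewrite divr_ge0// ltW.
  by rewrite ler_nat.
have [Dd1 Dd2] : D < d1 /\ D < d2 by apply/andP; rewrite -lt_min.
have aN : a + N%:R * D = b by rewrite /D mulrC divfK ?gt_eqF// addrC subrK.
have ND : N%:R * D = b - a by rewrite -aN addrC addKr.
have iFc : continuous (fun t => iint (F t)).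
  by apply: ucont_continuous => e' /iFe[d d0 h]; exists d.
have r1 x : `|Rintegral mu `[a, b] (fun t => F t x)
    - \sum_(i < N) D * F (a + i%:R * D) x| <= e / C * (b - a).
  rewrite -ND -{1}aN; apply: (riemann_sum a N (@Fc x) D0) => s t st.
  by rewrite ltW// h1// (le_lt_trans st).
have r2 : `|Rintegral mu `[a, b] (fun t => iint (F t))
    - \sum_(i < N) D * iint (F (a + i%:R * D))| <= e / C * (b - a).
  rewrite -ND -{1}aN; apply: (riemann_sum a N iFc D0) => s t st.
  by rewrite ltW// h2// (le_lt_trans st).
have us : ucs (fun x => \sum_(i < N) D * F (a + i%:R * D) x).
  by apply: ucs_sum => i; exact: ucsZ.
have ui := ucs_Rintegral.
have r3 : `|iint (fun x => Rintegral mu `[a, b] (fun t => F t x))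
    - \sum_(i < N) D * iint (F (a + i%:R * D))| <= e / C * (b - a) * (2 * M) ^+ n.
  have -> : \sum_(i < N) D * iint (F (a + i%:R * D)) =
      iint (fun x => \sum_(i < N) D * F (a + i%:R * D) x).
    rewrite iint_sum => [|i]; last exact: ucsZ.
    by apply: eq_bigr => i _; rewrite iintZ.
  rewrite -iintB//; apply: iint_bound => //; first exact: (ucsB ui us).1.
  move=> x Mx; rewrite big1 ?subr0 => [|i _]; last by rewrite FM// mulr0.
  under eq_Rintegral do rewrite FM//.
  by rewrite Rintegral_itv_cst// mul0r.
move: r2 r3; set X := Rintegral _ _ _; set Y := iint _; set S := \sum_(i < N) _ => r2 r3.
have -> : Y - X = (Y - S) - (X - S) by ring.
apply: le_trans (ler_normB _ _) _; apply: le_trans (lerD r3 r2) _.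
have -> : e / C * (b - a) * (2 * M) ^+ n + e / C * (b - a) =
  e / C * ((b - a) * ((2 * M) ^+ n + 1)) by ring.
rewrite -mulrA; apply: ler_piMr; first exact: ltW.
by rewrite mulrC ler_pdivrMr// mul1r /C lerDl ler01.
Qed.

End Fubini.

(** * Rotation invariance of the plane integral *)

Section PlaneRotation.
Variables (R : realType).
Local Notation mu := (@lebesgue_measure R).
Notation V := 'rV[R]_2.

(** Brings the first coordinate innermost, for [iint_shear0]: a shear along that axis is a
    translation by an amount depending on the other coordinate. *)
Lemma iint_swap0 n (f : 'rV[R]_n.+1 -> R) : ucs f ->
  iint f = iint (fun v => Rintegral mu setT (fun t => f (rcons0 t v))).
Proof.
move=> fu; have [M M0 fM] := ucs_supp fu.
have s1 v : Rintegral mu setT (fun t => f (rcons0 t v)) =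
    Rintegral mu `[- M, M] (fun t => f (rcons0 t v)).
  apply: Rintegral_supp; apply: supp_in_itv => t tM; apply: fM.
  by apply: (lt_le_trans tM); rewrite -{1}(rcons0_0 t v) coord_le_norm.
under [in RHS]eq_fun do rewrite s1.
rewrite (@iint_Rintegral R n (fun t v => f (rcons0 t v)) (- M) M M)//; [|lra| |].
- rewrite iintS; apply: Rintegral_supp; apply: supp_in_itv => t tM.
  rewrite -[RHS](iint0 R n); congr iint; apply/funext => v; apply: fM.
  by apply: (lt_le_trans tM); rewrite -{1}(rcons0_0 t v) coord_le_norm.
- by move=> t; have [] := ucs_slice t fu.1 fM.
- move=> e /fu.1[d d0 fd]; exists d => // s t x y st xy; apply: fd.
  by rewrite rcons0B norm_rcons0_lt.
Qed.

Definition vec2 (a b : R) : V := rcons0 a (rcons0 b 0).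

Lemma vec2_0 a b : vec2 a b 0 0 = a. Proof. exact: rcons0_0. Qed.

Lemma vec2_1 a b : vec2 a b 0 1 = b.
Proof.
have -> : (1 : 'I_2) = lift 0 (0 : 'I_1) by apply: val_inj.
by rewrite /vec2 rcons0_lift rcons0_0.
Qed.

Lemma vec2P (x y : V) : x 0 0 = y 0 0 -> x 0 1 = y 0 1 -> x = y.
Proof.
move=> h0 h1; apply/rowP => i; case: (unliftP 0 i) => [j|] ->; last exact: h0.
have -> : lift 0 j = (1 : 'I_2) by apply: val_inj; rewrite (ord1 j).
exact: h1.
Qed.

Lemma norm_vec2_le (x : V) (M : R) : `|x 0 0| <= M -> `|x 0 1| <= M -> `|x| <= M.
Proof.
move=> h0 h1; apply: norm_rV_le => [|i]; first exact: le_trans h0.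
case: (unliftP 0 i) => [j|] ->; last exact: h0.
by have -> : lift 0 j = (1 : 'I_2) by apply: val_inj; rewrite (ord1 j).
Qed.

Definition lin2 (p q r s : R) (x : V) : V :=
  vec2 (p * x 0 0 + q * x 0 1) (r * x 0 0 + s * x 0 1).

Lemma norm_lin2 p q r s (x : V) :
  `|lin2 p q r s x| <= (`|p| + `|q| + `|r| + `|s|) * `|x|.
Proof.
have a0 := coord_le_norm x 0; have a1 := coord_le_norm x 1.
have lem (a b c : R) : 0 <= c -> `|a| + `|b| <= c ->
    `|a * x 0 0 + b * x 0 1| <= c * `|x|.
  move=> c0 abc; apply: le_trans (ler_normD _ _) _; rewrite !normrM.
  apply: (@le_trans _ _ ((`|a| + `|b|) * `|x|)); last exact: ler_wpM2r.
  by rewrite mulrDl; apply: lerD; apply: ler_wpM2l.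
have := normr_ge0 p; have := normr_ge0 q; have := normr_ge0 r; have := normr_ge0 s.
move=> s0 r0 q0 p0.
by apply: norm_vec2_le; rewrite ?vec2_0 ?vec2_1; apply: lem; lra.
Qed.

Lemma lin2B p q r s (x y : V) : lin2 p q r s x - lin2 p q r s y = lin2 p q r s (x - y).
Proof.
by apply: vec2P; rewrite rowBE ?vec2_0 ?vec2_1 !rowBE; ring.
Qed.

(** The map is Lipschitz, which preserves uniform continuity; its linear left inverse bounds |x| by
    the norm of the image, which preserves boundedness of the support. *)
Lemma ucs_lin2 (f : V -> R) p q r s p' q' r' s' :
  (forall x, lin2 p' q' r' s' (lin2 p q r s x) = x) ->
  ucs f -> ucs (fun x => f (lin2 p q r s x)).
Proof.
move=> inv fu; have [M M0 fM] := ucs_supp fu.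
pose C := `|p| + `|q| + `|r| + `|s| + 1; pose C' := `|p'| + `|q'| + `|r'| + `|s'| + 1.
have C0 : 0 < C by rewrite /C ltr_wpDl// !addr_ge0.
have C'0 : 0 < C' by rewrite /C' ltr_wpDl// !addr_ge0.
split=> [e /fu.1[d d0 fd]|].
  exists (d / C) => [|x y xy]; first by rewrite divr_gt0.
  apply: fd; rewrite lin2B; apply: le_lt_trans (norm_lin2 _ _ _ _ _) _.
  apply: (@le_lt_trans _ _ (C * `|x - y|)); first by apply: ler_wpM2r => //; rewrite lerDl.
  by rewrite mulrC -ltr_pdivlMr.
exists (C' * M) => x xM; apply: fM.
rewrite -(ltr_pM2l C'0); apply: (lt_le_trans xM); rewrite -{1}(inv x).
apply: le_trans (norm_lin2 _ _ _ _ _) _; apply: ler_wpM2r => //; by rewrite lerDl.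
Qed.

Lemma iint_shear1 (f : V -> R) k : ucs f ->
  iint (fun x => f (lin2 1 0 k 1 x)) = iint f.
Proof.
move=> fu; rewrite !iintS; apply: eq_Rintegral => a _; rewrite !iintS.
have [M M0 fM] := ucs_supp fu.
have [u1 u2] := ucs_slice a fu.1 fM.
have us : ucs (fun b => iint (fun w : 'rV[R]_0 => f (rcons0 a (rcons0 b w)))).
  by apply: (@ucs_iint_slice _ _ (fun v => f (rcons0 a v))); split => //; exists M.
rewrite -[RHS](Rintegral_shift (k * a) us); apply: eq_Rintegral => b _.
rewrite /=; congr f; apply: vec2P; rewrite -/(vec2 a b) -/(vec2 a (b + k * a)) /lin2.
  by rewrite !vec2_0 !vec2_1 mul1r mul0r addr0.
by rewrite !vec2_1 !vec2_0 mul1r addrC.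
Qed.

Lemma iint_shear0 (f : V -> R) k : ucs f ->
  iint (fun x => f (lin2 1 k 0 1 x)) = iint f.
Proof.
move=> fu.
have inv x : lin2 1 (- k) 0 1 (lin2 1 k 0 1 x) = x.
  by apply: vec2P; rewrite ?vec2_0 ?vec2_1 ?vec2_0 ?vec2_1; ring.
rewrite (iint_swap0 (ucs_lin2 inv fu)) (iint_swap0 fu).
congr iint; apply/funext => v.
have us : ucs (fun t => f (rcons0 t v)).
  have [M M0 fM] := ucs_supp fu; split=> [e /fu.1[d d0 fd]|].
    exists d => // s t st; apply: fd; rewrite rcons0B norm_rcons0_lt//.
    by rewrite subrr normr0.
  exists M => t tM; apply: fM.
  by apply: (lt_le_trans tM); rewrite -{1}(rcons0_0 t v) coord_le_norm.
rewrite -[RHS](Rintegral_shift (k * v 0 0) us); apply: eq_Rintegral => t _.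
congr f; have -> : v = rcons0 (v 0 0) 0.
  by apply/rowP => i; rewrite (ord1 i) rcons0_0.
rewrite rcons0_0 -/(vec2 t (v 0 0)) -/(vec2 (t + k * v 0 0) (v 0 0)).
by apply: vec2P; rewrite ?vec2_0 ?vec2_1; ring.
Qed.

Definition rot (c s : R) : V -> V := lin2 c (- s) s c.

Lemma rotK c s x : c ^+ 2 + s ^+ 2 = 1 -> rot c (- s) (rot c s x) = x.
Proof.
move=> cs; rewrite /rot opprK; apply: vec2P; rewrite /lin2 ?vec2_0 ?vec2_1.
  by rewrite -[RHS]mul1r -cs; ring.
by rewrite -[RHS]mul1r -cs; ring.
Qed.

Lemma ucs_rot (f : V -> R) c s : c ^+ 2 + s ^+ 2 = 1 -> ucs f ->
  ucs (fun x => f (rot c s x)).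
Proof. by move=> cs; apply: ucs_lin2 => x; exact: (rotK x cs). Qed.

(* A rotation other than the half turn is a product of three shears. *)
Lemma iint_rot_shear (f : V -> R) c s : c ^+ 2 + s ^+ 2 = 1 -> c != -1 -> ucs f ->
  iint (fun x => f (rot c s x)) = iint f.
Proof.
(* The tangent of half the angle. The relations k (1 + c) = s and k s = 1 - c are what the product
   of shears with slopes -k, s, -k uses. *)
move=> cs c1 fu; pose k := s / (1 + c).
have c0 : 1 + c != 0 by rewrite addrC addr_eq0.
have inv0 l x : lin2 1 (- l) 0 1 (lin2 1 l 0 1 x) = x.
  by apply: vec2P; rewrite ?vec2_0 ?vec2_1 ?vec2_0 ?vec2_1; ring.
have inv1 l x : lin2 1 0 (- l) 1 (lin2 1 0 l 1 x) = x.
  by apply: vec2P; rewrite ?vec2_0 ?vec2_1 ?vec2_0 ?vec2_1; ring.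
pose f1 x := f (lin2 1 (- k) 0 1 x); pose f2 x := f1 (lin2 1 0 s 1 x).
have u1 : ucs f1 by exact: (ucs_lin2 (inv0 (- k)) fu).
have u2 : ucs f2 by exact: (ucs_lin2 (inv1 s) u1).
rewrite -(iint_shear0 (- k) fu) -(iint_shear1 s u1) -(iint_shear0 (- k) u2).
congr iint; apply/funext => x; rewrite /f2 /f1; congr f.
have kc : k * (1 + c) = s by rewrite /k divfK.
have ks : k * s = 1 - c.
  apply: (mulfI c0); transitivity (k * (1 + c) * s); first by ring.
  have ss : s * s = 1 - c ^+ 2 by rewrite -cs; ring.
  by rewrite kc ss; ring.
apply: vec2P; rewrite /rot /lin2 ?vec2_0 ?vec2_1 ?vec2_0 ?vec2_1.
  transitivity (1 * x 0 0 - (k * s) * x 0 0 - (k * (1 + (1 - k * s))) * x 0 1).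
    by rewrite ks (_ : 1 + (1 - (1 - c)) = 1 + c) ?kc; ring.
  by ring.
transitivity (s * x 0 0 + (1 - k * s) * x 0 1); first by rewrite ks; ring.
by ring.
Qed.

Lemma iint_rot (f : V -> R) c s : c ^+ 2 + s ^+ 2 = 1 -> ucs f ->
  iint (fun x => f (rot c s x)) = iint f.
Proof.
move=> cs fu; have [c1|] := eqVneq c (-1); last by move=> ?; exact: iint_rot_shear.
have s0 : s = 0.
  apply/eqP; rewrite -sqrf_eq0 -(subrr 1) -{1}cs c1 sqrrN expr1n; apply/eqP; ring.
(* The half turn is the square of the quarter turn, which the shears do reach. *)
have q : (0 : R) ^+ 2 + 1 ^+ 2 = 1 by rewrite expr0n expr1n add0r.
have z : (0 : R) != -1 by rewrite eq_sym oppr_eq0 oner_neq0.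
rewrite -(iint_rot_shear q z fu) -(iint_rot_shear q z (ucs_rot q fu)).
congr iint; apply/funext => x; congr f; rewrite c1 s0.
by apply: vec2P; rewrite /rot /lin2 ?vec2_0 ?vec2_1 ?vec2_0 ?vec2_1; ring.
Qed.

End PlaneRotation.

(** * Wirtinger's inequality *)

Section Wirtinger.
Variables (R : realType).
Local Notation mu := (@lebesgue_measure R).

Lemma is_derive1_continuous (f : R -> R) (x d : R) : is_derive x 1 f d -> continuous_at x f.
Proof.
by move=> fd; apply: differentiable_continuous; apply/derivable1_diffP; have [] := fd.
Qed.

(** The primitive of [m] minus [H] has derivative [m - dH], which is nonnegative, so it increases by
    the mean value theorem. *)
Lemma le_Rintegral_derive (m H dH : R -> R) (p q : R) : continuous m -> p <= q ->
  (forall x : R, p <= x <= q -> is_derive x 1 H (dH x)) ->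
  (forall x, p <= x <= q -> dH x <= m x) ->
  H q - H p <= Rintegral mu `[p, q] m.
Proof.
(* Starting the primitive at [p - 1] makes it differentiable from both sides at [p]. *)
move=> mc pq Hd dHm; pose P t := Rintegral mu `[p - 1, t] m.
have Pd (x : R) : p <= x -> is_derive x 1 P (m x).
  move=> px; have xx1 : x < x + 1 by rewrite ltrDl.
  have p1x : p - 1 < x by lra.
  have [d e] := continuous_FTC1_closed xx1 (continuous_itv_integrable (p - 1) (x + 1) mc) p1x (mc x).
  by split; [exact: d|rewrite -derive1E; exact: e].
have -> : Rintegral mu `[p, q] m = P q - P p.
  by rewrite /P (@Rintegral_itv_split _ m (p - 1) p q)//; [ring|lra].
pose Q := P - H.
have Qd (x : R) : p <= x <= q -> is_derive x 1 Q (m x - dH x).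
  by move=> xpq; have /andP[px _] := xpq; exact: is_deriveB (Pd x px) (Hd x xpq).
have Qc : {within `[p, q], continuous Q}.
  apply: derivable_within_continuous => x; rewrite in_itv /= => xpq.
  by have [] := Qd x xpq.
have Qd' (x : R) : x \in `]p, q[ -> is_derive x 1 Q (m x - dH x).
  by rewrite in_itv /= => /andP[px xq]; apply: Qd; rewrite !ltW.
have [c cpq E] := MVT_segment pq Qd' Qc.
have : 0 <= Q q - Q p.
  rewrite E mulr_ge0 ?subr_ge0//; apply: dHm.
  by move: cpq; rewrite in_itv.
rewrite /Q !fctE; lra.
Qed.

Lemma Rintegral_derive (m H : R -> R) (p q : R) : continuous m -> p <= q ->
  (forall x : R, is_derive x 1 H (m x)) -> Rintegral mu `[p, q] m = H q - H p.
Proof.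
move=> mc pq Hd; apply/le_anti/andP; split; last first.
  by apply: (@le_Rintegral_derive m H m) => // x _.
have nc : continuous (fun x => -1 * m x).
  by move=> x; exact: continuousM (@cst_continuous _ _ (-1 : R) x) (mc x).
have := @le_Rintegral_derive (fun x => -1 * m x) (- H) (fun x => - m x) p q nc pq.
have -> : Rintegral mu `[p, q] (fun x => -1 * m x) = -1 * Rintegral mu `[p, q] m.
  by rewrite RintegralZl//; exact: continuous_itv_integrable.
move=> h; have : (- H) q - (- H) p <= -1 * Rintegral mu `[p, q] m.
  by apply: h => x _; rewrite mulN1r.
rewrite !fctE; lra.
Qed.

Section Piece.
Variables (g dg : R -> R) (c k e : R).
Hypotheses (gd : forall t : R, is_derive t 1 g (dg t)) (dgc : continuous dg).

(** The function k cot(k (t - z) + e), a solution of the Riccati equation phi' = - k^2 - phi^2. For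
    k < 1 a phase [e] keeps it free of poles on a closed interval of length [pi]. *)
Let phi (z t : R) := k * (cos (k * (t - z) + e) / sin (k * (t - z) + e)).

Let gc : continuous g. Proof. by move=> t; exact: is_derive1_continuous (gd t). Qed.

Lemma wirtinger_continuous : continuous (fun t => dg t ^+ 2 - k ^+ 2 * (g t - c) ^+ 2).
Proof.
move=> t.
have c1 : continuous_at t (fun t => g t - c).
  exact: continuousB (@gc t) (@cst_continuous _ _ c t).
have c2 : continuous_at t (fun t => (g t - c) ^+ 2).
  exact: continuous_comp c1 (@exprn_continuous _ 2 _).
have c3 : continuous_at t (fun t => dg t ^+ 2).
  exact: continuous_comp (@dgc t) (@exprn_continuous _ 2 _).
exact: continuousB c3 (continuousM (@cst_continuous _ _ (k ^+ 2) t) c2).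
Qed.

Lemma wirtinger_piece (z p q : R) : p <= q ->
  (forall t, p <= t <= q -> 0 < k * (t - z) + e < pi) ->
  phi z q * (g q - c) ^+ 2 - phi z p * (g p - c) ^+ 2 <=
  Rintegral mu `[p, q] (fun t => dg t ^+ 2 - k ^+ 2 * (g t - c) ^+ 2).
Proof.
move=> pq th.
pose dphi t := - k ^+ 2 * (sin (k * (t - z) + e)) ^- 2.
pose dH t := dphi t * (g t - c) ^+ 2 + phi z t * (2 * (g t - c) * dg t).
have s0 t : p <= t <= q -> 0 < sin (k * (t - z) + e).
  by move=> /th ?; exact: sin_gt0_pi.
have cs t : cos (k * (t - z) + e) ^+ 2 = 1 - sin (k * (t - z) + e) ^+ 2.
  by rewrite -(cos2Dsin2 (k * (t - z) + e)); ring.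
have dl (t : R) : is_derive t 1 (fun t => k * (t - z) + e) k.
  have d1 := is_deriveB (is_derive_id t (1 : R)) (is_derive_cst z t (1 : R)).
  have d := is_deriveD (is_deriveZ k d1) (is_derive_cst e t (1 : R)).
  by apply: is_derive_eq d _; rewrite subr0 addr0 -[_ *: _]/(_ * _) mulr1.
have dphiP (t : R) : p <= t <= q -> is_derive t 1 (phi z) (dphi t).
  move=> tpq; have sn : sin (k * (t - z) + e) != 0 by rewrite gt_eqF// s0.
  have ds := is_derive1_chain (dl t) (is_derive_sin (k * (t - z) + e)).
  have dc := is_derive1_chain (dl t) (is_derive_cos (k * (t - z) + e)).
  have dV := @is_deriveV _ (fun t => sin (k * (t - z) + e)) t _ _ sn ds.
  have d := is_deriveZ k (is_deriveM dc dV).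
  apply: is_derive_eq d _; rewrite /dphi -![_ *: _]/(_ * _).
  have c2 := cs t.
  move: sn c2; move: (sin (k * (t - z) + e)) (cos (k * (t - z) + e)) => s d sn c2.
  transitivity (- k ^+ 2 * (s ^+ 2 + d ^+ 2) * s ^- 2); first by field.
  by rewrite c2; field.
have dHP (t : R) : p <= t <= q -> is_derive t 1 (fun t => phi z t * (g t - c) ^+ 2) (dH t).
  move=> tpq.
  have d1 := is_deriveB (gd t) (is_derive_cst c t (1 : R)).
  have d := is_deriveM (dphiP t tpq) (is_deriveX 2 d1).
  apply: is_derive_eq d _; rewrite /dH -![_ *: _]/(_ * _) !fctE subr0 expr1; ring.
apply: (le_Rintegral_derive wirtinger_continuous pq dHP) => t tpq.
rewrite -subr_ge0; have sn : sin (k * (t - z) + e) != 0 by rewrite gt_eqF// s0.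
suff -> : dg t ^+ 2 - k ^+ 2 * (g t - c) ^+ 2 - dH t = (dg t - phi z t * (g t - c)) ^+ 2.
  exact: sqr_ge0.
rewrite /dH /dphi /phi; have c2 := cs t.
move: sn c2; move: (sin (k * (t - z) + e)) (cos (k * (t - z) + e)) => s d sn c2.
move: (g t - c) (dg t) => G D.
transitivity (D ^+ 2 - 2 * (k * (d / s) * G) * D + k ^+ 2 * G ^+ 2 * ((1 - s ^+ 2) * s ^- 2)).
  by field.
by rewrite -c2; field.
Qed.

End Piece.

(** Some [t0] satisfies g(t0 + pi) = g(t0) = c, so g - c vanishes at both ends of the two half
    periods. On each of them [wirtinger_piece] applies for every k < 1, without boundary terms, and
    k tends to 1. *)
Lemma wirtinger (g dg : R -> R) : (forall t : R, is_derive t 1 g (dg t)) ->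
  continuous dg -> g (2 * pi) = g 0 -> Rintegral mu `[0, 2 * pi] g = 0 ->
  Rintegral mu `[0, 2 * pi] (fun t => g t ^+ 2) <=
  Rintegral mu `[0, 2 * pi] (fun t => dg t ^+ 2).
Proof.
move=> gd dgc gper gmean.
have gc : continuous g by move=> t; exact: is_derive1_continuous (gd t).
have pi0 := pi_gt0 R.
(* The function h(t) = g(t + pi) - g(t) takes opposite values at 0 and [pi]. *)
have [t0 t0pi gt0] : exists2 t0 : R, 0 <= t0 <= pi & g (t0 + pi) = g t0.
  pose h t := g (t + pi) - g t.
  have hc : continuous h.
    move=> t; apply: continuousB; last exact: gc.
    have c1 : continuous_at t (fun t : R => t + pi).
      by apply: is_derive1_continuous; exact: is_derive_shift.
    exact: continuous_comp c1 (@gc _).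
  have h1 : h pi = - h 0.
    by rewrite /h add0r (_ : pi + pi = 2 * pi) ?gper ?opprB// -mulr2n mulr_natl.
  have [] := @IVT R h 0 pi 0 (ltW pi0) (continuous_subspaceT hc).
    rewrite h1 ge_min le_max; have [h0|h0] := leP 0 (h 0).
      by rewrite oppr_le0 h0 orbT.
    by rewrite oppr_ge0 (ltW h0) orbT.
  move=> t; rewrite in_itv /= => tpi /eqP; rewrite subr_eq0 => /eqP tE.
  by exists t.
have /andP[t00 t0p] := t0pi.
pose c := g t0.
have g2c : continuous (fun t => g t ^+ 2).
  by move=> t; exact: continuous_comp (@gc t) (@exprn_continuous _ 2 _).
have dg2c : continuous (fun t => dg t ^+ 2).
  by move=> t; exact: continuous_comp (@dgc t) (@exprn_continuous _ 2 _).
set A := Rintegral _ _ _; set B := Rintegral _ _ _.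
have key (k : R) : 0 < k < 1 -> k ^+ 2 * A <= B.
  (* Half of what [k * pi] leaves free in the interval from 0 to [pi]. *)
  move=> /andP[k0 k1]; pose e : R := (1 - k) * pi / 2.
  have e0 : 0 < e by rewrite divr_gt0// mulr_gt0// subr_gt0.
  have ke : k * pi + 2 * e = pi by rewrite /e; field.
  have th (z t : R) : z <= t <= z + pi -> 0 < k * (t - z) + e < pi.
    move=> /andP[zt tz].
    have a1 : 0 <= k * (t - z) by rewrite mulr_ge0 ?subr_ge0// ltW.
    have a2 : k * (t - z) <= k * pi by rewrite ler_wpM2l ?(ltW k0)// lerBlDl.
    by clear -a1 a2 e0 ke; apply/andP; split; lra.
  pose m t := dg t ^+ 2 - k ^+ 2 * (g t - c) ^+ 2.
  have mc : continuous m by exact: wirtinger_continuous.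
  have q1 : 0 <= t0 by [].
  have q2 : t0 <= t0 + pi by rewrite lerDl ltW.
  have q3 : t0 + pi <= 2 * pi by clear -t0p; lra.
  (* The intervals from 0 to t0 and from t0 + pi to 2 pi are the two parts of one half period, cut
     by the base point of the circle. The phases t0 - pi and t0 + pi give [phi] the same value at 0
     and 2 pi, so the boundary terms there cancel. *)
  have th1 (t : R) : 0 <= t <= t0 -> 0 < k * (t - (t0 - pi)) + e < pi.
    move=> /andP[a1 a2]; apply: th; clear -a1 a2 t0p; apply/andP; split; lra.
  have th3 (t : R) : t0 + pi <= t <= 2 * pi -> 0 < k * (t - (t0 + pi)) + e < pi.
    move=> /andP[a1 a2]; apply: th; clear -a1 a2 t00; apply/andP; split; lra.
  have p1 := @wirtinger_piece g dg c k e gd dgc _ _ _ q1 th1.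
  have p2 := @wirtinger_piece g dg c k e gd dgc _ _ _ q2 (th t0).
  have p3 := @wirtinger_piece g dg c k e gd dgc _ _ _ q3 th3.
  have S0 : 0 <= Rintegral mu `[0, 2 * pi] m.
    rewrite (@Rintegral_itv_split _ m 0 t0 (2 * pi))//; last exact: le_trans q2 q3.
    rewrite (@Rintegral_itv_split _ m t0 (t0 + pi) (2 * pi))//.
    have E : 2 * pi - (t0 + pi) = 0 - (t0 - pi) :> R by ring.
    rewrite gper E in p3; rewrite gt0 in p2 p3.
    have cc0 : (g t0 - c) ^+ 2 = 0 by rewrite subrr expr0n.
    rewrite cc0 in p1 p2 p3.
    have {}p1 : 0 <= Rintegral mu `[0, t0] m +
        k * (cos (k * (0 - (t0 - pi)) + e) / sin (k * (0 - (t0 - pi)) + e)) * (g 0 - c) ^+ 2.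
      rewrite mulr0 in p1; move: p1; move: (_ * (g 0 - c) ^+ 2) (Rintegral _ _ _).
      by move=> x1 x2 h; clear -h; lra.
    have {}p3 : k * (cos (k * (0 - (t0 - pi)) + e) / sin (k * (0 - (t0 - pi)) + e))
        * (g 0 - c) ^+ 2 <= Rintegral mu `[t0 + pi, 2 * pi] m.
      rewrite mulr0 in p3; move: p3; move: (_ * (g 0 - c) ^+ 2) (Rintegral _ _ _).
      by move=> x1 x2 h; clear -h; lra.
    have {}p2 : 0 <= Rintegral mu `[t0, t0 + pi] m.
      by apply: le_trans p2; rewrite !mulr0 subrr.
    move: p1 p2 p3; move: (Rintegral _ _ _) (Rintegral _ _ _) (Rintegral _ _ _) (_ * (g 0 - c) ^+ 2).
    by move=> x1 x2 x3 x4 h1 h2 h3; clear -h1 h2 h3; lra.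
  (* The mean of [g] is 0, so replacing g by g - c only adds 2 pi c^2 to [A], which has the
     favourable sign. *)
  have mE : Rintegral mu `[0, 2 * pi] m = B - k ^+ 2 * (A + c ^+ 2 * (2 * pi)).
    have twopi : 0 <= 2 * pi :> R by rewrite mulr_ge0// ltW.
    have ccc : continuous (fun _ : R => c ^+ 2) by move=> t; exact: cst_continuous.
    have cgc : continuous (fun t : R => - (2 * c) * g t).
      by move=> t; exact: continuousM (@cst_continuous _ _ (- (2 * c)) t) (@gc t).
    have s1 : continuous (fun t : R => c ^+ 2 + - (2 * c) * g t).
      by move=> t; exact: continuousD (@ccc t) (@cgc t).
    have s2 : continuous (fun t : R => g t ^+ 2 + (c ^+ 2 + - (2 * c) * g t)).
      by move=> t; exact: continuousD (@g2c t) (@s1 t).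
    have s3 : continuous (fun t : R => - k ^+ 2 * (g t ^+ 2 + (c ^+ 2 + - (2 * c) * g t))).
      by move=> t; exact: continuousM (@cst_continuous _ _ (- k ^+ 2) t) (@s2 t).
    have I f : continuous f -> mu.-integrable `[0, 2 * pi] (EFin \o f).
      exact: continuous_itv_integrable.
    have -> : m = (fun t => dg t ^+ 2 + - k ^+ 2 * (g t ^+ 2 + (c ^+ 2 + - (2 * c) * g t))).
      by apply/funext => t; rewrite /m; ring.
    rewrite (RintegralD _ (I _ dg2c) (I _ s3))// (RintegralZl _ _ (I _ s2))//.
    rewrite (RintegralD _ (I _ g2c) (I _ s1))// (RintegralD _ (I _ ccc) (I _ cgc))//.
    rewrite (RintegralZl _ _ (I _ gc))//.
    by rewrite gmean mulr0 addr0 Rintegral_itv_cst// subr0 mulNr.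
  have : 0 <= k ^+ 2 * (c ^+ 2 * (2 * pi)).
    by rewrite mulr_ge0 ?sqr_ge0// mulr_ge0 ?sqr_ge0// mulr_ge0// ltW.
  move: S0; rewrite mE; move: (c ^+ 2 * (2 * pi)) (k ^+ 2) => x1 x2.
  by move: {mE} (A) (B) => x3 x4 h1 h2; clear -h1 h2; lra.
have A0 : 0 <= A by apply: Rintegral_ge0 => t _; exact: sqr_ge0.
apply/ler_addgt0Pl => e e0.
have d0 : 0 < 2 * A + 1 + e by clear -A0 e0; lra.
(* Chosen so that 0 < k < 1 and 2 (1 - k) A <= e, whence k^2 A >= A - e. *)
pose k := 1 - e / (2 * (2 * A + 1 + e)).
have q0 : 0 < e / (2 * (2 * A + 1 + e)) by rewrite divr_gt0// mulr_gt0.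
have q1 : e / (2 * (2 * A + 1 + e)) < 1.
  by rewrite ltr_pdivrMr ?mulr_gt0// mul1r; clear -A0 e0; lra.
have kk : 0 < k < 1 by rewrite /k; clear -q0 q1; apply/andP; split; lra.
have h := key k kk.
have : A * (e / (2 * (2 * A + 1 + e))) <= e / 2.
  rewrite mulrA ler_pdivrMr ?mulr_gt0//.
  have -> : e / 2 * (2 * (2 * A + 1 + e)) = e * (2 * A + 1 + e) by field.
  by rewrite mulrC ler_pM2l//; clear -A0 e0; lra.
move: h; rewrite /k; move: (e / (2 * (2 * A + 1 + e))) q0 q1 => q q0 q1 h1 h2.
have : (1 - q) ^+ 2 * A = A - 2 * (A * q) + q ^+ 2 * A by ring.
have : 0 <= q ^+ 2 * A by rewrite mulr_ge0// sqr_ge0.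
move: h1; move: ((1 - q) ^+ 2 * A) (q ^+ 2 * A) (A * q) h2 => x1 x2 x3 h2 h1 h3 h4.
by clear -h1 h2 h3 h4; lra.
Qed.

End Wirtinger.

(** * Rotations acting on plane functions *)

Section CircleAction.
Variables (R : realType).
Local Notation mu := (@lebesgue_measure R).
Notation V := 'rV[R]_2.

Lemma vec2D0 (a b h : R) : vec2 a b + h *: ebasis R 0 = vec2 (a + h) b.
Proof. by apply: vec2P; rewrite rowDE ?vec2_0 ?vec2_1 !mxE /= ?mulr1 ?mulr0 ?addr0. Qed.

Lemma vec2D1 (a b h : R) : vec2 a b + h *: ebasis R 1 = vec2 a (b + h).
Proof. by apply: vec2P; rewrite rowDE ?vec2_0 ?vec2_1 !mxE /= ?mulr1 ?mulr0 ?addr0. Qed.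

(** The increment is split along the two axes, each part is a partial derivative at an intermediate
    point by the mean value theorem, and continuity of the partial derivatives gives the limit. *)
Lemma is_derive_curve (f : V -> R) (p q : R -> R) (t p' q' : R) :
  (forall i y, derivable f y (ebasis R i)) -> (forall i, continuous (partial i f)) ->
  is_derive t 1 p p' -> is_derive t 1 q q' ->
  is_derive t 1 (fun s => f (vec2 (p s) (q s)))
    (p' * partial 0 f (vec2 (p t) (q t)) + q' * partial 1 f (vec2 (p t) (q t))).
Proof.
move=> fd fc pd qd.
have /choice[xi xiP] : forall s : R, exists z : R, `|z| <= `|p s - p t| /\
    f (vec2 (p s) (q s)) - f (vec2 (p t) (q s)) =
    (p s - p t) * partial 0 f (vec2 (p t + z) (q s)).
  move=> s; have [z zh E] := line_MVT (vec2 (p t) (q s)) (p s - p t) (fd 0).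
  by exists z; split => //; rewrite !vec2D0 subrKC in E.
have /choice[eta etaP] : forall s : R, exists z : R, `|z| <= `|q s - q t| /\
    f (vec2 (p t) (q s)) - f (vec2 (p t) (q t)) =
    (q s - q t) * partial 1 f (vec2 (p t) (q t + z)).
  move=> s; have [z zh E] := line_MVT (vec2 (p t) (q t)) (q s - q t) (fd 1).
  by exists z; split => //; rewrite !vec2D1 subrKC in E.
have near0 (r : R -> R) r' (e : R) : is_derive t 1 r r' -> 0 < e ->
    \forall h \near 0^', `|r (h *: (1 : R) + t) - r t| < e.
  move=> rd e0; have /cvgrPdist_lt/(_ _ e0)/nbhs_ballP[d /= d0 hd] := is_derive1_continuous rd.
  apply: filterS (dnbhs0_lt d0) => h hlt; rewrite distrC; apply: hd.
  rewrite -ball_normE /= -[h *: 1]/(h * 1) mulr1 opprD addrCA subrr addr0 normrN.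
  exact: hlt.
have ptc i (z : R -> V) : (forall e : R, 0 < e ->
      \forall h \near 0^', `|vec2 (p t) (q t) - z h| < e) ->
    partial i f (z h) @[h --> 0^'] --> partial i f (vec2 (p t) (q t)).
  move=> zc; apply/cvgrPdist_lt => e e0.
  have /cvgrPdist_lt/(_ _ e0)/nbhs_ballP[d /= d0 hd] := fc i (vec2 (p t) (q t)).
  by apply: filterS (zc d d0) => h zh; apply: hd; rewrite -ball_normE.
have pq : (fun h : R => h^-1 *: (((fun s => f (vec2 (p s) (q s))) \o shift t) (h *: 1)
      - f (vec2 (p t) (q t)))) @ 0^' -->
    p' * partial 0 f (vec2 (p t) (q t)) + q' * partial 1 f (vec2 (p t) (q t)).
  have -> : (fun h : R => h^-1 *: (((fun s => f (vec2 (p s) (q s))) \o shift t) (h *: 1)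
      - f (vec2 (p t) (q t)))) = (fun h : R =>
      h^-1 *: ((p \o shift t) (h *: 1) - p t) *
        partial 0 f (vec2 (p t + xi (h *: 1 + t)) (q (h *: 1 + t))) +
      h^-1 *: ((q \o shift t) (h *: 1) - q t) *
        partial 1 f (vec2 (p t) (q t + eta (h *: 1 + t)))).
    apply/funext => h; rewrite /= /shift -!scalerAl -scalerDr; congr (_ *: _).
    have [_ <-] := xiP (h *: 1 + t); have [_ <-] := etaP (h *: 1 + t).
    by rewrite addrA subrK.
  apply: cvgD; apply: cvgM.
  - by have [d <-] := pd; exact: d.
  - apply: ptc => e e0; near=> h.
    rewrite /vec2 rcons0B; apply: norm_rcons0_lt.
      rewrite opprD addNKr normrN; have [xh _] := xiP (h *: 1 + t).
      by apply: (le_lt_trans xh); near: h; exact: near0 pd e0.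
    rewrite rcons0B subrr; apply: norm_rcons0_lt; last by rewrite normr0.
    by rewrite distrC; near: h; exact: near0 qd e0.
  - by have [d <-] := qd; exact: d.
  - apply: ptc => e e0; near=> h.
    rewrite /vec2 rcons0B; apply: norm_rcons0_lt; first by rewrite subrr normr0.
    rewrite rcons0B subrr; apply: norm_rcons0_lt; last by rewrite normr0.
    rewrite opprD addNKr normrN; have [xh _] := etaP (h *: 1 + t).
    by apply: (le_lt_trans xh); near: h; exact: near0 qd e0.
by split; [exact: cvgP pq|exact: cvg_lim pq].
Unshelve. all: by end_near. Qed.

(** The angular derivative d/dtheta, generator of the rotations [turn]. *)
Definition ang (f : V -> R) (x : V) : R := x 0 0 * partial 1 f x - x 0 1 * partial 0 f x.
Definition turn (t : R) (x : V) : V := rot (cos t) (sin t) x.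

Lemma is_derive_turn (f : V -> R) (x : V) (t : R) :
  (forall i y, derivable f y (ebasis R i)) -> (forall i, continuous (partial i f)) ->
  is_derive t 1 (fun s => f (turn s x)) (ang f (turn t x)).
Proof.
move=> fd fc.
pose p s := cos s * x 0 0 + - sin s * x 0 1; pose q s := sin s * x 0 0 + cos s * x 0 1.
have pd : is_derive t 1 p (- q t).
  have d1 := is_deriveM (is_derive_cos t) (is_derive_cst (x 0 0) t (1 : R)).
  have d2 := is_deriveM (is_deriveN (is_derive_sin t)) (is_derive_cst (x 0 1) t (1 : R)).
  have d := is_deriveD d1 d2; apply: is_derive_eq d _.
  by rewrite !scaler0 !add0r /q /cst -![_ *: _]/(_ * _); ring.
have qd : is_derive t 1 q (p t).
  have d1 := is_deriveM (is_derive_sin t) (is_derive_cst (x 0 0) t (1 : R)).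
  have d2 := is_deriveM (is_derive_cos t) (is_derive_cst (x 0 1) t (1 : R)).
  have d := is_deriveD d1 d2; apply: is_derive_eq d _.
  by rewrite !scaler0 !add0r /p /cst -![_ *: _]/(_ * _); ring.
have d := is_derive_curve fd fc pd qd; apply: is_derive_eq d _.
rewrite /ang /turn /rot /lin2 vec2_0 vec2_1 -/(p t) -/(q t).
by rewrite [LHS]addrC mulNr.
Qed.

Lemma cs1 (t : R) : cos t ^+ 2 + sin t ^+ 2 = 1. Proof. exact: cos2Dsin2. Qed.

Lemma cos_le1' (t : R) : `|cos t| <= 1.
Proof. by rewrite ler_norml cos_geN1 cos_le1. Qed.

Lemma sin_le1' (t : R) : `|sin t| <= 1.
Proof. by rewrite ler_norml sin_geN1 sin_le1. Qed.

Lemma lipschitz_cos_sin (s t : R) : `|cos s - cos t| <= `|s - t| /\ `|sin s - sin t| <= `|s - t|.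
Proof.
have lip (f df : R -> R) : (forall x : R, is_derive x 1 f (df x)) -> (forall x, `|df x| <= 1) ->
    `|f s - f t| <= `|s - t|.
  move=> fd db.
  have fdv (y : R) : derivable f y 1 by have [] := fd y.
  have [z _] := line_MVT t (s - t) fdv.
  rewrite -[(s - t) *: 1]/((s - t) * 1) mulr1 subrKC => ->.
  have -> : 'D_1 f (t + z *: 1) = df (t + z *: 1) by have [] := fd (t + z *: 1).
  by rewrite normrM ler_piMr.
split; first by apply: (lip cos (fun x => - sin x)) => x; rewrite ?normrN ?sin_le1'.
by apply: (lip sin cos) => x; exact: cos_le1'.
Qed.

Lemma norm_turn (t : R) (x : V) : `|turn t x| <= 4 * `|x|.
Proof.
apply: le_trans (norm_lin2 _ _ _ _ _) _; apply: ler_wpM2r => //.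
have := cos_le1' t; have := sin_le1' t; rewrite normrN; lra.
Qed.

Lemma norm_turnB (s t : R) (x : V) : `|turn s x - turn t x| <= 4 * `|s - t| * `|x|.
Proof.
have -> : turn s x - turn t x =
    lin2 (cos s - cos t) (- (sin s - sin t)) (sin s - sin t) (cos s - cos t) x.
  by apply: vec2P; rewrite rowBE /turn /rot /lin2 ?vec2_0 ?vec2_1; ring.
apply: le_trans (norm_lin2 _ _ _ _ _) _; apply: ler_wpM2r => //.
have [l1 l2] := lipschitz_cos_sin s t; rewrite normrN; clear -l1 l2; lra.
Qed.

Lemma turn_continuous (x : V) : continuous (fun t : R => turn t x).
Proof.
move=> t; apply/cvgrPdist_lt => e e0.
have c0 : 0 < 4 * `|x| + 1 by rewrite ltr_wpDl// mulr_ge0.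
have d0 : 0 < e / (4 * `|x| + 1) by rewrite divr_gt0.
apply/nbhs_ballP; exists (e / (4 * `|x| + 1)) => // s ts /=.
have {}ts : `|t - s| < e / (4 * `|x| + 1) := ts.
apply: le_lt_trans (norm_turnB t s x) _; rewrite mulrAC mulrC.
apply: (@le_lt_trans _ _ (`|t - s| * (4 * `|x| + 1))).
  by apply: ler_wpM2l => //; rewrite lerDl.
by rewrite -ltr_pdivlMr.
Qed.

Lemma turnK (t : R) (x : V) : turn (- t) (turn t x) = x.
Proof. by rewrite /turn cosN sinN rotK ?cs1. Qed.

Lemma norm_turn_ge (t : R) (x : V) : `|x| <= 4 * `|turn t x|.
Proof. by rewrite -{1}(turnK t x) norm_turn. Qed.

(** Rotation invariance makes the integral of [G (turn t x)] independent of [t]; average over [t]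
    and exchange the integrals. *)
Lemma iint_circle_mean (G : V -> R) : ucs G ->
  2 * pi * iint G =
  iint (fun x => Rintegral mu `[0, 2 * pi] (fun t => G (turn t x))).
Proof.
move=> Gu; have [M M0 GM] := ucs_supp Gu.
have pi0 := pi_gt0 R.
(* The norm is the sup norm, which rotations respect only up to a factor, bounded here by 4; hence
   the support bound [4 * M]. *)
rewrite (@iint_Rintegral R 2 (fun t x => G (turn t x)) 0 (2 * pi) (4 * M)).
- under eq_Rintegral do rewrite (iint_rot (cs1 _) Gu).
  by rewrite Rintegral_itv_cst ?subr0 1?mulrC// mulr_ge0// ltW.
- by rewrite mulr_ge0// ltW.
- by rewrite mulr_ge0.
- move=> t x xM; apply: GM; have := norm_turn_ge t x; lra.
- move=> e e0; have [d d0 Gd] := Gu.1 e e0.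
  (* [turn] has Lipschitz constant 4 in the point and 4 |y| in the angle. If |y| <= 4 M + 1 the
     total variation is at most 4 d1 (4 M + 2) <= d / 2; otherwise [d1 <= 1] gives |x| > 4 M and
     both rotated points lie outside the support. *)
  pose d1 := Num.min 1 (d / (8 * (4 * M + 2))).
  have D0 : 0 < 8 * (4 * M + 2) by clear -M0; lra.
  have d10 : 0 < d1 by rewrite lt_min ltr01 divr_gt0.
  exists d1 => // s t x y st xy.
  have [yM|yM] := leP `|y| (4 * M + 1).
    apply: Gd.
    have -> : turn s x - turn t y = turn s (x - y) + (turn s y - turn t y).
      have tB : turn s (x - y) = turn s x - turn s y by rewrite /turn /rot lin2B.
      by rewrite tB subrKA.
    apply: le_lt_trans (ler_normD _ _) _.
    have a1 := norm_turn s (x - y).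
    have a2 := norm_turnB s t y.
    have a3 : 4 * `|s - t| * `|y| <= (4 * `|s - t|) * (4 * M + 1).
      by apply: ler_wpM2l => //; rewrite mulr_ge0.
    have a4 : `|s - t| * (4 * M + 1) <= d1 * (4 * M + 1).
      by apply: ler_wpM2r; [clear -M0; lra|exact: ltW].
    have a5 : d1 * (8 * (4 * M + 2)) <= d.
      by rewrite -ler_pdivlMr// ge_min lexx orbT.
    have a6 : d1 * (4 * M + 2) = d1 * (4 * M + 1) + d1 by ring.
    have a7 : 0 <= d1 * (4 * M + 1) by apply: mulr_ge0; [exact: ltW|clear -M0; lra].
    move: a1 a2 a3 a4 a5 a6 a7 xy; move: `|turn s (x - y)| `|turn s y - turn t y| `|x - y|.
    move: (4 * `|s - t| * `|y|) => n4 n1 n2 n3 a1 a2 a3 a4 a5 a6 a7 xy.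
    rewrite -mulrA in a3; rewrite mulrCA a6 in a5.
    move: a3 a4 a5 a7; move: (`|s - t| * (4 * M + 1)) (d1 * (4 * M + 1)) => n5 n6 a3 a4 a5 a7.
    by clear -a1 a2 a3 a4 a5 a7 xy d0 d10; lra.
  have d11 : d1 <= 1 by rewrite ge_min lexx.
  have xM : 4 * M < `|x|.
    have := ler_normD x (y - x); rewrite addrC subrK distrC => h.
    by clear -h xy yM d11; lra.
  have tx : M < `|turn s x| by have := norm_turn_ge s x; clear -xM; lra.
  have ty : M < `|turn t y| by have := norm_turn_ge t y; clear -yM; lra.
  by rewrite (GM _ tx) (GM _ ty) subrr normr0.
Qed.

Lemma rad_turn (t : R) (x : V) : rad (turn t x) = rad x.
Proof.
rewrite /Defs.rad; congr Num.sqrt.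
have sum2 (F : 'I_2 -> R) : \sum_(i < 2) F i = F 0 + F 1.
  by rewrite big_ord_recl big_ord1; congr (_ + F _); apply: val_inj.
rewrite !sum2 /turn /rot /lin2 vec2_0 vec2_1.
transitivity ((cos t ^+ 2 + sin t ^+ 2) * (x 0 0 ^+ 2 + x 0 1 ^+ 2)); first by ring.
by rewrite cs1 mul1r.
Qed.

End CircleAction.

(** * Poincare inequality on circles, n = 2 *)

Section CirclePoincare.
Variables (R : realType).
Local Notation mu := (@lebesgue_measure R).
Notation V := 'rV[R]_2.
Variables (K : set V) (cK : compact K) (KO : K `<=` @pball R 2).
Variable (u : V -> R).
Hypotheses (u2 : C2 u) (u0 : off K u).

Let sum2 (F : 'I_2 -> R) : \sum_(i < 2) F i = F 0 + F 1.
Proof. by rewrite big_ord_recl big_ord1; congr (_ + F _); apply: val_inj. Qed.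

Let ud i x : derivable u x (ebasis R i). Proof. by case: u2 => _ [h _]; exact: h. Qed.
Let pc i : continuous (partial i u). Proof. by case: u2 => _ [_ [h _]]; exact: h. Qed.
Let pd i j x : derivable (partial i u) x (ebasis R j).
Proof. by case: u2 => _ [_ [_ [h _]]]; exact: h. Qed.
Let ppc i j : continuous (partial j (partial i u)).
Proof. by case: u2 => _ [_ [_ [_ h]]]; exact: h. Qed.

Let coordc (i : 'I_2) : continuous (fun x : V => x 0 i).
Proof. by move=> x; exact: (@coord_continuous R 1 2 0 i). Qed.

Let ang_is_derive i x : is_derive x (ebasis R i) (ang u)
  ((0 == i)%:R * partial 1 u x + x 0 0 * partial i (partial 1 u) x
   - ((1 == i)%:R * partial 0 u x + x 0 1 * partial i (partial 0 u) x)).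
Proof.
have d1 := is_deriveM (is_derive_coord x i 0) (derivableP (@pd 1 i x)).
have d2 := is_deriveM (is_derive_coord x i 1) (derivableP (@pd 0 i x)).
have d := is_deriveB d1 d2; apply: is_derive_eq d _.
rewrite -![_ *: _]/(_ * _) -!/(partial _ _ _).
by congr (_ - _); rewrite addrC [X in X + _]mulrC.
Qed.

Let partial_ang i x : partial i (ang u) x =
  (0 == i)%:R * partial 1 u x + x 0 0 * partial i (partial 1 u) x
   - ((1 == i)%:R * partial 0 u x + x 0 1 * partial i (partial 0 u) x).
Proof. by have [_ <-] := ang_is_derive i x. Qed.

Let contM (f g : V -> R) : continuous f -> continuous g -> continuous (fun x => f x * g x).
Proof. by move=> fc gc x; exact: continuousM (fc x) (gc x). Qed.

Let contB (f g : V -> R) : continuous f -> continuous g -> continuous (fun x => f x - g x).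
Proof. by move=> fc gc x; exact: continuousB (fc x) (gc x). Qed.

Let contD (f g : V -> R) : continuous f -> continuous g -> continuous (fun x => f x + g x).
Proof. by move=> fc gc x; exact: continuousD (fc x) (gc x). Qed.

Let contC (a : R) : continuous (fun _ : V => a).
Proof. by move=> x; exact: cst_continuous. Qed.

Let ang_cont (f : V -> R) : (forall i, continuous (partial i f)) -> continuous (ang f).
Proof.
by move=> fc; exact: contB (contM (@coordc 0) (fc 1)) (contM (@coordc 1) (fc 0)).
Qed.

Let partial_ang_cont i : continuous (partial i (ang u)).
Proof.
have -> : partial i (ang u) = (fun x =>
  (0 == i)%:R * partial 1 u x + x 0 0 * partial i (partial 1 u) x
   - ((1 == i)%:R * partial 0 u x + x 0 1 * partial i (partial 0 u) x)).
  by apply/funext => x; exact: partial_ang.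
apply: contB; apply: contD.
- exact: contM (@contC _) (@pc 1).
- exact: contM (@coordc 0) (@ppc 1 i).
- exact: contM (@contC _) (@pc 0).
- exact: contM (@coordc 1) (@ppc 0 i).
Qed.

Let off_ang f : off K f -> off K (ang f).
Proof.
by move=> f0 x Kx; rewrite /ang !(off_partial cK _ f0)// !mulr0 subrr.
Qed.

Let sum_del_sqr x : pball x -> \sum_(j < 2) del j u x ^+ 2 = ang u x ^+ 2.
Proof.
move=> xO; have r0 := rad_neq0 xO; have := sqr_rad x; rewrite !sum2 !delE /eul /vf /ce.
rewrite sum2 /ang; move: (partial 0 u x) (partial 1 u x) (x 0 0) (x 0 1) => a b p q.
move: r0; move: (rad x) => r r0 rE.
transitivity (r ^+ 2 * (a ^+ 2 + b ^+ 2) - 2 * (p * a + q * b) ^+ 2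
  + (p ^+ 2 + q ^+ 2) / r ^+ 2 * (p * a + q * b) ^+ 2); first by field.
by rewrite -rE divff ?expf_neq0// rE; ring.
Qed.

Let sum_del_del2 x : pball x -> \sum_(j < 2) del j (del j u) x = ang (ang u) x.
Proof.
move=> xO; rewrite (sum_del_del u2 xO) sqr_rad.
rewrite (vf_eul u2 (@ce R 2) xO : eul (eul u) x = _) /eul /ang -/(ang u) !partial_ang.
have e01 : (0 == 1 :> 'I_2)%:R = 0 :> R by [].
have e10 : (1 == 0 :> 'I_2)%:R = 0 :> R by [].
have e00 : (0 == 0 :> 'I_2)%:R = 1 :> R by [].
have e11 : (1 == 1 :> 'I_2)%:R = 1 :> R by [].
rewrite e00 ?e11 e01 ?e10.
have E1 : \sum_(j < 2) partial j (partial j u) x =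
    partial 0 (partial 0 u) x + partial 1 (partial 1 u) x by exact: sum2.
have E2 l : vf (@ce R 2) (partial l u) x =
    x 0 0 * partial 0 (partial l u) x + x 0 1 * partial 1 (partial l u) x by exact: sum2.
have E3 : \sum_(l < 2) x 0 l * vf (@ce R 2) (partial l u) x =
    x 0 0 * (x 0 0 * partial 0 (partial 0 u) x + x 0 1 * partial 1 (partial 0 u) x) +
    x 0 1 * (x 0 0 * partial 0 (partial 1 u) x + x 0 1 * partial 1 (partial 1 u) x).
  exact: etrans (sum2 (fun l => x 0 l * vf (@ce R 2) (partial l u) x))
    (congr2 (fun a b => x 0 0 * a + x 0 1 * b) (E2 0) (E2 1)).
have E4 : \sum_(l < 2) ce l x * partial l u x = x 0 0 * partial 0 u x + x 0 1 * partial 1 u x.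
  exact: sum2.
apply: (etrans (congr2 (fun a b => a - b) (congr2 (fun a b => a - b)
  (congr2 *%R (sum2 (fun i => x 0 i ^+ 2)) E1) (congr2 +%R E3 E4))
  (congr1 (fun a => (2 - 2) * a) E4))).
move: (partial 0 (partial 0 u) x) (partial 0 (partial 1 u) x) (partial 1 (partial 0 u) x)
  (partial 1 (partial 1 u) x) (partial 0 u x) (partial 1 u x) => a b c d e f.
by cbv beta; ring.
Qed.

(** In the plane the squared spherical gradient is ([ang u])^2 and the spherical Laplacian is
    [ang (ang u)]. Wirtinger is applied to [ang u] along each circle, where its mean is 0 as it is
    the derivative of a periodic function, and the radial weight is constant there. *)
Lemma sphere_poincare_2 :
  iint (fun x => wk 3 x * \sum_(j < 2) del j u x ^+ 2) <=
  iint (fun x => wk 3 x * (\sum_(j < 2) del j (del j u) x) ^+ 2).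
Proof.
have [g wr] := @radgrad_wk R 2 3.
have yC j := C1O_del u2 j; have y0 j := off_del cK j u0.
have wC : C1O (@wk R 2 3) by exact: wr.1.
have uT : ucs (fun x => wk 3 x * (\sum_(j < 2) del j (del j u) x) ^+ 2).
  apply: (C0O_ucs cK KO); first by C0O_tac.
  move=> x Kx; rewrite big1 ?expr0n ?mulr0// => k _; by rewrite (off_del cK k (y0 k)).
have uY : ucs (fun x => wk 3 x * \sum_(j < 2) del j u x ^+ 2).
  apply: (C0O_ucs cK KO); first by C0O_tac.
  by move=> x Kx; rewrite big1 ?mulr0// => k _; rewrite y0// expr0n.
rewrite -subr_ge0 -(iintB uT uY).
pose G x := wk 3 x * (ang (ang u) x ^+ 2 - ang u x ^+ 2).
have aC := ang_cont pc; have aaC := ang_cont partial_ang_cont.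
have a0 := off_ang u0; have aa0 := off_ang a0.
have G0 : off K G by move=> x Kx; rewrite /G a0// aa0// expr0n subrr mulr0.
have -> : iint (fun x => wk 3 x * (\sum_(j < 2) del j (del j u) x) ^+ 2
    - wk 3 x * \sum_(j < 2) del j u x ^+ 2) = iint G.
  apply: (eq_iint_off KO) => //.
    move=> x Kx; rewrite !sum2 !(off_del cK _ (y0 _))// !y0// addr0 expr0n /= addr0.
    by rewrite mulr0 subrr.
  by move=> x xO; rewrite sum_del_sqr// sum_del_del2// -mulrBr.
have Gu : ucs G.
  apply: (C0O_ucs cK KO) => //; apply: C0O_M; first exact: (C1O_C0O wC).
  move=> x _; apply: contB => y.
    exact: continuous_comp (@aaC y) (@exprn_continuous _ 2 _).
  exact: continuous_comp (@aC y) (@exprn_continuous _ 2 _).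
have pi0 : 0 < 2 * pi :> R by rewrite mulr_gt0// pi_gt0.
rewrite -(pmulr_rge0 _ pi0) iint_circle_mean//; apply: iint_ge0 => x.
have [xO|xO] := pselect (pball x); last first.
  rewrite (_ : (fun t => _) = (fun=> 0)); first by rewrite Rintegral_itv_cst ?mul0r// ltW.
  by apply/funext => t; apply: G0 => /KO; rewrite /pball /= rad_turn.
have wE t : wk 3 (turn t x) = wk 3 x by rewrite /wk /lam /kk rad_turn.
have w0 : 0 <= wk 3 x by rewrite /wk mulr_ge0// exprn_ge0// ltW ?lam_gt0 ?kk_gt0.
pose dg t := ang (ang u) (turn t x); pose gg t := ang u (turn t x).
have angd i y : derivable (ang u) y (ebasis R i) by have [] := ang_is_derive i y.
have gd (t : R) : is_derive t 1 gg (dg t) := is_derive_turn x t angd partial_ang_cont.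
have hd (t : R) : is_derive t 1 (fun t => u (turn t x)) (gg t) := is_derive_turn x t ud pc.
have turnc : continuous (fun t : R => turn t x) by exact: turn_continuous.
have dgc : continuous dg.
  by move=> t; exact: continuous_comp (turnc t) (@aaC _).
have gc : continuous gg.
  by move=> t; exact: is_derive1_continuous (gd t).
have per : turn (2 * pi) x = turn 0 x.
  by rewrite /turn mulr_natl cos2pi sin2pi cos0 sin0.
have mean : Rintegral mu `[0, 2 * pi] gg = 0.
  by rewrite (Rintegral_derive gc (ltW pi0) hd) per subrr.
have := wirtinger gd dgc _ mean; rewrite {1}/gg per => /(_ erefl) W.
have c1 : continuous (fun t => gg t ^+ 2).
  by move=> t; exact: continuous_comp (@gc t) (@exprn_continuous _ 2 _).
have c2 : continuous (fun t => dg t ^+ 2).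
  by move=> t; exact: continuous_comp (@dgc t) (@exprn_continuous _ 2 _).
have c3 : continuous (fun t => dg t ^+ 2 - gg t ^+ 2).
  by move=> t; exact: continuousB (@c2 t) (@c1 t).
have -> : (fun t => G (turn t x)) = (fun t => wk 3 x * (dg t ^+ 2 - gg t ^+ 2)).
  by apply/funext => t; rewrite /G wE.
rewrite (RintegralZl _ _ (continuous_itv_integrable _ _ c3))// mulr_ge0//.
rewrite (RintegralB _ (continuous_itv_integrable _ _ c2) (continuous_itv_integrable _ _ c1))//.
by rewrite subr_ge0.
Qed.

End CirclePoincare.

(** Twice the first hypothesis plus the second: the terms in [q] cancel exactly, and 2 ((N - 1) /
    2)^2 - 2 = (N + 1)(N - 3) / 2. *)
Lemma lower_bound_arith (R : realType) (N q r L T d c : R) :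
  ((N - 1) / 2) ^+ 2 * c - (N - 1) / 2 * q + 1 / 4 * r <= d -> (N - 1) * q <= T ->
  L + 1 / 2 * r + (N + 1) * (N - 3) / 2 * c <= L + T + 2 * (d - c).
Proof. by move=> h1 h2; nra. Qed.

(** * The identity and the lower bound for hyperbolic norms *)

Section Norms.
#[local] Unset Implicit Arguments.
Variables (R : realType) (n : nat).
Notation V := 'rV[R]_n.
Variables (K : set V) (cK : compact K) (KO : K `<=` @pball R n).
Variable (u : V -> R).
Hypotheses (n2 : (2 <= n)%N) (u2 : C2 u) (u0 : off K u).

Lemma sphere_poincare :
  (n%:R - 1) * iint (fun x => wk 3 x * \sum_(j < n) del j u x ^+ 2) <=
  iint (fun x => wk 3 x * (\sum_(j < n) del j (del j u) x) ^+ 2).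
Proof.
have [n3|] := ltnP 2 n; first exact: (@sphere_poincare_ge3 _ _ K).
move=> n2'; have E : n = 2 by apply/eqP; rewrite eqn_leq n2'.
(* All data depending on [n] are generalised before it is replaced by 2. *)
move: K cK KO u u2 u0; clear n2 n2' u2 u0 u KO cK K; rewrite E => K cK KO u u2 u0.
have -> : 2%:R - 1 = 1 :> R by ring.
by rewrite mul1r; exact: (@sphere_poincare_2 _ K).
Qed.

(** On the punctured ball [v j], [dv j], [lr] and [lt] are respectively [Lop j u],
    [d_rho (Lop j u)], [lapRho u] and [lapH u - lapRho u]. *)
Let v j (x : V) := kk x * del j u x.
Let dv j (x : V) := kk x * (kk x * eul (del j u) x - cc x * del j u x).
Let lr (x : V) := kk x ^+ 2 * eul (eul u) x + (n%:R - 2) * cc x * kk x * eul u x.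
Let lt (x : V) := kk x ^+ 2 * \sum_(j < n) del j (del j u) x.
Let J f := iint (fun x : V => lam x ^+ n * f x).

Let yC j : C1O (del j u). Proof. exact: C1O_del. Qed.
Let y0 j : off K (del j u). Proof. exact: off_del. Qed.
Let vC j : C1O (v j). Proof. exact: (C1O_M (radgrad_kk R n).1 (yC j)).1. Qed.
Let v0 j : off K (v j). Proof. by move=> x Kx; rewrite /v y0// mulr0. Qed.
Let dv0 j : off K (dv j).
Proof. by move=> x Kx; rewrite /dv (off_eul cK (y0 j))// y0// !mulr0 subrr mulr0. Qed.
Let dvC j : C0O (dv j).
Proof. by have h := yC j; rewrite /dv; C0O_tac. Qed.
Let lr0 : off K lr.
Proof.
by move=> x Kx; rewrite /lr (off_eul cK (off_eul cK u0))// (off_eul cK u0)// !mulr0 addr0.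
Qed.
Let lrC : C0O lr.
Proof. by rewrite /lr; C0O_tac. Qed.
Let lt0' : off K lt.
Proof.
move=> x Kx; rewrite /lt big1 ?mulr0// => j _; by rewrite (off_del cK j (y0 j)).
Qed.
Let ltC : C0O lt.
Proof. by rewrite /lt; C0O_tac. Qed.
Let ucsJ f : C0O f -> off K f -> ucs (fun x : V => lam x ^+ n * f x).
Proof.
move=> fC f0; apply: (C0O_ucs cK KO); last by move=> x Kx; rewrite f0// mulr0.
by apply: C0O_M fC; C0O_tac.
Qed.
Let JD f g : C0O f -> off K f -> C0O g -> off K g -> J (fun x => f x + g x) = J f + J g.
Proof.
move=> fC f0 gC g0; rewrite /J -(iintD (ucsJ _ fC f0) (ucsJ _ gC g0)).
by congr iint; apply/funext => x; rewrite mulrDr.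
Qed.
Let JZ a f : C0O f -> off K f -> J (fun x => a * f x) = a * J f.
Proof.
move=> fC f0; rewrite /J -(iintZ _ (ucsJ _ fC f0)).
by congr iint; apply/funext => x; rewrite mulrCA.
Qed.
Let Jeq f g : off K f -> off K g -> (forall x, pball x -> f x = g x) -> J f = J g.
Proof.
move=> f0 g0 fg; apply: (eq_iint_off KO) => [x Kx|x Kx|x xO].
- by rewrite f0// mulr0.
- by rewrite g0// mulr0.
- by rewrite fg.
Qed.
Let sqrC (f : V -> R) : C0O f -> C0O (fun x => f x ^+ 2). Proof. exact: C0O_X. Qed.
Let sqr0 (f : V -> R) : off K f -> off K (fun x => f x ^+ 2).
Proof. by move=> f0 x Kx; rewrite f0// expr0n. Qed.
Let mul0 (f g : V -> R) : off K g -> off K (fun x => f x * g x).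
Proof. by move=> g0 x Kx; rewrite g0// mulr0. Qed.

Let ccC : C0O (fun x : V => cc x). Proof. exact: C0O_cc. Qed.
Let kkC : C0O (fun x : V => kk x). Proof. exact: C0O_kk. Qed.
Let rC : C0O (fun x : V => (rho x)^-1). Proof. exact: C0O_rhoV. Qed.
Let vC0 j : C0O (v j). Proof. exact: C1O_C0O. Qed.

(** Squared norms of L_j u multiplied by coth rho, 1 / sinh rho, 1 / rho and 1; [DV j] is that of
    d_rho (L_j u). *)
Let CV j := J (fun x => (cc x * v j x) ^+ 2).
Let KV j := J (fun x => (kk x * v j x) ^+ 2).
Let RV j := J (fun x => ((rho x)^-1 * v j x) ^+ 2).
Let V0 j := J (fun x => v j x ^+ 2).
Let DV j := J (fun x => dv j x ^+ 2).

Let CVC j : C0O (fun x => (cc x * v j x) ^+ 2). Proof. exact: sqrC _ (C0O_M ccC (vC0 j)). Qed.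
Let KVC j : C0O (fun x => (kk x * v j x) ^+ 2). Proof. exact: sqrC _ (C0O_M kkC (vC0 j)). Qed.
Let RVC j : C0O (fun x => ((rho x)^-1 * v j x) ^+ 2).
Proof. exact: sqrC _ (C0O_M rC (vC0 j)). Qed.
Let CV0 j : off K (fun x => (cc x * v j x) ^+ 2). Proof. exact/sqr0/mul0. Qed.
Let KV0 j : off K (fun x => (kk x * v j x) ^+ 2). Proof. exact/sqr0/mul0. Qed.
Let RV0 j : off K (fun x => ((rho x)^-1 * v j x) ^+ 2). Proof. exact/sqr0/mul0. Qed.

Lemma hnorm_lapRho : hnorm (lapRho u) ^+ 2 = J (fun x => lr x ^+ 2).
Proof.
apply: (hnorm_sqr KO (off_lapRho cK u0) lr0) => x xO; exact: lapRhoE.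
Qed.

Lemma hnorm_lapH_sub : hnorm (fun x => lapH u x - lapRho u x) ^+ 2 = J (fun x => lt x ^+ 2).
Proof.
apply: (hnorm_sqr KO _ lt0') => [x Kx|x xO]; last exact: lapH_lapRho.
by rewrite (off_lapH cK u0)// (off_lapRho cK u0)// subrr.
Qed.

Lemma hnorm_lapH : hnorm (lapH u) ^+ 2 =
  hnorm (lapRho u) ^+ 2 + hnorm (fun x => lapH u x - lapRho u x) ^+ 2
  + 2 * (\sum_(j < n) DV j - \sum_(j < n) CV j).
Proof.
have s0 : off K (fun x => lr x + lt x) by move=> x Kx; rewrite lr0// lt0'// addr0.
rewrite (hnorm_sqr KO (off_lapH cK u0) s0) => [|x xO]; last first.
  by rewrite /lr -lapRhoE// /lt -lapH_lapRho// addrC subrK.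
rewrite hnorm_lapRho hnorm_lapH_sub -/(J _).
have -> : (fun x => (lr x + lt x) ^+ 2) =
    (fun x => (lr x ^+ 2 + lt x ^+ 2) + 2 * (lr x * lt x)).
  by apply/funext => x; ring.
have lC : C0O (fun x => lr x * lt x) by exact: C0O_M.
have l0 : off K (fun x => lr x * lt x) by exact: mul0.
rewrite JD; last 4 first.
- exact: C0O_D (sqrC _ lrC) (sqrC _ ltC).
- by move=> x Kx; rewrite (sqr0 _ lr0)// (sqr0 _ lt0')// addr0.
- exact: C0O_M (@C0O_cst _ _ 2) lC.
- by move=> x Kx; rewrite l0// mulr0.
rewrite (JD _ _ (sqrC _ lrC) (sqr0 _ lr0) (sqrC _ ltC) (sqr0 _ lt0')) (JZ 2 _ lC l0).
congr (_ + 2 * _); rewrite [LHS](iint_cross cK KO u2 u0) -sumrB; apply: eq_bigr => j _.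
rewrite -[CV j]mul1r -[RHS]/(DV j - 1 * CV j) -mulNr /CV -(JZ (-1) _ (CVC j) (CV0 j)).
have NC : C0O (fun x => -1 * (cc x * v j x) ^+ 2) by exact: C0O_M (@C0O_cst _ _ (-1)) (CVC j).
have N0 : off K (fun x => -1 * (cc x * v j x) ^+ 2) by exact: mul0.
rewrite /DV -(JD _ _ (sqrC _ (dvC j)) (sqr0 _ (dv0 j)) NC N0); congr iint; apply/funext => x.
by rewrite mulN1r.
Qed.

(** From coth^2 = 1 + 1 / sinh^2: the single negative term left by the cross term becomes the last
    two terms of the identity. *)
Lemma CV_split j : CV j = V0 j + KV j.
Proof.
rewrite /V0 /KV -(JD _ _ (sqrC _ (vC0 j)) (sqr0 _ (v0 j)) (KVC j) (KV0 j)); apply: Jeq => //.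
  by move=> x Kx; rewrite (sqr0 _ (v0 j))// KV0// addr0.
move=> x xO; rewrite [LHS]exprMn sqr_cc//; move: (v j x) => *; ring.
Qed.

Lemma hnorm_d_rho_Lop j : hnorm (d_rho (Lop j u)) ^+ 2 = DV j.
Proof.
have L0 : off K (Lop j u) by exact: off_Lop.
apply: (hnorm_sqr KO (off_d_rho cK L0) (dv0 j)) => x xO.
exact: d_rho_Lop.
Qed.

Lemma hnorm_Lop j : hnorm (Lop j u) ^+ 2 = V0 j.
Proof.
have L0 : off K (Lop j u) by exact: off_Lop.
by apply: (hnorm_sqr KO L0 (v0 j)) => x xO; exact: LopE.
Qed.

Lemma hnorm_Lop_sinh j : hnorm (fun x => Lop j u x / sinh (rho x)) ^+ 2 = KV j.
Proof.
apply: (hnorm_sqr KO _ (mul0 _ _ (v0 j))) => [x Kx|x xO].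
  by rewrite (off_Lop cK u0)// mul0r.
by rewrite sinh_rho// invrK LopE// mulrC.
Qed.

Lemma hnorm_Lop_rho j : hnorm (fun x => Lop j u x / rho x) ^+ 2 = RV j.
Proof.
apply: (hnorm_sqr KO _ (mul0 _ _ (v0 j))) => [x Kx|x xO].
  by rewrite (off_Lop cK u0)// mul0r.
by rewrite LopE// mulrC.
Qed.

Lemma hnorm_coth_Lop j : hnorm (fun x => coth (rho x) * Lop j u x) ^+ 2 = CV j.
Proof.
apply: (hnorm_sqr KO _ (mul0 _ _ (v0 j))) => [x Kx|x xO].
  by rewrite (off_Lop cK u0)// mulr0.
by rewrite coth_rho// LopE.
Qed.

Lemma hardy_Lop j : ((n%:R - 1) / 2) ^+ 2 * CV j - (n%:R - 1) / 2 * KV j + 1 / 4 * RV j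
  <= DV j.
Proof.
have := iint_hardy cK KO (vC j) (v0 j).
have -> : iint (fun x => lam x ^+ n * (kk x * eul (v j) x) ^+ 2) = DV j.
  apply: Jeq => [||x xO].
  - exact/sqr0/mul0/off_eul.
  - exact: sqr0.
  - by rewrite /v eul_kk_mul.
congr (_ <= _); set a := (n%:R - 1) / 2.
have C1 := C0O_M (@C0O_cst R n (a ^+ 2)) (CVC j).
have C2 := C0O_M (@C0O_cst R n (- a)) (KVC j).
have C3 := C0O_M (@C0O_cst R n (1 / 4)) (RVC j).
have Z1 := mul0 (fun=> a ^+ 2) _ (CV0 j).
have Z2 := mul0 (fun=> - a) _ (KV0 j).
have Z3 := mul0 (fun=> 1 / 4) _ (RV0 j).
have Z12 : off K (fun x => a ^+ 2 * (cc x * v j x) ^+ 2 + - a * (kk x * v j x) ^+ 2).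
  by move=> x Kx; rewrite Z1// Z2// addr0.
rewrite /CV /KV /RV -mulNr -(JZ _ _ (CVC j) (CV0 j)) -(JZ _ _ (KVC j) (KV0 j)).
rewrite -(JZ _ _ (RVC j) (RV0 j)) -(JD _ _ C1 Z1 C2 Z2) -(JD _ _ (C0O_D C1 C2) Z12 C3 Z3).
congr iint; apply/funext => x; congr (_ * _).
by rewrite [_ / rho x]mulrC mulNr.
Qed.

(** Both [KV j] and the square of [lt] carry [lam ^+ n] times the fourth power of [kk], that is
    [wk 3], the weight of [sphere_poincare]. *)
Lemma poincare_Lop : (n%:R - 1) * (\sum_(j < n) KV j) <=
  hnorm (fun x => lapH u x - lapRho u x) ^+ 2.
Proof.
rewrite hnorm_lapH_sub.
have -> : \sum_(j < n) KV j = iint (fun x => wk 3 x * \sum_(j < n) del j u x ^+ 2).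
  rewrite /KV /J -iint_sum => [|j]; last exact: ucsJ.
  congr iint; apply/funext => x; rewrite mulr_sumr; apply: eq_bigr => j _.
  rewrite /wk /v; move: (lam x ^+ n) (del j u x) => *; ring.
apply: le_trans sphere_poincare _; rewrite le_eqVlt; apply/orP; left; apply/eqP.
congr iint; apply/funext => x; rewrite /wk /lt.
move: (lam x ^+ n) (\sum_(j < n) _) => *; ring.
Qed.

Lemma hnorm_identity : hnorm (lapH u) ^+ 2 =
  hnorm (lapRho u) ^+ 2
  + hnorm (fun x => lapH u x - lapRho u x) ^+ 2
  + 2 * \sum_(j < n) hnorm (d_rho (Lop j u)) ^+ 2
  - 2 * \sum_(j < n) hnorm (Lop j u) ^+ 2
  - 2 * \sum_(j < n) hnorm (fun x => Lop j u x / sinh (rho x)) ^+ 2.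
Proof.
rewrite hnorm_lapH.
rewrite (eq_bigr DV (fun j _ => hnorm_d_rho_Lop j)) (eq_bigr V0 (fun j _ => hnorm_Lop j)).
rewrite (eq_bigr KV (fun j _ => hnorm_Lop_sinh j)).
have -> : \sum_(j < n) CV j = \sum_(j < n) V0 j + \sum_(j < n) KV j.
  by rewrite -big_split; apply: eq_bigr => j _; exact: CV_split.
move: (hnorm _ ^+ 2) (hnorm _ ^+ 2) (\sum_(j < n) _) (\sum_(j < n) _) (\sum_(j < n) _) => *.
ring.
Qed.

Lemma hnorm_lower_bound : hnorm (lapRho u) ^+ 2
  + 1 / 2 * \sum_(j < n) hnorm (fun x => Lop j u x / rho x) ^+ 2
  + (n%:R + 1) * (n%:R - 3) / 2 *
      \sum_(j < n) hnorm (fun x => coth (rho x) * Lop j u x) ^+ 2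
  <= hnorm (lapH u) ^+ 2.
Proof.
rewrite hnorm_lapH.
rewrite (eq_bigr RV (fun j _ => hnorm_Lop_rho j)) (eq_bigr CV (fun j _ => hnorm_coth_Lop j)).
have := poincare_Lop.
have : ((n%:R - 1) / 2) ^+ 2 * (\sum_(j < n) CV j) - (n%:R - 1) / 2 * (\sum_(j < n) KV j)
    + 1 / 4 * (\sum_(j < n) RV j) <= \sum_(j < n) DV j.
  rewrite !mulr_sumr -sumrB -big_split/=; apply: ler_sum => j _; exact: hardy_Lop.
by move=> h1 h2; exact: lower_bound_arith h1 h2.
Qed.

End Norms.

Theorem theorem1p6 (R : realType) (n : nat) (u : 'rV[R]_n -> R) :
  (2 <= n)%N -> C2c_punctured_ball u ->
  [/\ hnorm (lapH u) ^+ 2 =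
        hnorm (lapRho u) ^+ 2
        + hnorm (fun x => lapH u x - lapRho u x) ^+ 2
        + 2 * \sum_(j < n) hnorm (d_rho (Lop j u)) ^+ 2
        - 2 * \sum_(j < n) hnorm (Lop j u) ^+ 2
        - 2 * \sum_(j < n) hnorm (fun x => Lop j u x / sinh (rho x)) ^+ 2,
      hnorm (lapH u) ^+ 2 >=
        hnorm (lapRho u) ^+ 2
        + 1 / 2 * \sum_(j < n) hnorm (fun x => Lop j u x / rho x) ^+ 2
        + (n%:R + 1) * (n%:R - 3) / 2 *
            \sum_(j < n) hnorm (fun x => coth (rho x) * Lop j u x) ^+ 2
    & (3 <= n)%N -> hnorm (lapH u) >= hnorm (lapRho u)].
Proof.
move=> n2 [u2 [K [cK [KO u0]]]].
have lb := @hnorm_lower_bound _ _ _ cK KO _ n2 u2 u0.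
split=> // [|n3]; first exact: (@hnorm_identity _ _ _ cK KO _ n2 u2 u0).
rewrite -(ler_pXn2r (n := 2))// ?nnegrE ?sqrtr_ge0//; apply: le_trans lb.
have sq0 (f : 'I_n -> R) : 0 <= \sum_(j < n) f j ^+ 2.
  by apply: sumr_ge0 => j _; exact: sqr_ge0.
rewrite -addrA lerDl; apply: addr_ge0; first by apply: mulr_ge0.
apply: mulr_ge0 => //; apply: divr_ge0 => //; apply: mulr_ge0; first by rewrite addr_ge0.
by rewrite subr_ge0 ler_nat.
Qed.
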